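(* Let $n\ge 1$ and let $\nu$ be a partition of $n$. Every eigenvalue of the random-to-random shuffle acting on words of evaluation $\nu$ is of the form $\frac{1}{n^2}\operatorname{eig}(\lambda/\mu)$, where $\lambda$ is a partition of $n$ and $\lambda/\mu$ is a horizontal strip with $\lambda \trianglerighteq \nu$ such that $\mu\neq (n)$ and $\mu \neq (1,1,\dots,1)$ with an odd number of $1$'s, and where $$\operatorname{eig}(\lambda/\mu)=\Big[\tbinom{|\lambda|+1}{2}+\operatorname{diag}(\lambda)\Big]-\Big[\tbinom{|\mu|+1}{2}+\operatorname{diag}(\mu)\Big]=\tbinom{|\lambda|+1}{2}-\tbinom{|\mu|+1}{2}+\operatorname{diag}(\lambda/\mu).$$ Moreover, the multiplicity of an eigenvalue $\frac{1}{n^2}\varepsilon$ is $$\sum_{\substack{\lambda/\mu \text{ a horizontal strip},\ \lambda\vdash n,\\ \lambda\trianglerighteq\nu,\ \operatorname{eig}(\lambda/\mu)=\varepsilon}} K_{\lambda,\nu}\, d^{\mu}.$$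
   Context: Words are finite sequences over an ordered alphabet $\{1,2,\dots,N\}$ with $N$ at least the number of parts of $\nu$; a word has evaluation $\nu=(\nu_1,\nu_2,\dots)$ if it contains $\nu_i$ occurrences of the letter $i$ for each $i$. The random-to-random shuffle on words of evaluation $\nu\vdash n$ is the Markov chain which, from a word $w$, removes the letter in a uniformly random position and reinserts it at a uniformly random one of the $n$ possible positions of the resulting word of length $n-1$; its eigenvalues are the eigenvalues of its transition matrix (rows and columns indexed by words of evaluation $\nu$, $(w,u)$-entry the probability of going from $w$ to $u$ in one step). Partitions are identified with their Young diagrams (row $i$ has $\lambda_i$ left-justified cells, cells indexed by matrix coordinates $(i,j)$). For $\mu\subseteq\lambda$, the skew partition $\lambda/\mu$ is the set of cells of $\lambda$ not in $\mu$; it is a horizontal strip if it has at most one cell in each column. The diagonal index of cell $(i,j)$ is $j-i$; $\operatorname{diag}(\lambda/\mu)$ is the sum of diagonal indices of the cells of $\lambda/\mu$, and $\operatorname{diag}(\lambda)=\operatorname{diag}(\lambda/\emptyset)$. $|\lambda|$ is the sum of the parts. Dominance order: $\lambda\trianglerighteq\nu$ iff $\lambda_1+\dots+\lambda_i\ge \nu_1+\dots+\nu_i$ for all $i$ (missing parts are $0$). $K_{\lambda,\nu}$ is the number of semistandard tableaux of shape $\lambda$ and evaluation (content) $\nu$. A standard tableau of size $m$ has an ascent $i$ if $i=m$, or $i<m$ and $i+1$ lies weakly north and weakly east of $i$; it is a desarrangement tableau if its smallest ascent is even (the empty tableau of size $0$ counts as a desarrangement tableau). $d^{\mu}$ is the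 number of desarrangement tableaux of shape $\mu$. *)

(* Defs.v *)
From HB Require Import structures.
From mathcomp Require Import all_boot all_order all_algebra.

Set Implicit Arguments.
Unset Strict Implicit.
Unset Printing Implicit Defensive.

Import GRing.Theory.
Local Open Scope nat_scope.

(* The list of the (positive) parts, without trailing zeros; the part of index
   [i] (counted from 0) of [la] is [nth 0 la i], which is 0 for a missing
   part. *)
Definition is_part_of (n : nat) (la : seq nat) : bool :=
  [&& sorted geq la, 0 \notin la & sumn la == n].

Record intpart (n : nat) := IntPart {
  parts :> seq nat;
  _ : is_part_of n parts }.

HB.instance Definition _ n := [isSub for @parts n].
HB.instance Definition _ n := [Countable of intpart n by <:].

Lemma intpartP n (la : intpart n) : is_part_of n la.
Proof. exact: (valP la). Qed.

Lemma leq_part la i : i \in la -> i <= sumn la.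
Proof.
elim: la => //= x s IHs; rewrite inE => /orP[/eqP-> | /IHs le_i].
  exact: leq_addr.
exact: leq_trans le_i (leq_addl _ _).
Qed.

Lemma leq_size_sumn la : 0 \notin la -> size la <= sumn la.
Proof.
elim: la => //= x s IHs; rewrite inE negb_or eq_sym -lt0n => /andP[x_gt0 /IHs].
by rewrite -add1n; apply: leq_add.
Qed.

Definition bseq_of_part n (la : intpart n) : n.-bseq 'I_n.+1 :=
  insub_bseq n [seq inord x | x <- parts la].

Definition part_of_bseq n (b : n.-bseq 'I_n.+1) : option (intpart n) :=
  insub [seq val x | x <- b].

Lemma bseq_of_partK n : pcancel (@bseq_of_part n) (@part_of_bseq n).
Proof.
move=> la; have /and3P[_ la0 /eqP sum_la] := intpartP la.
rewrite /part_of_bseq /bseq_of_part /insub_bseq val_insubd size_map.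
rewrite -[X in _ <= X]sum_la leq_size_sumn // -map_comp map_id_in ?valK //.
by move=> i /leq_part; rewrite sum_la /= => le_in; rewrite inordK.
Qed.

HB.instance Definition _ n : isFinite (intpart n) :=
  PCanIsFinite (@bseq_of_partK n).

Definition dominates (la nu : seq nat) : bool :=
  [forall i : 'I_(maxn (size la) (size nu)).+1,
     sumn (take i nu) <= sumn (take i la)].

Lemma dominatesP (la nu : seq nat) :
  reflect (forall i, sumn (take i nu) <= sumn (take i la)) (dominates la nu).
Proof.
apply: (iffP forallP) => [dom i | dom i]; last exact: dom.
have [le_i | /ltnW gt_i] := leqP i (maxn (size la) (size nu)).
  exact: (dom (Ordinal (le_i : i < (maxn (size la) (size nu)).+1))).
have:= dom ord_max; move: gt_i; rewrite geq_max => /andP[la_i nu_i].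
by rewrite /= !take_oversize ?leq_maxl ?leq_maxr.
Qed.

(* Matrix coordinates are counted from 0, which leaves the diagonal index
   [j - i] of a cell [(i, j)] unchanged. *)
Definition cells (la : seq nat) : seq (nat * nat) :=
  [seq (i, j) | i <- iota 0 (size la), j <- iota 0 (nth 0 la i)].

Lemma mem_cells la i j : ((i, j) \in cells la) = (j < nth 0 la i).
Proof.
apply/allpairsPdep/idP => [[i' [j' [_ j'_la [-> ->]]]] | lt_j].
  by move: j'_la; rewrite mem_iota.
exists i, j; rewrite !mem_iota; split=> //=.
by have [le_i | //] := leqP (size la) i; rewrite nth_default in lt_j.
Qed.

Definition skew (la mu : seq nat) : seq (nat * nat) :=
  [seq c <- cells la | c \notin cells mu].

Definition horizontal_strip (la mu : seq nat) : bool :=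
  all (mem (cells la)) (cells mu) && uniq [seq c.2 | c <- skew la mu].

Definition diag_skew (la mu : seq nat) : int :=
  (\sum_(c <- skew la mu) (c.2%:Z - c.1%:Z))%R.

Definition diag (la : seq nat) : int := diag_skew la [::].

Definition eig (la mu : seq nat) : int :=
  ((('C((sumn la).+1, 2))%:Z + diag la)
   - (('C((sumn mu).+1, 2))%:Z + diag mu))%R.

(* A filling of the diagram of [la] is a function on its cells; a value [k] of
   type ['I_m] stands for the entry [k.+1] of {1, ..., m}. *)
Notation cell la := (seq_sub (cells la)).
Notation filling la m := {ffun cell la -> 'I_m}.

Definition same_row la (c d : cell la) : bool := (val c).1 == (val d).1.
Definition same_col la (c d : cell la) : bool := (val c).2 == (val d).2.
Definition left_of la (c d : cell la) : bool := (val c).2 < (val d).2.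
Definition above la (c d : cell la) : bool := (val c).1 < (val d).1.

Definition semistandard la m (T : filling la m) : bool :=
  [forall c, forall d,
     (same_row c d && left_of c d ==> (T c <= T d))
     && (same_col c d && above c d ==> (T c < T d))].

Definition kostka (la nu : seq nat) : nat :=
  #|[set T : filling la (size nu) |
      semistandard T
      && [forall k, #|[set c | T c == k]| == nth 0 nu k]]|.

Definition standard mu (T : filling mu (sumn mu)) : bool :=
  injectiveb T
  && [forall c, forall d,
        (same_row c d && left_of c d ==> (T c < T d))
        && (same_col c d && above c d ==> (T c < T d))].

(* Here [i] is an entry counted from 1. *)
Definition ascent mu (T : filling mu (sumn mu)) (i : nat) : bool :=
  (0 < i <= sumn mu)
  && ((i == sumn mu)
      || [exists c : cell mu, exists d : cell mu,
            [&& (T c).+1 == i, (T d).+1 == i.+1,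
                (val d).1 <= (val c).1 & (val c).2 <= (val d).2]]).

Definition desarrangement mu (T : filling mu (sumn mu)) : bool :=
  (sumn mu == 0)
  || [exists i : 'I_(sumn mu).+1,
        [&& ascent T i, ~~ odd i & [forall j : 'I_i, ~~ ascent T j]]].

Definition desarr_num (mu : seq nat) : nat :=
  #|[set T : filling mu (sumn mu) | standard T && desarrangement T]|.

(* The letters 1, ..., N are represented by the elements 0, ..., N-1 of
   ['I_N]. *)
Definition has_eval n N (nu : seq nat) (w : n.-tuple 'I_N) : bool :=
  [forall a : 'I_N, count_mem a w == nth 0 nu a].

Notation word n N nu := {w : n.-tuple 'I_N | has_eval nu w}.

(* Remove the letter in position [i], then reinsert it so that it ends up in
   position [j]. *)
Definition r2r_move n (A : Type) (w : n.-tuple A) (i j : 'I_n) : seq A :=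
  let v := take i w ++ drop i.+1 w in take j v ++ tnth w i :: drop j v.

Definition r2r_prob (F : fieldType) n (A : eqType) (w u : n.-tuple A) : F :=
  (\sum_(i < n) n%:R^-1 *
     \sum_(j < n) n%:R^-1 * (r2r_move w i j == u :> seq A)%:R)%R.

Definition r2r_mx (F : fieldType) n N (nu : seq nat) :
    'M[F]_#|{: word n N nu}| :=
  (\matrix_(s, t) r2r_prob F (val (enum_val s)) (val (enum_val t)))%R.

(* Main.v *)
Require Import Defs.
From mathcomp Require Import all_boot all_order all_algebra.
From HB Require Import structures.
From mathcomp Require Import all_fingroup mxred spectral mpoly ring zify.

(* Let R be n^2 times the transition operator, acting on all words of length n
   in N letters: R is the sum over the letters c of "delete a c, then insert it
   anywhere".  Let Cas be the Casimir operator of gl_N acting on words, and let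
   T = (Cas - N n)/2 + C(n+1, 2).  Then D = T - R commutes with gl_N and with
   all the operators "insert a letter anywhere".  On the quotient of the words by
   the images of these insertions R vanishes, so that D = T there.

   The traces graded by the content of words are symmetric polynomials X in
   x_1, ..., x_N.  After multiplication by the Vandermonde product, T multiplies
   the coefficient of x^(mu + delta) by C(|mu|+1, 2) + diag(mu) (Freudenthal's
   identity), and this coefficient is d^mu for the trace of the identity on the
   quotient, because both satisfy the same recursion on the corners of mu.  The
   quotient is reached by killing the insertions of one letter c after the
   other, which multiplies the graded traces by 1 - x_c t; conversely, the trace
   on all words is a sum over a box of exponents in which all terms cancel except
   those for which la/mu is a horizontal strip.  Hence D has trace
   sum_mu d^mu (C(|mu|+1, 2) + diag(mu))^j at x^(la + delta), and R^m has trace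
   sum_mu d^mu eig(la/mu)^m.

   The coefficient of x^nu in X is obtained from those of x^(la + delta) in the
   product with the Vandermonde by peeling off one variable at a time, which
   produces the Kostka numbers.  The traces of the powers of the transition
   matrix then determine its characteristic polynomial. *)

Set Implicit Arguments.
Unset Strict Implicit.
Unset Printing Implicit Defensive.

Import GRing.Theory Num.Theory.
Local Open Scope nat_scope.

(** * Partitions and fillings *)

Section Partitions.
Implicit Types (la mu : seq nat) (i j k n : nat).

(** No eigenvector and no irreducible representation is constructed: [R], [T] and [D] are seen only
    through traces. The operator [D] arises because [R] and [T] fail to commute with an insertion by
    exactly the same terms. The factor 1 - x_c t requires the insertion of c to be injective modulo
    those of the smaller letters; this comes from a Weyl algebra relation with the operator that
    strips the first letter. The intermediate quotients need not be stable under gl_N, so symmetry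
    and Freudenthal's identity are used only on all words and on the final quotient. Two coefficient
    rings coexist: subspaces and projections require a field, while weights live in a polynomial
    ring, so projections are built over the field and then mapped. Divisions by x_i or x_i - x_j are
    avoided by cross-multiplied relations and by the Vandermonde factor. *)

Definition is_part la := sorted geq la && (0 \notin la).

Lemma is_part_ofE n la : is_part_of n la = is_part la && (sumn la == n).
Proof. by rewrite /is_part_of /is_part andbA. Qed.

Lemma intpart_part n (la : intpart n) : is_part la.
Proof. by have := intpartP la; rewrite is_part_ofE => /andP[]. Qed.

Lemma intpart_sum n (la : intpart n) : sumn la = n.
Proof. by have := intpartP la; rewrite is_part_ofE => /andP[_ /eqP]. Qed.

Lemma part_nth_anti la i j : is_part la -> i <= j -> nth 0 la j <= nth 0 la i.
Proof.
case/andP=> sla _ le_ij; have [lt_j|/(nth_default 0)-> //] := ltnP j (size la).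
have geq_trans : transitive geq by move=> a b c ab bc; apply: leq_trans bc ab.
have lt_i := leq_ltn_trans le_ij lt_j.
exact: (sorted_leq_nth geq_trans (fun a => leqnn a) 0 sla i j lt_i lt_j le_ij).
Qed.

Lemma part_nth_eq0 la i : is_part la -> (nth 0 la i == 0) = (size la <= i).
Proof.
case/andP=> _ la0; have [le_i|lt_i] := leqP (size la) i.
  by rewrite nth_default.
by apply: contraNF la0 => /eqP <-; apply: mem_nth.
Qed.

Lemma part_eq la mu : is_part la -> is_part mu ->
  (forall i, nth 0 la i = nth 0 mu i) -> la = mu.
Proof.
move=> pla pmu eq_nth; have eq_size : size la = size mu.
  apply/eqP; rewrite eqn_leq -!part_nth_eq0 // eq_nth part_nth_eq0 // leqnn /=.
  by rewrite -eq_nth part_nth_eq0.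
by apply: (eq_from_nth (x0 := 0)).
Qed.

(* Used for nonincreasing [r] that vanish from [L] on, where dropping the zeros
   does not move the parts. *)
Definition part_of_fun L (r : nat -> nat) := [seq x <- mkseq r L | x != 0].

Lemma nth_part_of_fun L (r : nat -> nat) i :
  (forall i, r i.+1 <= r i) -> (forall i, L <= i -> r i = 0) ->
  nth 0 (part_of_fun L r) i = r i.
Proof.
elim: L r i => [|L IHL] r i dec_r r0; first by rewrite nth_nil r0.
rewrite /part_of_fun /mkseq /= -[1]/(0.+1) -add1n iotaDl -map_comp.
have IH := IHL (r \o succn) _ (fun i => dec_r i.+1) (fun i => r0 i.+1).
have [r00|r00] := eqVneq (r 0) 0.
  have rz j : r j = 0 by elim: j => // j rj; have := dec_r j; rewrite rj leqn0 => /eqP.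
  rewrite /= (_ : [seq _ <- _ | _] = [::]) ?nth_nil ?rz //.
  apply/eqP; rewrite -[_ == _]negbK -has_filter.
  by apply/hasPn=> x /mapP[j _ ->]; rewrite /= rz.
by rewrite /=; case: i => //= i; apply: IH.
Qed.

Lemma part_of_fun_part L (r : nat -> nat) :
  (forall i, r i.+1 <= r i) -> is_part (part_of_fun L r).
Proof.
move=> dec_r; rewrite /is_part mem_filter eqxx andbT.
apply: sorted_filter; first by move=> a b c ab bc; apply: leq_trans bc ab.
by apply/(sortedP 0) => i; rewrite size_mkseq => lt_i; rewrite !nth_mkseq //; [exact: dec_r | exact: ltnW].
Qed.

Lemma sumn_nth la : sumn la = \sum_(i < size la) nth 0 la i.
Proof. by rewrite sumnE (big_nth 0) big_mkord. Qed.

Lemma uniq_cells la : uniq (cells la).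
Proof.
apply: allpairs_uniq_dep => [|i _|[i j] [i' j'] _ _ [-> ->]] //; exact: iota_uniq.
Qed.

Lemma size_cells la : size (cells la) = sumn la.
Proof.
rewrite size_allpairs_dep; under eq_map do rewrite size_iota.
by rewrite -/(mkseq _ _) mkseq_nth.
Qed.

Lemma card_cells la : #|{: cell la}| = sumn la.
Proof. by rewrite card_seq_sub ?uniq_cells // size_cells. Qed.

Lemma cells_subP la mu :
  reflect (forall i, nth 0 mu i <= nth 0 la i) (all (mem (cells la)) (cells mu)).
Proof.
apply: (iffP allP) => [sub i|le_nth [i j]].
  rewrite leqNgt; apply/negP=> lt; have := sub (i, nth 0 la i).
  by rewrite /= !mem_cells lt ltnn => /(_ isT).
by rewrite /= !mem_cells => /leq_trans; apply.
Qed.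

Lemma uniq_map_inj (T1 T2 : eqType) (f : T1 -> T2) s :
  uniq (map f s) -> {in s &, injective f}.
Proof.
elim: s => //= a s IHs /andP[fa_s us] x y; rewrite !inE.
case/predU1P=> [->|xs]; case/predU1P=> [->|ys] //; last exact: IHs.
  by move=> fay; rewrite fay map_f in fa_s.
by move=> fxa; rewrite -fxa map_f in fa_s.
Qed.

(** Interlacing is the form in which strips meet the exponents later on. If column j meets rows a <
    b of the skew shape, then mu_a <= j < la_b <= la_(a+1), against interlacing at row a. *)
Lemma hstripP la mu : is_part la -> is_part mu ->
  reflect (forall i, nth 0 mu i <= nth 0 la i /\ nth 0 la i.+1 <= nth 0 mu i)
          (horizontal_strip la mu).
Proof.
move=> pla pmu; have skE (c : nat * nat) : (c \in Defs.skew la mu) = (nth 0 mu c.1 <= c.2 < nth 0 la c.1).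
  by case: c => i j; rewrite mem_filter !mem_cells -leqNgt.
have usk : uniq (Defs.skew la mu) by rewrite filter_uniq ?uniq_cells.
apply: (iffP andP) => [[/cells_subP sub us] i|Hh]; last first.
  split; first by apply/cells_subP=> i; case: (Hh i).
  rewrite map_inj_in_uniq // => -[i j] [i' j'].
  rewrite !skE /= => /andP[mu1 la1] /andP[mu2 la2] eq_j; rewrite -eq_j in mu2 la2 *.
  suff -> : i = i' by [].
  have main a b : a < b -> nth 0 mu a <= j -> j < nth 0 la b -> False.
    move=> lt_ab mu_j j_la; have [_] := Hh a.
    have := part_nth_anti pla lt_ab; lia.
  have [/main|/main|//] := ltngtP i i'; by case.
(* Otherwise rows [i] and [i.+1] of the skew shape both contain a cell in column [j], the first
   column of row [i] outside [mu]. *)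
split=> //; rewrite leqNgt; apply/negP=> lt_mu; set j := nth 0 mu i in lt_mu.
have in1 : (i, j) \in Defs.skew la mu.
  rewrite skE /= leqnn; apply: leq_trans lt_mu _; exact: part_nth_anti.
have in2 : (i.+1, j) \in Defs.skew la mu by rewrite skE /= lt_mu andbT part_nth_anti.
by have := uniq_map_inj us in1 in2 erefl; case=> /n_Sn.
Qed.

End Partitions.

Section Extension.
Variables (la mu : seq nat) (m : nat).
Hypothesis sub : forall i, nth 0 mu i <= nth 0 la i.

Lemma sub_cells c : c \in cells mu -> c \in cells la.
Proof. by case: c => i j; rewrite !mem_cells => /leq_trans; apply. Qed.

Definition wid (c : cell mu) : cell la := SeqSub (sub_cells (valP c)).

Lemma wid_inj : injective wid.
Proof. by move=> c d /(congr1 val) /= /val_inj. Qed.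

Lemma widP (c : cell la) : val c \in cells mu -> exists d, c = wid d.
Proof. by move=> c_mu; exists (SeqSub c_mu); apply: val_inj. Qed.

(* The cells of [la] outside [mu] receive the largest entry. *)
Definition ext (T : filling mu m) : filling la m.+1 :=
  [ffun c => if insub (val c) is Some d then widen_ord (leqnSn m) (T d) else ord_max].

Lemma ext_wid T c : ext T (wid c) = T c :> nat.
Proof. by rewrite ffunE /= valK. Qed.

Lemma ext_out T c : val c \notin cells mu -> ext T c = m :> nat.
Proof. by move=> c_mu; rewrite ffunE insubN. Qed.

Lemma ext_lt T c : (ext T c < m) = (val c \in cells mu).
Proof.
case: (boolP (val c \in cells mu)) => [/widP[d ->]|/ext_out->]; last exact: ltnn.
by rewrite ext_wid ltn_ord.
Qed.

Lemma ext_inj : injective ext.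
Proof.
move=> T T' eqT; apply/ffunP=> c; apply: val_inj.
by rewrite /= -!ext_wid eqT.
Qed.

Lemma ext_onto (T : filling la m.+1) :
  (forall c, (T c < m) = (val c \in cells mu)) -> exists T', T = ext T'.
Proof.
move=> shT; have lt_T (c : cell mu) : T (wid c) < m by rewrite shT (valP c).
exists [ffun c => Ordinal (lt_T c)]; apply/ffunP=> c; apply: val_inj.
have [/widP[d ->]|c_mu] := boolP (val c \in cells mu).
  by rewrite [RHS]ext_wid ffunE.
apply/eqP; by rewrite [X in _ == X]ext_out // eqn_leq -ltnS ltn_ord leqNgt shT.
Qed.

Lemma card_ext_val T k : k < m ->
  #|[set c | ext T c == k :> nat]| = #|[set c | T c == k :> nat]|.
Proof.
move=> lt_km; rewrite -(card_imset _ wid_inj); apply: eq_card => c.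
rewrite inE; apply/eqP/imsetP=> [Tc|[d + ->]]; last by rewrite inE ext_wid => /eqP.
have /widP[d def_c] : val c \in cells mu by rewrite -(ext_lt T) Tc.
by exists d => //; rewrite inE -ext_wid -def_c Tc.
Qed.

Lemma card_ext_max T : sumn mu + #|[set c | ext T c == m :> nat]| = sumn la.
Proof.
rewrite -!card_cells -(card_imset _ wid_inj) -(cardsC [set wid c | c in [set: cell mu]]).
congr (_ + _).
  by apply: eq_card => c; apply/imsetP/imsetP=> -[d _ ->]; exists d.
apply: eq_card => c; rewrite !inE.
have -> : (ext T c == m :> nat) = (val c \notin cells mu).
  by rewrite -(ext_lt T) -leqNgt eqn_leq -ltnS ltn_ord.
congr (~~ _); by apply/idP/imsetP=> [/widP[d ->]|[d _ ->]]; [exists d; rewrite ?inE|exact: (valP d)].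
Qed.

End Extension.

(** A downward closed set of naturals is an initial segment, so its count below [L] is its end. This
    turns an order ideal of cells into row lengths. *)
Lemma count_ideal (p : pred nat) L j :
  (forall j1 j2, p j1 -> j2 <= j1 -> p j2) ->
  (j < count p (iota 0 L)) = p j && (j < L).
Proof.
move=> p_ideal; elim: L j => [|L IHL] j; first by rewrite andbF.
rewrite -[in iota _ _]addn1 iotaD count_cat /= add0n addn0 ltnS.
have [pL|npL] := boolP (p L); last first.
  rewrite addn0 IHL; have [->|ne_jL] := eqVneq j L; first by rewrite (negPf npL).
  by rewrite [in RHS]leq_eqVlt (negPf ne_jL).
have -> : count p (iota 0 L) = L.
  apply/eqP; rewrite -[X in _ == X](size_iota 0) -all_count.
  by apply/allP=> i; rewrite mem_iota => /andP[_ /ltnW]; apply: p_ideal.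
by rewrite addn1 ltnS andbC andb_idr //; apply: p_ideal.
Qed.

Section Shape.
Variables (n : nat) (la : intpart n) (m : nat).
Implicit Type T : filling la m.+1.

Definition shaped T (mu : seq nat) := [forall c, (T c < m) == (val c \in cells mu)].

(** The cells with entry below [m] form an order ideal of [la]. The weak inequality along columns
    lets the lemma serve standard and semistandard fillings alike. *)
Lemma shape_exists T :
  (forall c d : cell la, same_row c d -> left_of c d -> T c <= T d) ->
  (forall c d : cell la, same_col c d -> above c d -> T c <= T d) ->
  exists mu : seq nat, [/\ is_part mu, forall i, nth 0 mu i <= nth 0 la i & shaped T mu].
Proof.
move=> rowT colT; have pla := intpart_part la.
pose S i j := if insub (i, j) is Some c then T (c : cell la) < m else false.
have SE (c : cell la) : S (val c).1 (val c).2 = (T c < m).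
  by rewrite /S -surjective_pairing valK.
have SP i j : S i j -> exists c : cell la, [/\ val c = (i, j), T c < m & j < nth 0 la i].
  rewrite /S; case: insubP => // c c_la vc Tc; exists c; split=> //.
  by rewrite -mem_cells.
have SS i j i' j' : S i j -> i' <= i -> j' <= j -> S i' j'.
  case/SP=> c [vc Tc j_la] le_i le_j.
  have in1 : (i, j') \in cells la by rewrite mem_cells (leq_ltn_trans le_j).
  have in2 : (i', j') \in cells la.
    by rewrite mem_cells (leq_ltn_trans le_j) // (leq_trans j_la) // part_nth_anti.
  have -> := SE (SeqSub in2 : cell la); apply: leq_ltn_trans Tc.
  apply: (@leq_trans (T (SeqSub in1))).
    have [eq_i|ne_i] := eqVneq i i'.
      by rewrite (_ : SeqSub in2 = SeqSub in1) //; apply: val_inj; rewrite /= eq_i.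
    apply: colT; rewrite /same_col /above //=.
    by rewrite ltn_neqAle eq_sym ne_i.
  have [eq_j|ne_j] := eqVneq j j'.
    rewrite (_ : SeqSub in1 = c) //; apply: val_inj; by rewrite vc eq_j.
  apply: rowT; rewrite /same_row /left_of vc //=.
  by rewrite ltn_neqAle eq_sym ne_j.
pose r i := count (S i) (iota 0 (nth 0 la i)).
have rE i j : (j < r i) = S i j.
  rewrite count_ideal => [|j1 j2 Sj1 le_j]; last exact: SS Sj1 _ le_j.
  by rewrite andb_idr // => /SP[c []].
have dec_r i : r i.+1 <= r i.
  have [->//|] := posnP (r i.+1); case: (r i.+1) (rE i.+1) => // k Sk _.
  by rewrite rE (SS i.+1 k) // -Sk ltnSn.
have r_la i : r i <= nth 0 la i.
  by rewrite -[X in _ <= X](size_iota 0) count_size.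
have r0 i : size la <= i -> r i = 0.
  by move=> le_i; apply/eqP; rewrite -leqn0 (leq_trans (r_la i)) // nth_default.
exists (part_of_fun (size la) r); split.
- exact: part_of_fun_part.
- by move=> i; rewrite nth_part_of_fun.
apply/forallP=> c; rewrite -SE (surjective_pairing (val c)) mem_cells.
by rewrite nth_part_of_fun // rE.
Qed.

End Shape.

Lemma sum_by_shape (X I : finType) (A : {set X}) (Q : pred I) (sh : X -> I -> bool) :
  (forall T, T \in A -> exists2 i, Q i && sh T i &
     forall j, Q j -> sh T j -> j = i) ->
  #|A| = \sum_(i | Q i) #|[set T in A | sh T i]|.
Proof.
move=> ex_sh; rewrite -sum1_card.
transitivity (\sum_(T in A) \sum_(i | Q i && sh T i) 1).
  apply: eq_bigr => T /ex_sh[i Qi uniq_i]; rewrite (big_pred1 i) // => j.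
  apply/idP/eqP=> [/andP[]|->//]; exact: uniq_i.
rewrite (exchange_big_dep Q) /=; last by move=> T i _ /andP[].
apply: eq_bigr => i Qi; rewrite -sum1_card; apply: eq_bigl => T.
by rewrite inE Qi.
Qed.

(** Unlike in [kostka], the number of letters is a separate parameter, so that an induction can
    remove the largest letter and trailing zero multiplicities can be added. *)
Definition kost la m (c : nat -> nat) :=
  #|[set T : filling la m | semistandard T
      && [forall k : 'I_m, #|[set p | T p == k]| == c k]]|.

Lemma kostkaE la nu : kostka la nu = kost la (size nu) (nth 0 nu).
Proof. by []. Qed.

(** [shaped] tests only the cells of [la]; the two inclusions make this enough to determine the
    shape. *)
Lemma shaped_uniq n (la : intpart n) m (T : filling la m.+1) mu mu' :
  is_part mu -> is_part mu' ->
  (forall i, nth 0 mu i <= nth 0 la i) -> (forall i, nth 0 mu' i <= nth 0 la i) ->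
  shaped T mu -> shaped T mu' -> mu = mu'.
Proof.
move=> pmu pmu' sub sub' /forallP sh /forallP sh'.
have cE c : c \in cells la -> (c \in cells mu) = (c \in cells mu').
  by move=> c_la; have /eqP<- := sh (SeqSub c_la); have /eqP-> := sh' (SeqSub c_la).
apply: part_eq => // i; apply/eqP; rewrite eqn_leq.
apply/andP; split; rewrite leqNgt; apply/negP=> lt_mu.
  have c_la : (i, nth 0 mu' i) \in cells la.
    by rewrite mem_cells (leq_trans lt_mu).
  by have := cE _ c_la; rewrite !mem_cells lt_mu ltnn.
have c_la : (i, nth 0 mu i) \in cells la.
  by rewrite mem_cells (leq_trans lt_mu).
by have := cE _ c_la; rewrite !mem_cells lt_mu ltnn.
Qed.

Lemma semistandardP la m (T : filling la m) :
  reflect ((forall c d : cell la, same_row c d -> left_of c d -> T c <= T d) /\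
           (forall c d : cell la, same_col c d -> above c d -> T c < T d))
          (semistandard T).
Proof.
apply: (iffP forallP) => [H|[rowT colT] c].
  by split=> c d rcd lcd; have /forallP/(_ d)/andP[] := H c; rewrite rcd lcd.
apply/forallP=> d; apply/andP; split; apply/implyP=> /andP[].
  exact: rowT.
exact: colT.
Qed.

(** Branching rule: by strictness along columns, the [r] cells carrying the largest entry form a
    horizontal strip, and any such strip can be filled with it. *)
Lemma kost_rec n (la : intpart n) k r m c : n = k + r -> c m = r ->
  kost la m.+1 c = \sum_(mu : intpart k | horizontal_strip la mu) kost mu m c.
Proof.
move=> n_kr cm; have pla := intpart_part la.
rewrite /kost (sum_by_shape (Q := fun mu : intpart k => horizontal_strip la mu)
  (sh := fun T (mu : intpart k) => shaped T mu)); last first.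
  move=> T; rewrite inE => /andP[/semistandardP[rowT colT] /forallP contT].
  have [mu [pmu sub shT]] := shape_exists rowT (fun c d h1 h2 => ltnW (colT c d h1 h2)).
  have [T' eqT] := ext_onto sub (fun c => eqP (forallP shT c)).
  have sum_mu : sumn mu = k.
    have := card_ext_max sub T'; rewrite -eqT intpart_sum.
    have /eqP := contT ord_max; rewrite /= cm => card_m e.
    have : sumn mu + r = n by rewrite -e -card_m; congr (_ + _); apply: eq_card => c'; rewrite !inE.
    by move: n_kr; lia.
  have pmuk : is_part_of k mu by rewrite is_part_ofE pmu sum_mu /=.
  exists (IntPart pmuk) => [|mu' /(hstripP pla (intpart_part mu')) H sh'].
    rewrite shT andbT; apply/hstripP => // i; split; first exact: sub.
    rewrite leqNgt; apply/negP=> lt_mu; set j := nth 0 mu i in lt_mu.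
    have in2 : (i.+1, j) \in cells la by rewrite mem_cells.
    have in1 : (i, j) \in cells la.
      by rewrite mem_cells (leq_trans lt_mu) // part_nth_anti.
    have := colT (SeqSub in1) (SeqSub in2); rewrite /same_col /above /= eqxx ltnSn.
    move/(_ isT isT); rewrite ltnNge => /negP; apply.
    have /eqP := forallP shT (SeqSub in1); rewrite /= mem_cells ltnn => /negbT.
    by rewrite -leqNgt; apply: leq_trans; rewrite -ltnS ltn_ord.
  apply: val_inj => /=.
  by apply: (shaped_uniq (intpart_part mu') pmu _ sub sh' shT) => i; case: (H i).
apply: eq_bigr => mu /(hstripP pla (intpart_part mu)) hs.
have sub i : nth 0 mu i <= nth 0 la i by case: (hs i).
rewrite -(card_imset _ (@ext_inj la mu m sub)); apply: eq_card => T.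
apply/idP/imsetP; rewrite !inE.
  case/andP=> /andP[/semistandardP[rowT colT] /forallP contT] shT.
  have [T' eqT] := ext_onto sub (fun c => eqP (forallP shT c)).
  exists T' => //; rewrite inE; apply/andP; split.
    apply/semistandardP; split=> a b ab1 ab2.
      by have := rowT (wid sub a) (wid sub b) ab1 ab2; rewrite eqT !ext_wid.
    by have := colT (wid sub a) (wid sub b) ab1 ab2; rewrite eqT !ext_wid.
  apply/forallP=> i; have /eqP <- := contT (widen_ord (leqnSn m) i).
  by rewrite eqT; apply/eqP/esym; apply: (card_ext_val sub T' (ltn_ord i)).
case=> T'; rewrite inE => /andP[/semistandardP[rowT colT] /forallP contT] ->.
have inmu a b : (val a).1 <= (val b).1 -> (val a).2 <= (val b).2 ->
    val b \in cells mu -> val (a : cell la) \in cells mu.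
  case: (val a) (val b : nat * nat) => i j [i' j'] /= le_i le_j; rewrite !mem_cells => lt_j'.
  by rewrite (leq_ltn_trans le_j) // (leq_trans lt_j') // part_nth_anti ?intpart_part.
apply/andP; split; last by apply/forallP=> p; rewrite ext_lt.
apply/andP; split.
  apply/semistandardP; split=> a b /eqP ab1 ab2.
    have [/[dup] b_mu /widP-/(_ sub)[b' eb]|b_mu] := boolP (val b \in cells mu).
      have /widP-/(_ sub)[a' ea] : val a \in cells mu.
        by apply: inmu b_mu; [rewrite ab1 | apply: ltnW].
      rewrite ea eb !ext_wid; apply: rowT; rewrite /same_row /left_of.
        by move: ab1; rewrite ea eb /= => ->.
      by move: ab2; rewrite ea eb.
    by rewrite [X in _ <= X]ext_out // -ltnS ltn_ord.
  have [/[dup] b_mu /widP-/(_ sub)[b' eb]|b_mu] := boolP (val b \in cells mu).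
    have /widP-/(_ sub)[a' ea] : val a \in cells mu.
      by apply: inmu b_mu; [apply: ltnW | rewrite ab1].
    rewrite ea eb !ext_wid; apply: colT; rewrite /same_col /above.
      by move: ab1; rewrite ea eb /= => ->.
    by move: ab2; rewrite ea eb.
  (* Here [b] carries the largest entry. Interlacing puts every cell above [b] in its column into
     [mu], where entries are smaller. *)
  rewrite [X in _ < X]ext_out // (ext_lt sub).
  have := valP b; move: ab1 ab2; rewrite /above.
  case: (val a) (val b) => i j [i' j'] /= -> lt_i; rewrite !mem_cells => lt_j'.
  have [_] := hs i; apply: leq_trans; apply: leq_trans lt_j' _.
  by apply: part_nth_anti.
apply/forallP=> i; have [lt_im|le_mi] := ltnP i m.
  have /eqP <- := contT (Ordinal lt_im).
  by apply/eqP/(card_ext_val sub T' lt_im).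
have -> : i = ord_max by apply: val_inj; apply/eqP; rewrite eqn_leq le_mi -ltnS ltn_ord.
rewrite /= cm; have := card_ext_max sub T'; rewrite !intpart_sum => e.
have : k + #|[set p | ext la T' p == m :> nat]| = k + r by rewrite e.
by move/addnI=> <-; apply/eqP/eq_card => p; rewrite !inE.
Qed.

(** * Standard fillings and their ascents *)

Section StandardFillings.
Variables (mu : seq nat) (m : nat).
Implicit Types (T : filling mu m) (c d : cell mu).

(* [std], [asc] and [des] are the notions of the statement for fillings with
   values in an arbitrary ['I_m]; for [m = sumn mu] they unfold to the same terms. *)
Definition std T := injectiveb T
  && [forall c, forall d,
        (same_row c d && left_of c d ==> (T c < T d))
        && (same_col c d && above c d ==> (T c < T d))].

Definition asc T (i : nat) := (0 < i <= m)
  && ((i == m)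
      || [exists c : cell mu, exists d : cell mu,
            [&& (T c).+1 == i, (T d).+1 == i.+1,
                (val d).1 <= (val c).1 & (val c).2 <= (val d).2]]).

Definition des T := (m == 0)
  || [exists i : 'I_m.+1, [&& asc T i, ~~ odd i & [forall j : 'I_i, ~~ asc T j]]].

Lemma stdP T : reflect [/\ injective T,
    forall c d, same_row c d -> left_of c d -> T c < T d
  & forall c d, same_col c d -> above c d -> T c < T d] (std T).
Proof.
apply: (iffP andP) => [[/injectiveP injT /forallP H]|[injT rowT colT]].
  by split=> // c d rcd lcd; have /forallP/(_ d)/andP[] := H c; rewrite rcd lcd.
split; first exact/injectiveP.
apply/forallP=> c; apply/forallP=> d; apply/andP; split; apply/implyP=> /andP[].
  exact: rowT.
exact: colT.
Qed.

Lemma std_le T c d : std T ->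
  (val c).1 <= (val d).1 -> (val c).2 <= (val d).2 -> is_part mu -> T c <= T d.
Proof.
case/stdP=> _ rowT colT le1 le2 pmu.
have e_la : ((val c).1, (val d).2) \in cells mu.
  rewrite mem_cells; have := valP d; rewrite [val d]surjective_pairing mem_cells.
  by move/leq_trans; apply; apply: part_nth_anti.
pose e : cell mu := SeqSub e_la.
apply: (@leq_trans (T e)).
  have [eq2|ne2] := eqVneq (val c).2 (val d).2.
    rewrite (_ : c = e) //; apply: val_inj; rewrite /= -eq2.
    exact: surjective_pairing.
  by apply/ltnW/rowT; rewrite /same_row /left_of //= ltn_neqAle ne2.
have [eq1|ne1] := eqVneq (val c).1 (val d).1.
  rewrite (_ : e = d) //; apply: val_inj; rewrite /= eq1.
  exact/esym/surjective_pairing.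
by apply/ltnW/colT; rewrite /same_col /above //= ltn_neqAle ne1.
Qed.

Lemma std_onto T v : sumn mu = m -> std T -> v < m -> exists c, T c = v :> nat.
Proof.
move=> sum_mu /stdP[injT _ _] lt_vm.
have /codomP[c eq_c] : Ordinal lt_vm \in codom T.
  by apply: inj_card_onto; rewrite ?card_ord ?card_cells ?sum_mu.
by exists c; rewrite -eq_c.
Qed.

Lemma ascP T i : 0 < i < m -> reflect (exists c d, [/\ (T c).+1 = i, T d = i :> nat,
    (val d).1 <= (val c).1 & (val c).2 <= (val d).2]) (asc T i).
Proof.
case/andP=> i_gt0 lt_im; rewrite /asc i_gt0 ltnW //= ltn_eqF //=.
apply: (iffP existsP) => [[c /existsP[d /and4P[/eqP Tc /eqP[Td] le1 le2]]]|[c [d [Tc Td le1 le2]]]].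
  by exists c, d.
by exists c; apply/existsP; exists d; rewrite Tc Td !eqxx le1.
Qed.

Lemma asc_max T : 0 < m -> asc T m.
Proof. by move=> m_gt0; rewrite /asc m_gt0 leqnn eqxx. Qed.

Lemma des_first T i : 0 < m -> asc T i -> (forall j, j < i -> ~~ asc T j) ->
  des T = ~~ odd i.
Proof.
move=> m_gt0 asc_i first_i; rewrite /des -[m == 0]negbK -lt0n m_gt0 /=.
apply/existsP/idP=> [[j /and3P[asc_j even_j /forallP first_j]]|even_i].
  have [lt_ij|/first_i|eq_ij] := ltngtP i j; last by rewrite eq_ij.
    by have := first_j (Ordinal lt_ij); rewrite asc_i.
  by rewrite asc_j.
have lt_im : i < m.+1 by case/andP: asc_i => /andP[].
exists (Ordinal lt_im); rewrite asc_i even_i /=; apply/forallP=> j.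
exact: first_i.
Qed.

(** By strong induction on the entry, [T c] sits in row [T c] of the first column: the first entry
    placed elsewhere would create an ascent or leave a gap. *)
Lemma noasc_column T : is_part mu -> sumn mu = m -> std T ->
  (forall i, 0 < i < m -> ~~ asc T i) -> mu = nseq m 1.
Proof.
move=> pmu sum_mu stdT noasc; have /stdP[injT rowT colT] := stdT.
have pos c : val c = (T c : nat, 0).
  have [n] := ubnP (T c : nat); elim: n c => // n IHn c; rewrite ltnS => le_Tn.
  have {}IHn e : T e < T c -> val e = (T e : nat, 0).
    by move=> lt_e; apply: IHn; apply: leq_trans le_Tn.
  case ec : (val c) => [r s]; have := valP c; rewrite /= ec mem_cells => c_mu.
  have s0 : s = 0.
    (* The first cell of row [r] has a smaller entry, which by induction equals [r]. Hence the cell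
       of the entry [(T c).-1] is in column 0 and weakly south of [c], and [T c], counted from 1, is
       an ascent. *)
    apply/eqP; rewrite -leqn0 leqNgt; apply/negP=> s_gt0.
    have e_mu : (r, 0) \in cells mu by rewrite mem_cells (leq_trans _ c_mu).
    have lt_e : T (SeqSub e_mu) < T c.
      by apply: rowT; rewrite /same_row /left_of ec /=.
    have [eq_r] := IHn _ lt_e.
    have i_gt0 : 0 < T c by apply: leq_ltn_trans lt_e.
    have lt_i1 : (T c).-1 < m by rewrite prednK // ltnW.
    have [c' Tc'] := std_onto sum_mu stdT lt_i1.
    have lt_i1c : (T c).-1 < T c by rewrite prednK.
    have ec' : val c' = ((T c).-1, 0) by rewrite IHn Tc'.
    have i_bnd : 0 < T c < m by rewrite i_gt0 ltn_ord.
    have /negP[] := noasc _ i_bnd; apply/(ascP _ i_bnd).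
    exists c', c; rewrite Tc' prednK // ec' ec /=; split=> //.
    by rewrite -ltnS prednK // eq_r.
  rewrite s0 in ec c_mu *; congr (_, _).
  (* If [r < T c], the entry [r] already occupies the cell of [c]. If [r > T c], the cell [(T c, 0)]
     has an entry smaller than [T c], while by induction this entry is its row. *)
  have [lt_r|lt_r|//] := ltngtP r (T c).
    have [c' Tc'] := std_onto sum_mu stdT (ltn_trans lt_r (ltn_ord _)).
    have /val_inj eq_c : val c' = val c by rewrite IHn Tc' ?ec.
    by rewrite -Tc' eq_c ltnn in lt_r.
  have e_mu : (T c : nat, 0) \in cells mu.
    by rewrite mem_cells (leq_trans c_mu) // part_nth_anti // ltnW.
  have lt_e : T (SeqSub e_mu) < T c.
    by apply: colT; rewrite /same_col /above ec /=.
  by have [eq_T] := IHn _ lt_e; rewrite -eq_T ltnn in lt_e.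
apply: part_eq => // [|i].
  apply/andP; split; last by rewrite mem_nseq andbF.
  by apply/(sortedP 0) => i; rewrite size_nseq => lt_i; rewrite !nth_nseq lt_i ltnW.
rewrite nth_nseq; case: ltnP => [lt_im|le_mi].
  have [c Tc] := std_onto sum_mu stdT lt_im.
  have := valP c; rewrite pos Tc mem_cells => mu_i; apply/eqP; rewrite eqn_leq mu_i andbT.
  rewrite leqNgt; apply/negP=> mu_i2.
  have in2 : (i, 1) \in cells mu by rewrite mem_cells.
  by have [] := pos (SeqSub in2).
apply/eqP; rewrite -leqn0 leqNgt; apply/negP=> mu_i.
have in0 : (i, 0) \in cells mu by rewrite mem_cells.
have [eq_i] := pos (SeqSub in0).
by move: (ltn_ord (T (SeqSub in0))); rewrite -eq_i ltnNge le_mi.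
Qed.

End StandardFillings.

Lemma desarr_numE mu : desarr_num mu = #|[set T : filling mu (sumn mu) | std T && des T]|.
Proof. by []. Qed.

Lemma desarr_num_of n (la : intpart n) :
  desarr_num la = #|[set T : filling la n | std T && des T]|.
Proof. by rewrite desarr_numE intpart_sum. Qed.

(** * Removing the largest entry of a standard filling *)

Section RemoveMax.
Variables (n : nat) (la : intpart n.+1) (mu : intpart n).
Hypothesis sub : forall i, nth 0 mu i <= nth 0 la i.
Implicit Type T : filling mu n.

Lemma out_uniq (c d : cell la) :
  val c \notin cells mu -> val d \notin cells mu -> c = d.
Proof.
move=> c_mu d_mu; have n_mu := intpart_sum mu.
(* Any filling will do: [card_ext_max] counts the cells outside [mu] through the entries given to
   them by [ext]. *)
pose T : filling mu n := [ffun c => cast_ord (etrans (card_cells mu) n_mu) (enum_rank c)].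
have card1 : #|[set b | ext la T b == n :> nat]| = 1.
  by apply/(@addnI n)/(etrans _ (esym (addn1 n))); have := card_ext_max sub T; rewrite !intpart_sum.
have /cards1P[e eE] := introT eqP card1.
have memE (b : cell la) : val b \notin cells mu -> b = e.
  by move=> b_mu; apply/set1P; rewrite -eE inE ext_out.
by rewrite (memE c) // (memE d).
Qed.

Lemma sub_ideal (c d : cell la) : (val c).1 <= (val d).1 -> (val c).2 <= (val d).2 ->
  val d \in cells mu -> val c \in cells mu.
Proof.
case: (val c) (val d : nat * nat) => i j [i' j'] /= le_i le_j; rewrite !mem_cells => lt_j'.
by rewrite (leq_ltn_trans le_j) // (leq_trans lt_j') // part_nth_anti ?intpart_part.
Qed.

Lemma std_ext T : std (ext la T) = std T.
Proof.
apply/stdP/stdP=> -[injT rowT colT]; split.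
- by move=> c d eqT; apply: (@wid_inj la mu sub); apply: injT; apply: val_inj; rewrite /= !ext_wid eqT.
- by move=> c d rcd lcd; have := rowT (wid sub c) (wid sub d) rcd lcd; rewrite !ext_wid.
- by move=> c d rcd lcd; have := colT (wid sub c) (wid sub d) rcd lcd; rewrite !ext_wid.
- move=> c d eqT; have [c_mu|c_mu] := boolP (val c \in cells mu).
    have d_mu : val d \in cells mu by rewrite -(ext_lt sub T) -eqT ext_lt.
    have [c' ec] := widP sub c_mu; have [d' ed] := widP sub d_mu.
    rewrite ec ed; congr wid; apply: injT; apply: val_inj.
    by rewrite /= -!(ext_wid sub) -ec -ed eqT.
  by apply: out_uniq => //; rewrite -(ext_lt sub T) -eqT ext_lt.
- move=> c d /eqP rcd lcd; have [d_mu|d_mu] := boolP (val d \in cells mu).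
    have c_mu : val c \in cells mu by apply: sub_ideal d_mu; rewrite ?rcd // ltnW.
    have [c' ec] := widP sub c_mu; have [d' ed] := widP sub d_mu.
    rewrite ec ed !ext_wid; apply: rowT; rewrite /same_row /left_of.
      by move: rcd; rewrite ec ed /= => ->.
    by move: lcd; rewrite ec ed.
  rewrite [X in _ < X]ext_out // (ext_lt sub T); apply/negPn/negP=> c_mu.
  by move: lcd; rewrite (out_uniq c_mu d_mu) /left_of ltnn.
- move=> c d /eqP rcd lcd; have [d_mu|d_mu] := boolP (val d \in cells mu).
    have c_mu : val c \in cells mu by apply: sub_ideal d_mu; rewrite ?rcd // ltnW.
    have [c' ec] := widP sub c_mu; have [d' ed] := widP sub d_mu.
    rewrite ec ed !ext_wid; apply: colT; rewrite /same_col /above.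
      by move: rcd; rewrite ec ed /= => ->.
    by move: lcd; rewrite ec ed.
  rewrite [X in _ < X]ext_out // (ext_lt sub T); apply/negPn/negP=> c_mu.
  by move: lcd; rewrite (out_uniq c_mu d_mu) /above ltnn.
Qed.

Lemma asc_ext T i : 0 < i < n -> asc (ext la T) i = asc T i.
Proof.
move=> i_bnd; have /andP[i_gt0 lt_in] := i_bnd.
have i_bnd1 : 0 < i < n.+1 by rewrite i_gt0 ltnW.
apply/(ascP _ i_bnd1)/(ascP _ i_bnd) => [[c [d [Tc Td le1 le2]]]|[c [d [Tc Td le1 le2]]]].
  have c_mu : val c \in cells mu by rewrite -(ext_lt sub T) (leq_trans _ (ltnW lt_in)) // Tc.
  have d_mu : val d \in cells mu by rewrite -(ext_lt sub T) Td.
  have [c' ec] := widP sub c_mu; have [d' ed] := widP sub d_mu.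
  exists c', d'; split; first by rewrite -(ext_wid sub) -ec.
  - by rewrite -(ext_wid sub) -ed.
  - by move: le1; rewrite ec ed.
  by move: le2; rewrite ec ed.
by exists (wid sub c), (wid sub d); rewrite !ext_wid.
Qed.

(** Ascents below [n] agree. If there are none, the smallest ascent of a nonempty [T] is [n], by
    convention; it is also an ascent of the extension, since otherwise [noasc_column] would make
    [la] a column. *)
Lemma des_ext T : std T -> parts la != nseq n.+1 1 -> des (ext la T) = des T.
Proof.
move=> stdT la_ne; have [ex|nex] := boolP [exists i : 'I_n, (0 < i) && asc T i].
  have ex' : exists i, (0 < i < n) && asc T i.
    by case/existsP: ex => i /andP[i0 ai]; exists i; rewrite i0 ltn_ord.
  case: (ex_minnP ex') => i /andP[i_bnd asc_i] min_i.
  have n_gt0 : 0 < n by case/andP: i_bnd => _; apply: leq_trans.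
  have first_i j : j < i -> ~~ asc T j.
    move=> lt_ji; apply/negP=> asc_j; have [j0|j0] := posnP j.
      by move: asc_j; rewrite j0 /asc.
    have := min_i j; rewrite j0 asc_j (ltn_trans lt_ji) ?(andP i_bnd).2 //=.
    by move/(_ isT); rewrite leqNgt lt_ji.
  rewrite (des_first n_gt0 asc_i first_i); apply: des_first => //; first by rewrite asc_ext.
  move=> j lt_ji; have [->|j0] := posnP j; first by rewrite /asc.
  by rewrite asc_ext ?first_i // j0 (ltn_trans lt_ji) // (andP i_bnd).2.
have noasc i : 0 < i < n -> ~~ asc T i.
  case/andP=> i0 lt_in; apply: contra nex => ai; apply/existsP.
  by exists (Ordinal lt_in); rewrite i0.
have [asc_n|nasc_n] := boolP ((0 < n) && asc (ext la T) n); last first.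
  case/eqP: la_ne; apply: (@noasc_column _ n.+1 (ext la T)).
  - exact: intpart_part.
  - exact: intpart_sum.
  - by rewrite std_ext.
  move=> i /andP[i0]; rewrite ltnS leq_eqVlt => /orP[/eqP e|lt_in].
    by apply: contra nasc_n => asc_i; rewrite -[X in 0 < X]e -[X in asc _ X]e i0.
  by rewrite asc_ext ?noasc ?i0.
case/andP: asc_n => n_gt0 asc_n.
rewrite (@des_first _ _ (ext la T) n) // => [|j lt_j].
  apply/esym/des_first => //; first exact: asc_max.
  by move=> j lt_j; have [->|j0] := posnP j; [rewrite /asc|rewrite noasc ?j0].
have [->|j0] := posnP j; first by rewrite /asc.
by rewrite asc_ext ?noasc ?j0.
Qed.

End RemoveMax.

(** The predicate [D] is arbitrary because the recursion counts both the desarrangement tableaux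
    and, for a column, all standard tableaux. *)
Lemma std_rec n (la : intpart n.+1) (D : pred (filling la n.+1)) :
  #|[set T : filling la n.+1 | std T && D T]|
  = \sum_(mu : intpart n | all (mem (cells la)) (cells mu))
      #|[set T' : filling mu n | std T' && D (ext la T')]|.
Proof.
rewrite (sum_by_shape (Q := fun mu : intpart n => all (mem (cells la)) (cells mu))
  (sh := fun T (mu : intpart n) => shaped T mu)); last first.
  move=> T; rewrite inE => /andP[stdT _]; have /stdP[injT rowT colT] := stdT.
  have [mu [pmu sub shT]] := shape_exists (fun c d h1 h2 => ltnW (rowT c d h1 h2))
    (fun c d h1 h2 => ltnW (colT c d h1 h2)).
  have [T' eqT] := ext_onto sub (fun c => eqP (forallP shT c)).
  have sum_mu : sumn mu = n.
    have := card_ext_max sub T'; rewrite -eqT intpart_sum.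
    have [c Tc] := std_onto (intpart_sum la) stdT (ltnSn n).
    rewrite (_ : [set _ | _] = [set c]) ?cards1; first by rewrite addn1; case.
    apply/setP=> d; rewrite !inE; apply/eqP/eqP=> [Td|->//].
    by apply: injT; apply: val_inj; rewrite /= Td Tc.
  have pmuk : is_part_of n mu by rewrite is_part_ofE pmu sum_mu /=.
  exists (IntPart pmuk) => [|mu' /cells_subP sub' sh'].
    by rewrite shT andbT; apply/cells_subP.
  apply: val_inj => /=.
  exact: (shaped_uniq (intpart_part mu') pmu _ sub sh' shT).
apply: eq_bigr => mu /cells_subP sub.
rewrite -(card_imset _ (@ext_inj la mu n sub)); apply: eq_card => T.
apply/idP/imsetP; rewrite !inE.
  case/andP=> /andP[stdT DT] shT.
  have [T' eqT] := ext_onto sub (fun c => eqP (forallP shT c)).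
  by exists T' => //; rewrite inE -eqT DT -(std_ext sub) -eqT stdT.
case=> T'; rewrite inE => /andP[stdT DT] ->.
by rewrite std_ext // stdT DT /=; apply/forallP=> p; rewrite ext_lt.
Qed.

Lemma desarr_num_rec n (la : intpart n.+1) : parts la != nseq n.+1 1 ->
  desarr_num la = \sum_(mu : intpart n | all (mem (cells la)) (cells mu)) desarr_num mu.
Proof.
move=> la_ne; rewrite desarr_num_of std_rec; apply: eq_bigr => mu /cells_subP sub.
rewrite desarr_num_of; apply: eq_card => T; rewrite !inE.
by case: (boolP (std T)) => //= stdT; rewrite des_ext.
Qed.

Lemma des_column n (la : intpart n) (T : filling la n) :
  parts la = nseq n 1 -> std T -> des T = ~~ odd n.
Proof.
move=> la1 stdT; have [n0|n_gt0] := posnP n; first by rewrite /des (introT eqP n0) /= [X in odd X]n0.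
apply: des_first => // [|i lt_in]; first exact: asc_max.
have [->|i_gt0] := posnP i; first by rewrite /asc.
have i_bnd : 0 < i < n by rewrite i_gt0.
apply/(ascP _ i_bnd) => -[c [d [Tc Td le1 _]]].
have col0 (e : cell la) : (val e).2 = 0.
  move: (valP e); case: (val e) => i' j /=; rewrite mem_cells la1 nth_nseq.
  by case: ifP => // _; case: j.
have : T d <= T c by apply: std_le => //; rewrite ?col0 ?intpart_part.
by rewrite Td -Tc ltnn.
Qed.

Lemma card_std0 (la : intpart 0) : #|[set T : filling la 0 | std T]| = 1.
Proof.
have nocell (c : cell la) : False.
  have : 0 < #|{: cell la}| by apply/card_gt0P; exists c.
  by rewrite card_cells intpart_sum.
pose T0 : filling la 0 := [ffun c => match nocell c with end].
rewrite (_ : [set _ | _] = [set T0]) ?cards1 //; apply/setP=> T; rewrite !inE.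
have -> : T = T0 by apply/ffunP=> c; case: (nocell c).
by rewrite eqxx; apply/stdP; split=> c; case: (nocell c).
Qed.

Lemma column_part n : is_part_of n (nseq n 1).
Proof.
rewrite is_part_ofE /is_part mem_nseq andbF /= sumn_nseq mul1n eqxx !andbT.
by apply/(sortedP 0) => i; rewrite size_nseq => lt_i; rewrite !nth_nseq lt_i ltnW.
Qed.

Lemma sub_column n (la : intpart n.+1) (mu : intpart n) : parts la = nseq n.+1 1 ->
  all (mem (cells la)) (cells mu) = (mu == IntPart (column_part n)).
Proof.
move=> la1; apply/cells_subP/eqP=> [sub|-> i]; last first.
  by rewrite la1 !nth_nseq; case: ltnP => // /leqW->.
apply: val_inj => /=; have pmu := intpart_part mu; have /andP[_ mu0] := pmu.
have sz : size mu <= n by rewrite -[X in _ <= X](intpart_sum mu) leq_size_sumn.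
have mu1 i : i < size mu -> nth 0 mu i = 1.
  move=> lt_i; apply/eqP; rewrite eqn_leq lt0n part_nth_eq0 // -ltnNge lt_i andbT.
  by apply: leq_trans (sub i) _; rewrite la1 nth_nseq; case: ifP.
have e : size mu = n.
  by rewrite -[RHS](intpart_sum mu) sumn_nth (eq_bigr (fun=> 1)) => [|i _]; rewrite ?sum1_card ?card_ord ?mu1.
apply: (@eq_from_nth _ 0); first by rewrite size_nseq.
by move=> i lt_i; rewrite mu1 // nth_nseq -e lt_i.
Qed.

Lemma card_std_column n : #|[set T : filling (IntPart (column_part n)) n | std T]| = 1.
Proof.
elim: n => [|n IHn]; first exact: card_std0.
have := @std_rec n (IntPart (column_part n.+1)) xpredT.
under eq_finset do rewrite andbT.
move=> ->; rewrite (big_pred1 (IntPart (column_part n))) => [|mu]; last exact: sub_column.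
by under eq_finset do rewrite andbT.
Qed.

Lemma desarr_num_column n : desarr_num (nseq n 1) = ~~ odd n.
Proof.
rewrite (desarr_num_of (IntPart (column_part n))).
under eq_finset => T do rewrite (andb_id2l (@des_column _ _ T erefl)).
case: (odd n) => /=; last by under eq_finset do rewrite andbT; exact: card_std_column.
by apply/eqP; rewrite cards_eq0; apply/eqP/setP=> T; rewrite !inE andbF.
Qed.

Lemma desarr_num_row n : 0 < n -> desarr_num [:: n] = 0.
Proof.
move=> n_gt0; rewrite desarr_numE /= addn0.
apply/eqP; rewrite cards_eq0; apply/eqP/setP=> T; rewrite !inE.
apply/negbTE/negP => /andP[stdT]; have /stdP[injT rowT _] := stdT.
have sum_n : sumn [:: n] = n by rewrite /= addn0.
(* In a row the smallest ascent is 1, which is odd; for [n = 1] it is an ascent by convention. *)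
rewrite (@des_first _ _ T 1) // => [|[]] //.
have [n1|n_gt1] : n = 1 \/ 1 < n by lia.
  suff asc_n i : i = n -> asc T i by apply: asc_n.
  by move->; apply: asc_max.
apply/ascP; first by rewrite n_gt1.
have [c Tc] := std_onto sum_n stdT n_gt0; have [d Td] := std_onto sum_n stdT n_gt1.
have row0 (e : cell [:: n]) : (val e).1 = 0.
  move: (valP e); case: (val e) => i j /=; rewrite mem_cells.
  by case: i => //= i; rewrite nth_nil.
exists c, d; rewrite Tc Td !row0; split=> //; rewrite leqNgt; apply/negP=> lt_dc.
by have := rowT d c; rewrite /same_row !row0 /left_of lt_dc Tc Td => /(_ isT isT).
Qed.

Lemma desarr_num0 (la : intpart 0) : desarr_num la = 1.
Proof.
have -> : parts la = nseq 0 1; last exact: desarr_num_column.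
apply/eqP; rewrite -size_eq0 -leqn0 -[X in _ <= X](intpart_sum la) leq_size_sumn //.
by have /andP[] := intpart_part la.
Qed.

Local Open Scope ring_scope.

(** * Operators on words *)

Section WordOps.
Variables (N : nat) (K : comNzRingType).
Local Notation A := 'I_N.
Implicit Types (a b c d x : A) (w : seq A) (f g : seq A -> K).

(* Each of these lists the results of an operation on [w], with multiplicities:
   [shw] inserts [a], [delw] deletes one [b], [ew] replaces one [b] by [a], and
   [dlw] deletes the first letter provided that it is [a]. *)
Fixpoint shw a w : seq (seq A) :=
  (a :: w) :: if w is x :: w' then map (cons x) (shw a w') else [::].

Fixpoint delw b w : seq (seq A) :=
  if w is x :: w' then nseq (x == b) w' ++ map (cons x) (delw b w') else [::].

Fixpoint ew a b w : seq (seq A) :=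
  if w is x :: w' then nseq (x == b) (a :: w') ++ map (cons x) (ew a b w')
  else [::].

Definition dlw a w : seq (seq A) :=
  if w is x :: w' then nseq (x == a) w' else [::].

(** Letting operations act on functions makes induction on words possible: the first letter is
    absorbed into the function, over which the identities are quantified. *)
Definition wact (l : seq A -> seq (seq A)) f w : K := \sum_(u <- l w) f u.

Lemma eq_wact l f g w : f =1 g -> wact l f w = wact l g w.
Proof. by move=> fg; apply: eq_bigr => u _; apply: fg. Qed.

Lemma wactD l f g w : wact l (fun u => f u + g u) w = wact l f w + wact l g w.
Proof. exact: big_split. Qed.

Lemma wactZ l (k : K) f w : wact l (fun u => k * f u) w = k * wact l f w.
Proof. by rewrite /wact mulr_sumr. Qed.

Lemma sum_nseqb (I : Type) (b : bool) (u : I) (f : I -> K) :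
  \sum_(v <- nseq b u) f v = b%:R * f u.
Proof. by case: b; rewrite /= ?big_seq1 ?big_nil ?mul1r ?mul0r. Qed.

Lemma wact_sh0 a f : wact (shw a) f [::] = f [:: a].
Proof. by rewrite /wact big_seq1. Qed.

Lemma wact_shS a x f w :
  wact (shw a) f (x :: w) = f [:: a, x & w] + wact (shw a) (fun u => f (x :: u)) w.
Proof. by rewrite /wact /= big_cons big_map. Qed.

Lemma wact_del0 b f : wact (delw b) f [::] = 0.
Proof. by rewrite /wact big_nil. Qed.

Lemma wact_delS b x f w :
  wact (delw b) f (x :: w) =
  (x == b)%:R * f w + wact (delw b) (fun u => f (x :: u)) w.
Proof. by rewrite /wact /= big_cat big_map sum_nseqb. Qed.

Lemma wact_e0 a b f : wact (ew a b) f [::] = 0.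
Proof. by rewrite /wact big_nil. Qed.

Lemma wact_eS a b x f w :
  wact (ew a b) f (x :: w) =
  (x == b)%:R * f (a :: w) + wact (ew a b) (fun u => f (x :: u)) w.
Proof. by rewrite /wact /= big_cat big_map sum_nseqb. Qed.

Lemma wact_dl0 b f : wact (dlw b) f [::] = 0.
Proof. by rewrite /wact big_nil. Qed.

Lemma wact_dlS b x f w : wact (dlw b) f (x :: w) = (x == b)%:R * f w.
Proof. by rewrite /wact /= sum_nseqb. Qed.

(** The commutation relations of gl_N on tensor powers of its vector representation, with negative
    terms moved across. *)
Lemma wact_eC a b c d f w :
  wact (ew a b) (wact (ew c d) f) w + (c == b)%:R * wact (ew a d) f w =
  wact (ew c d) (wact (ew a b) f) w + (a == d)%:R * wact (ew c b) f w.
Proof.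
elim: w f => [|x w IHw] f; first by rewrite !wact_e0 !mulr0.
rewrite !wact_eS.
have H a' b' c' d' g : wact (ew a' b') (fun u => wact (ew c' d') g (x :: u)) w =
    (x == d')%:R * wact (ew a' b') (fun u => g (c' :: u)) w +
    wact (ew a' b') (wact (ew c' d') (fun u => g (x :: u))) w.
  rewrite -wactZ -wactD; apply: eq_wact => u; exact: wact_eS.
rewrite !H (canRL (addrK _) (IHw (fun u => f (x :: u)))); ring.
Qed.

Lemma wact_esh a b c f w :
  wact (ew a b) (wact (shw c) f) w + (b == c)%:R * wact (shw a) f w =
  wact (shw c) (wact (ew a b) f) w.
Proof.
elim: w f => [|x w IHw] f.
  by rewrite wact_e0 !wact_sh0 wact_eS wact_e0 eq_sym; ring.
rewrite !wact_eS !wact_shS !wact_eS.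
have -> : wact (ew a b) (fun u => wact (shw c) f (x :: u)) w =
    wact (ew a b) (fun u => f [:: c, x & u]) w +
    wact (ew a b) (wact (shw c) (fun u => f (x :: u))) w.
  rewrite -wactD; apply: eq_wact => u; exact: wact_shS.
have -> : wact (shw c) (fun u => wact (ew a b) f (x :: u)) w =
    (x == b)%:R * wact (shw c) (fun u => f (a :: u)) w +
    wact (shw c) (wact (ew a b) (fun u => f (x :: u))) w.
  rewrite -wactZ -wactD; apply: eq_wact => u; exact: wact_eS.
rewrite -IHw (eq_sym b c); have [-> //|] := eqVneq c b; first ring.
move=> _; ring.
Qed.

Lemma wact_edel a b c f w :
  wact (ew a b) (wact (delw c) f) w =
  wact (delw c) (wact (ew a b) f) w + (a == c)%:R * wact (delw b) f w.
Proof.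
elim: w f => [|x w IHw] f; first by rewrite wact_e0 !wact_del0; ring.
rewrite !wact_eS !wact_delS.
have -> : wact (ew a b) (fun u => wact (delw c) f (x :: u)) w =
    (x == c)%:R * wact (ew a b) f w +
    wact (ew a b) (wact (delw c) (fun u => f (x :: u))) w.
  rewrite -wactZ -wactD; apply: eq_wact => u; exact: wact_delS.
have -> : wact (delw c) (fun u => wact (ew a b) f (x :: u)) w =
    (x == b)%:R * wact (delw c) (fun u => f (a :: u)) w +
    wact (delw c) (wact (ew a b) (fun u => f (x :: u))) w.
  rewrite -wactZ -wactD; apply: eq_wact => u; exact: wact_eS.
rewrite IHw; ring.
Qed.

(** Deleting an old letter merges the two gaps around it; the surplus insertion puts [a] in place of
    that letter, which is [ew a b]. Deleting the inserted letter itself gives the last term, once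
    for each gap. *)
Lemma wact_shdel a b f w :
  wact (shw a) (wact (delw b) f) w =
  wact (delw b) (wact (shw a) f) w + wact (ew a b) f w
  + ((a == b) * (size w).+1)%:R * f w.
Proof.
elim: w f => [|x w IHw] f.
  rewrite wact_sh0 wact_delS !wact_del0 wact_e0 /= muln1; ring.
rewrite wact_shS !wact_delS wact_eS.
have -> : wact (shw a) (fun u => wact (delw b) f (x :: u)) w =
    (x == b)%:R * wact (shw a) f w +
    wact (shw a) (wact (delw b) (fun u => f (x :: u))) w.
  rewrite -wactZ -wactD; apply: eq_wact => u; exact: wact_delS.
have -> : wact (delw b) (fun u => wact (shw a) f (x :: u)) w =
    wact (delw b) (fun u => f [:: a, x & u]) w +
    wact (delw b) (wact (shw a) (fun u => f (x :: u))) w.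
  rewrite -wactD; apply: eq_wact => u; exact: wact_shS.
rewrite IHw [size (x :: w)]/= !natrM -[(size w).+2%:R]natr1; ring.
Qed.

Lemma wact_shC a b f w :
  wact (shw a) (wact (shw b) f) w = wact (shw b) (wact (shw a) f) w.
Proof.
elim: w f => [|x w IHw] f; first by rewrite !wact_sh0 !wact_shS !wact_sh0 addrC.
rewrite !wact_shS.
have H a' b' : wact (shw a') (fun u => wact (shw b') f (x :: u)) w =
    wact (shw a') (fun u => f [:: b', x & u]) w +
    wact (shw a') (wact (shw b') (fun u => f (x :: u))) w.
  rewrite -wactD; apply: eq_wact => u; exact: wact_shS.
rewrite !H IHw; ring.
Qed.

(** Only an insertion in front changes the first letter. The commutator is therefore a scalar
    independent of the length, as in a Weyl algebra, in contrast with [wact_shdel]. *)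
Lemma wact_shdl a b f w :
  wact (shw b) (wact (dlw a) f) w =
  wact (dlw a) (wact (shw b) f) w + (b == a)%:R * f w.
Proof.
case: w => [|x w]; first by rewrite wact_sh0 wact_dlS wact_dl0 add0r.
rewrite wact_shS !wact_dlS addrC; congr (_ + _).
by rewrite -wactZ; apply: eq_wact => u; rewrite wact_dlS.
Qed.

Lemma wact_e_diag a f w : wact (ew a a) f w = (count_mem a w)%:R * f w.
Proof.
elim: w f => [|x w IHw] f; first by rewrite wact_e0 mul0r.
rewrite wact_eS IHw /= natrD; by case: eqVneq => [->|_]; rewrite ?mul1r ?mul0r ?add0r ?mulrDl ?mul1r.
Qed.

End WordOps.

Section WordSizes.
Variable N : nat.
Local Notation A := 'I_N.
Implicit Types (a b c d x : A) (w : seq A).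

Definition maps_size (l : seq A -> seq (seq A)) n m :=
  forall w, size w = n -> {in l w, forall u, size u = m}.

Lemma shw_size a n : maps_size (shw a) n n.+1.
Proof.
move=> w <-; elim: w => [|x w IHw] u; first by rewrite inE => /eqP->.
by rewrite inE => /predU1P[-> // | /mapP[v /IHw /= <- ->]].
Qed.

Lemma delw_size b n : maps_size (delw b) n.+1 n.
Proof.
elim: n => [|n IHn] [|x w] //= [sz_w] u; rewrite mem_cat => /orP[].
- by rewrite mem_nseq => /andP[_ /eqP->].
- by rewrite (size0nil sz_w).
- by rewrite mem_nseq => /andP[_ /eqP->].
- by case/mapP=> v /(IHn _ sz_w) /= <- ->.
Qed.

Lemma ew_size a b n : maps_size (ew a b) n n.
Proof.
elim: n => [|n IHn] [|x w] //= [sz_w] u; rewrite mem_cat => /orP[].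
- by rewrite mem_nseq => /andP[_ /eqP->]; rewrite /= sz_w.
- by case/mapP=> v /(IHn _ sz_w) /= <- ->.
Qed.

Lemma dlw_size a n : maps_size (dlw a) n.+1 n.
Proof.
by case=> [|x w] //= [sz_w] u; rewrite mem_nseq => /andP[_ /eqP->].
Qed.

End WordSizes.

Section WordMatrices.
Variables (N : nat) (K : comNzRingType).
Local Notation A := 'I_N.
Implicit Types (a b c d x : A) (w : seq A).

Definition dm n := #|{: n.-tuple 'I_N}|.
Definition wd n (i : 'I_(dm n)) : seq A := val (enum_val i).
Lemma size_wd n (i : 'I_(dm n)) : size (wd i) = n.
Proof. exact: size_tuple. Qed.

Lemma wd_inj n : injective (@wd n).
Proof. by move=> i j /val_inj /enum_val_inj. Qed.

Definition ind n (j : 'I_(dm n)) w : K := (w == wd j)%:R.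

(* Matrices act on functions of words; in a product the left factor is the
   operation performed first. *)
Definition mxw l n m : 'M[K]_(dm n, dm m) :=
  \matrix_(i, j) wact l (ind j) (wd i).

Lemma sum_wd m (u : seq A) (g : seq A -> K) :
  size u = m -> \sum_(j : 'I_(dm m)) ind j u * g (wd j) = g u.
Proof.
move=> sz_u; pose t := Tuple (introT eqP sz_u).
rewrite (bigD1 (enum_rank t)) //= big1 ?addr0 => [|j ne_j].
  by rewrite /ind /wd enum_rankK eqxx mul1r.
rewrite /ind; case: eqP => [eq_u|]; last by rewrite mul0r.
case/eqP: ne_j; apply: wd_inj; rewrite -eq_u /wd enum_rankK.
by [].
Qed.

Lemma mul_mxw l1 l2 n m p i j : maps_size l1 n m ->
  (mxw l1 n m *m mxw l2 m p) i j = wact l1 (wact l2 (ind j)) (wd i).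
Proof.
move=> sz1; rewrite mxE; under eq_bigr do rewrite !mxE mulr_suml.
rewrite exchange_big; apply: eq_big_seq => u /(sz1 _ (size_wd i)) sz_u.
exact: sum_wd.
Qed.

Definition ins_mx a n := mxw (shw a) n n.+1.
Local Notation SH := ins_mx.
Definition del_mx a n := mxw (delw a) n.+1 n.
Local Notation DEL := del_mx.
Definition strip_mx a n := mxw (dlw a) n.+1 n.
Local Notation DL := strip_mx.
Definition subst_mx a b n := mxw (ew a b) n n.
Local Notation E := subst_mx.

(** The empty word has no letter to delete; the value 0 is the corresponding empty sum, so that
    [DSE] holds in every degree. *)
Definition delins_mx a b n : 'M[K]_(dm n) :=
  if n is m.+1 then DEL b m *m SH a m else 0.
Local Notation DS := delins_mx.
Definition stripins_mx a b n : 'M[K]_(dm n) :=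
  if n is m.+1 then DL b m *m SH a m else 0.
Local Notation DLS := stripins_mx.

Lemma DSE a b n i j : DS a b n i j = wact (delw b) (wact (shw a) (ind j)) (wd i).
Proof.
case: n i j => [|n] i j; last exact: mul_mxw (@delw_size _ _ _).
by rewrite mxE (size0nil (size_wd i)) wact_del0.
Qed.

Lemma DLSE a b n i j : DLS a b n i j = wact (dlw b) (wact (shw a) (ind j)) (wd i).
Proof.
case: n i j => [|n] i j; last exact: mul_mxw (@dlw_size _ _ _).
by rewrite mxE (size0nil (size_wd i)) wact_dl0.
Qed.

Lemma mul_EE a b c d n :
  E a b n *m E c d n + (c == b)%:R *: E a d n =
  E c d n *m E a b n + (a == d)%:R *: E c b n.
Proof.
apply/matrixP=> i j; have szE a' b' := @ew_size N a' b' n.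
by rewrite [LHS]mxE mul_mxw // [RHS]mxE mul_mxw // !mxE wact_eC.
Qed.

Lemma mul_ESH a b c n :
  E a b n *m SH c n + (b == c)%:R *: SH a n = SH c n *m E a b n.+1.
Proof.
apply/matrixP=> i j; have szE a' b' := @ew_size N a' b' n.
by rewrite [LHS]mxE !mul_mxw //; [rewrite !mxE wact_esh | exact: shw_size].
Qed.

Lemma mul_EDEL a b c n :
  E a b n.+1 *m DEL c n = DEL c n *m E a b n + (a == c)%:R *: DEL b n.
Proof.
apply/matrixP=> i j; rewrite [RHS]mxE !mul_mxw ?mxE; first exact: wact_edel.
  exact: delw_size.
exact: ew_size.
Qed.

Lemma mul_SHDEL a b n :
  SH a n *m DEL b n = DS a b n + E a b n + ((a == b) * n.+1)%:R%:M.
Proof.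
apply/matrixP=> i j; rewrite mul_mxw; last exact: shw_size.
rewrite wact_shdel size_wd 2!mxE DSE 2!mxE; congr (_ + _).
by rewrite /ind (inj_eq (@wd_inj n)) mulr_natr.
Qed.

Lemma mul_SHSH a b n : SH a n *m SH b n.+1 = SH b n *m SH a n.+1.
Proof.
apply/matrixP=> i j; rewrite !mul_mxw; first exact: wact_shC.
all: exact: shw_size.
Qed.

Lemma mul_SHDL a b n : SH b n *m DL a n = DLS b a n + (b == a)%:R%:M.
Proof.
apply/matrixP=> i j; rewrite mul_mxw ?wact_shdl; last exact: shw_size.
rewrite mxE DLSE mxE; congr (_ + _).
by rewrite /ind (inj_eq (@wd_inj n)) mulr_natr.
Qed.

(* [n ^ 2] times the transition matrix on all words. *)
Definition shuffle_mx n := \sum_c DS c c n.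
Local Notation RR := shuffle_mx.
Definition casimir_mx n := \sum_a \sum_b E a b n *m E b a n.
Local Notation Cas := casimir_mx.

Lemma mul_DSSH a c n : DS a c n *m SH c n = DS c c n *m SH a n.
Proof.
by case: n => [|n] /=; rewrite ?mul0mx // -!mulmxA mul_SHSH.
Qed.

(** [mul_SHDEL] exchanges insertion and deletion, and the commuting insertions identify the main
    term. The two correction terms reappear in [mul_SHTT]. *)
Lemma mul_SHRR a n :
  SH a n *m RR n.+1 =
  RR n *m SH a n + \sum_c E a c n *m SH c n + n.+1%:R *: SH a n.
Proof.
rewrite /RR mulmx_sumr mulmx_suml /=.
under eq_bigr do rewrite mulmxA mul_SHDEL !mulmxDl mul_DSSH.
rewrite !big_split /=; congr (_ + _).
rewrite (bigD1 a) //= big1 => [|c ne_ca]; last first.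
  by rewrite eq_sym (negPf ne_ca) mul0n mul_scalar_mx scale0r.
by rewrite eqxx mul1n mul_scalar_mx addr0.
Qed.

Lemma E_RR a b n : E a b n *m RR n = RR n *m E a b n.
Proof.
case: n => [|n].
  by rewrite /RR big1 // mulmx0 mul0mx.
rewrite /RR mulmx_sumr mulmx_suml /=.
have H c : E a b n.+1 *m (DEL c n *m SH c n) =
  DEL c n *m SH c n *m E a b n.+1 +
    ((a == c)%:R *: (DEL b n *m SH c n) - (b == c)%:R *: (DEL c n *m SH a n)).
  rewrite mulmxA mul_EDEL mulmxDl -scalemxAl -!mulmxA -mul_ESH mulmxDr -scalemxAr.
  by rewrite [in RHS]addrACA addrN addr0.
under eq_bigr do rewrite H.
rewrite big_split /= sumrB.
rewrite -[RHS]addr0; congr (_ + _).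
rewrite (bigD1 a) //= big1 => [|c /negPf ne_ca]; last by rewrite eq_sym ne_ca scale0r.
rewrite (bigD1 b) //= [X in _ - (_ + X)]big1 => [|c /negPf ne_ca]; last by rewrite eq_sym ne_ca scale0r.
by rewrite !eqxx !scale1r !addr0 subrr.
Qed.

Lemma E_Cas a b n : E a b n *m Cas n = Cas n *m E a b n.
Proof.
rewrite /Cas mulmx_sumr mulmx_suml.
pose P c d := E c d n *m E d c n.
have H c d : E a b n *m (E c d n *m E d c n) = P c d *m E a b n +
   ((a == d)%:R *: (E c b n *m E d c n) - (c == b)%:R *: (E a d n *m E d c n)
   + ((a == c)%:R *: (E c d n *m E d b n) - (d == b)%:R *: (E c d n *m E a c n))).
  have C a' b' c' d' : E a' b' n *m E c' d' n = E c' d' n *m E a' b' n +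
      ((a' == d')%:R *: E c' b' n - (c' == b')%:R *: E a' d' n).
    by rewrite addrA -mul_EE addrK.
  rewrite mulmxA C mulmxDl -mulmxA C mulmxDr mulmxBl mulmxBr.
  by rewrite -!scalemxAr -!scalemxAl mulmxA -addrA; congr (_ + _); rewrite addrC.
have sum1 (c0 : A) (G : A -> 'M[K]_(dm n)) : \sum_c (c0 == c)%:R *: G c = G c0.
  rewrite (bigD1 c0) //= big1 => [|c /negPf ne]; last by rewrite eq_sym ne scale0r.
  by rewrite eqxx scale1r addr0.
transitivity (\sum_c \sum_d P c d *m E a b n + \sum_c \sum_d
   ((a == d)%:R *: (E c b n *m E d c n) - (c == b)%:R *: (E a d n *m E d c n)
   + ((a == c)%:R *: (E c d n *m E d b n) - (d == b)%:R *: (E c d n *m E a c n)))).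
  rewrite -big_split; apply: eq_bigr => c _; rewrite mulmx_sumr -big_split.
  by apply: eq_bigr => d _; rewrite H.
rewrite -[RHS]addr0; congr (_ + _).
  by apply: eq_bigr => c _; rewrite mulmx_suml.
(* Once the Kronecker symbols are summed out, the four correction sums cancel in pairs. *)
under eq_bigr do rewrite big_split !sumrB /=.
rewrite big_split !sumrB /=.
under eq_bigr do rewrite sum1.
rewrite addrC [X in _ + (_ - X)]exchange_big [X in X - _ + _]exchange_big /=.
under [X in X - _ + _]eq_bigr do rewrite sum1.
under [X in _ - X + _]eq_bigr do under eq_bigr do rewrite eq_sym.
under [X in _ - X + _]eq_bigr do rewrite sum1.
under [X in _ + (_ - X)]eq_bigr do under eq_bigr do rewrite eq_sym.
under [X in _ + (_ - X)]eq_bigr do rewrite sum1.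
by rewrite addrA subrK subrr.
Qed.

(** The Casimir operator on a tensor product: [N] is its value on a single letter, and the doubled
    sum is the mixed term between the inserted letter and the others. *)
Lemma mul_SHCas c n :
  SH c n *m Cas n.+1 =
  Cas n *m SH c n + (\sum_a E c a n *m SH a n) *+ 2 + N%:R *: SH c n.
Proof.
have sum1 (c0 : A) (G : A -> 'M[K]_(dm n, dm n.+1)) : \sum_c (c0 == c)%:R *: G c = G c0.
  rewrite (bigD1 c0) //= big1 => [|c' /negPf ne]; last by rewrite eq_sym ne scale0r.
  by rewrite eqxx scale1r addr0.
have H a b : SH c n *m (E a b n.+1 *m E b a n.+1) =
   E a b n *m E b a n *m SH c n + (a == c)%:R *: (E a b n *m SH b n)
   + (b == c)%:R *: (E b a n *m SH a n) + (c == b)%:R *: SH b n.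
  rewrite mulmxA -mul_ESH mulmxDl -mulmxA -mul_ESH mulmxDr -!scalemxAl -mul_ESH.
  rewrite -scalemxAr scalerDr eqxx scale1r !mulmxA addrA.
  by congr (_ + _ + _); have [->|]:= eqVneq b c; rewrite ?scale0r // ?eqxx.
transitivity (\sum_a \sum_b
  (E a b n *m E b a n *m SH c n + (a == c)%:R *: (E a b n *m SH b n)
   + (b == c)%:R *: (E b a n *m SH a n) + (c == b)%:R *: SH b n)).
  rewrite mulmx_sumr; apply: eq_bigr => a _; rewrite mulmx_sumr.
  by apply: eq_bigr => b _; rewrite H.
under eq_bigr do rewrite !big_split /= sum1.
rewrite !big_split /=; congr (_ + _); last first.
  by rewrite sumr_const card_ord scaler_nat.
rewrite -addrA; congr (_ + _).
  by rewrite /Cas mulmx_suml; apply: eq_bigr => a _; rewrite mulmx_suml.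
rewrite mulr2n; congr (_ + _).
  under eq_bigr do under eq_bigr do rewrite eq_sym.
  by rewrite exchange_big /=; under eq_bigr do rewrite sum1.
under eq_bigr do under eq_bigr do rewrite eq_sym.
by under eq_bigr do rewrite sum1.
Qed.

Lemma sum_Ediag n : \sum_a E a a n = n%:R%:M.
Proof.
apply/matrixP=> i j; rewrite summxE mxE.
under eq_bigr do rewrite mxE wact_e_diag.
rewrite -mulr_suml -natr_sum.
have -> : (\sum_a count_mem a (wd i) = n)%N.
  rewrite -[RHS](size_wd i) -sum1_size.
  under eq_bigr do rewrite -sum1_count.
  rewrite (exchange_big_dep xpredT) //=; apply: eq_bigr => a _.
  by rewrite (big_pred1 a) // => b; rewrite /= eq_sym.
by rewrite /ind (inj_eq (@wd_inj n)) mulr_natr.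
Qed.

End WordMatrices.

(** * The corrected Casimir operator and the weights *)

Section Transfer.
Variables (N : nat) (K : comNzRingType) (h : K).
Hypothesis h2 : h *+ 2 = 1.
Local Notation A := 'I_N.
Local Notation E := (@subst_mx N K).
Local Notation SH := (@ins_mx N K).
Local Notation RR := (@shuffle_mx N K).
Local Notation Cas := (@casimir_mx N K).
Implicit Types (a b c d : A) (w : seq A).

(* [h] stands for 1/2. *)
Definition transfer_mx n : 'M[K]_(dm N n) :=
  h *: (Cas n - (N * n)%:R%:M) + 'C(n.+1, 2)%:R%:M.
Local Notation TT := transfer_mx.
Definition defect_mx n := TT n - RR n.
Local Notation DD := defect_mx.

(** This dictates the constants of [transfer_mx]: [h] halves the mixed term of the Casimir operator,
    [N * n] absorbs its value on the inserted letter, and the binomial grows by [n.+1]. What remains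
    is the correction of [mul_SHRR]. *)
Lemma mul_SHTT a n :
  SH a n *m TT n.+1 =
  TT n *m SH a n + \sum_c E a c n *m SH c n + n.+1%:R *: SH a n.
Proof.
rewrite /TT mulmxDr mulmxDl -scalemxAr -scalemxAl mulmxBr mulmxBl mul_SHCas.
rewrite !mul_mx_scalar !mul_scalar_mx mulnS natrD scalerDl.
rewrite (binS n.+1 1) bin1 natrD [X in _ + X = _]scalerDl.
set P := Cas n *m _; set Q := \sum_c _; set S := SH a n.
have -> : P + Q *+ 2 + N%:R *: S - (N%:R *: S + (N * n)%:R *: S) =
    P - (N * n)%:R *: S + Q *+ 2.
  by rewrite opprD addrA addrK addrAC.
have hQ : h *: (Q *+ 2) = Q by rewrite -scalerMnr scalerMnl h2 scale1r.
by rewrite scalerDr hQ addrA (addrAC _ Q).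
Qed.

Lemma mul_SHDD a n : SH a n *m DD n.+1 = DD n *m SH a n.
Proof.
rewrite /DD mulmxBr mulmxBl mul_SHTT mul_SHRR.
by rewrite -[X in X - _]addrA -[X in _ - X]addrA opprD addrACA subrr addr0.
Qed.

Lemma Cas_comm n (F : 'M[K]_(dm N n)) :
  (forall a b, E a b n *m F = F *m E a b n) -> Cas n *m F = F *m Cas n.
Proof.
move=> EF; rewrite mulmx_suml mulmx_sumr; apply: eq_bigr => a _.
rewrite mulmx_suml mulmx_sumr; apply: eq_bigr => b _.
by rewrite -mulmxA EF mulmxA EF mulmxA.
Qed.

Lemma TT_comm n (F : 'M[K]_(dm N n)) :
  (forall a b, E a b n *m F = F *m E a b n) -> TT n *m F = F *m TT n.
Proof.
move=> /Cas_comm CF; rewrite /TT mulmxDr mulmxDl -scalemxAr -scalemxAl.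
by rewrite mulmxBr mulmxBl CF !mul_mx_scalar !mul_scalar_mx.
Qed.

Lemma E_TT a b n : E a b n *m TT n = TT n *m E a b n.
Proof.
rewrite /TT mulmxDr mulmxDl -scalemxAr -scalemxAl.
by rewrite mulmxBr mulmxBl E_Cas !mul_mx_scalar !mul_scalar_mx.
Qed.

Lemma E_DD a b n : E a b n *m DD n = DD n *m E a b n.
Proof. by rewrite /DD mulmxBr mulmxBl E_TT E_RR. Qed.

Variable x : A -> K.

Definition mon w : K := \prod_(a <- w) x a.
(** The action on words of the diagonal matrix with entries [x a]; traces against it are characters
    of gl_N. *)
Definition weight_mx n : 'M[K]_(dm N n) := diag_mx (\row_i mon (wd i)).
Local Notation Xd := weight_mx.

Lemma mon_cons c w : mon (c :: w) = x c * mon w.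
Proof. exact: big_cons. Qed.

Lemma mul_Xd_mxw l n m i j :
  (Xd n *m mxw K l n m) i j = mon (wd i) * wact l (ind K j) (wd i).
Proof. by rewrite mul_diag_mx !mxE. Qed.

Lemma mul_mxw_Xd l n m i j :
  (mxw K l n m *m Xd m) i j = wact l (fun u => mon u * ind K j u) (wd i).
Proof.
rewrite mul_mx_diag !mxE mulrC -wactZ; apply: eq_wact => u.
by rewrite /ind; case: eqP => [->|]; rewrite ?mulr0.
Qed.

Lemma mon_ew a b w u : u \in ew a b w -> x b * mon u = x a * mon w.
Proof.
elim: w u => [|c w IHw] u //=; rewrite mem_cat => /orP[].
  rewrite mem_nseq => /andP[]; case: eqP => // -> _ /eqP->.
  by rewrite !mon_cons mulrCA.
by case/mapP=> v /IHw xv ->; rewrite !mon_cons mulrCA xv mulrCA.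
Qed.

Lemma mon_shw a w u : u \in shw a w -> mon u = x a * mon w.
Proof.
elim: w u => [|c w IHw] u /=; rewrite inE.
  by move/eqP->; rewrite mon_cons.
case/predU1P=> [->|]; first by rewrite mon_cons.
by case/mapP=> v /IHw xv ->; rewrite !mon_cons xv mulrCA.
Qed.

(** A substitution scales the weight by [x a / x b]; the form without division is suited to
    variables of a polynomial ring. *)
Lemma E_Xd a b n : x b *: (E a b n *m Xd n) = x a *: (Xd n *m E a b n).
Proof.
apply/matrixP=> i j; rewrite [LHS]mxE [RHS]mxE mul_mxw_Xd mul_Xd_mxw -wactZ mulrA -wactZ.
by apply: eq_big_seq => u /mon_ew eq_u; rewrite mulrA eq_u.
Qed.

Lemma SH_Xd a n : SH a n *m Xd n.+1 = x a *: (Xd n *m SH a n).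
Proof.
apply/matrixP=> i j; rewrite [RHS]mxE mul_mxw_Xd mul_Xd_mxw mulrA -wactZ.
by apply: eq_big_seq => u /mon_shw ->.
Qed.

End Transfer.

(** * Permutations of the alphabet *)

Section LetterPerm.
Variables (N : nat) (K : comNzRingType) (h : K) (x : 'I_N -> K).
Local Notation A := 'I_N.
Local Notation E := (@subst_mx N K).
Local Notation SH := (@ins_mx N K).
Local Notation DEL := (@del_mx N K).
Local Notation RR := (@shuffle_mx N K).
Local Notation Cas := (@casimir_mx N K).
Implicit Types (a b c d : A) (w : seq A) (s : 'S_N).

Definition permw s w : seq (seq A) := [:: map s w].
Definition letter_mx s n := mxw K (permw s) n n.
Local Notation SG := letter_mx.

Lemma permw_size s n : maps_size (permw s) n n.
Proof. by move=> w <- u; rewrite inE => /eqP->; rewrite size_map. Qed.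

Lemma wact_permw s (f : seq A -> K) w : wact (permw s) f w = f (map s w).
Proof. exact: big_seq1. Qed.

Lemma ew_map s a b w :
  ew (s a) (s b) (map s w) = [seq map s u | u <- ew a b w].
Proof.
elim: w => //= c w ->; rewrite map_cat -!map_comp map_nseq.
by rewrite (inj_eq perm_inj).
Qed.

Lemma shw_map s a w : shw (s a) (map s w) = [seq map s u | u <- shw a w].
Proof. by elim: w => //= c w ->; rewrite -!map_comp. Qed.

Lemma delw_map s a w : delw (s a) (map s w) = [seq map s u | u <- delw a w].
Proof.
elim: w => //= c w ->; rewrite map_cat -!map_comp map_nseq.
by rewrite (inj_eq perm_inj).
Qed.

Lemma SG_mxw s l l' n m :
  (forall w, l' (map s w) = [seq map s u | u <- l w]) -> maps_size l n m ->
  SG s n *m mxw K l' n m = mxw K l n m *m SG s m.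
Proof.
move=> ll' szl; apply/matrixP=> i j.
rewrite !mul_mxw //; last exact: permw_size.
rewrite wact_permw /wact ll' big_map; apply: eq_bigr => u _.
by rewrite /permw big_seq1.
Qed.

Lemma SG_E s a b n : SG s n *m E (s a) (s b) n = E a b n *m SG s n.
Proof. by apply: SG_mxw => [w|]; [exact: ew_map | exact: ew_size]. Qed.

Lemma SG_SH s a n : SG s n *m SH (s a) n = SH a n *m SG s n.+1.
Proof. by apply: SG_mxw => [w|]; [exact: shw_map | exact: shw_size]. Qed.

Lemma SG_DEL s a n : SG s n.+1 *m DEL (s a) n = DEL a n *m SG s n.
Proof. by apply: SG_mxw => [w|]; [exact: delw_map | exact: delw_size]. Qed.

Lemma SG_RR s n : SG s n *m RR n = RR n *m SG s n.
Proof.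
rewrite mulmx_sumr mulmx_suml (reindex_inj (@perm_inj _ s)) /=.
apply: eq_bigr => a _; case: n => [|n]; rewrite ?mulmx0 ?mul0mx //=.
by rewrite mulmxA SG_DEL -mulmxA SG_SH mulmxA.
Qed.

Lemma SG_Cas s n : SG s n *m Cas n = Cas n *m SG s n.
Proof.
rewrite mulmx_sumr mulmx_suml (reindex_inj (@perm_inj _ s)) /=.
apply: eq_bigr => a _; rewrite mulmx_sumr mulmx_suml.
rewrite (reindex_inj (@perm_inj _ s)) /=.
by apply: eq_bigr => b _; rewrite mulmxA SG_E -mulmxA SG_E mulmxA.
Qed.

Lemma SG_TT s n : SG s n *m transfer_mx N h n = transfer_mx N h n *m SG s n.
Proof.
rewrite /transfer_mx mulmxDr mulmxDl -scalemxAr -scalemxAl.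
by rewrite mulmxBr mulmxBl SG_Cas !mul_mx_scalar !mul_scalar_mx.
Qed.

Lemma SG_DD s n : SG s n *m defect_mx N h n = defect_mx N h n *m SG s n.
Proof. by rewrite /defect_mx mulmxBr mulmxBl SG_TT SG_RR. Qed.

Lemma SG_Xd s n : SG s n *m weight_mx x n = weight_mx (x \o s) n *m SG s n.
Proof.
apply/matrixP=> i j; rewrite mul_mxw_Xd mul_Xd_mxw !wact_permw.
by congr (_ * _); rewrite /mon big_map.
Qed.

Lemma SGK s n : SG s n *m SG s^-1 n = 1%:M.
Proof.
apply/matrixP=> i j; rewrite mul_mxw; last exact: permw_size.
rewrite !wact_permw mxE -map_comp map_id_in ?/ind ?(inj_eq (@wd_inj _ n)) //.
by move=> a _; rewrite /= permK.
Qed.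

End LetterPerm.

(** * Traces on quotients *)

Section Projector.
Variables (F : fieldType) (K : comNzRingType) (phi : {rmorphism F -> K}).

(* [rho U] is a projection with kernel the row space of [U]: the trace of
   [rho U *m G] is the trace of [G] on the quotient by that space. *)
Definition pim k n (U : 'M[F]_(k, n)) : 'M[F]_n :=
  locked (pinvmx U *m U).
Definition rho k n (U : 'M[F]_(k, n)) : 'M[F]_n := 1%:M - pim U.

Lemma pim_id k l n (V : 'M[F]_(l, n)) (U : 'M[F]_(k, n)) :
  (V <= U)%MS -> V *m pim U = V.
Proof. by move=> VU; rewrite /pim -lock mulmxA mulmxKpV. Qed.

Lemma pim_sub k l n (V : 'M[F]_(l, n)) (U : 'M[F]_(k, n)) :
  (V *m pim U <= U)%MS.
Proof. by rewrite /pim -lock mulmxA submxMl. Qed.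

Lemma pim_le k n (U : 'M[F]_(k, n)) : (pim U <= U)%MS.
Proof. by rewrite -[pim U]mul1mx pim_sub. Qed.

Lemma rho_sub0 k l n (V : 'M[F]_(l, n)) (U : 'M[F]_(k, n)) :
  (V <= U)%MS -> V *m rho U = 0.
Proof. by move=> VU; rewrite mulmxBr mulmx1 pim_id ?subrr. Qed.

Lemma sub_rho0 k l n (V : 'M[F]_(l, n)) (U : 'M[F]_(k, n)) :
  V *m rho U = 0 -> (V <= U)%MS.
Proof.
by move/eqP; rewrite mulmxBr mulmx1 subr_eq0 => /eqP->; apply: pim_sub.
Qed.

Lemma pim_rho k n (U : 'M[F]_(k, n)) : pim U *m rho U = 0.
Proof. by apply: rho_sub0; rewrite -[pim U]mul1mx pim_sub. Qed.

Lemma pimK k n (U : 'M[F]_(k, n)) : pim U *m pim U = pim U.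
Proof. by rewrite pim_id // -[pim U]mul1mx pim_sub. Qed.

Lemma rhoK k n (U : 'M[F]_(k, n)) : rho U *m rho U = rho U.
Proof. by rewrite {1}/rho mulmxBl mul1mx pim_rho subr0. Qed.

Lemma rho_pim k n (U : 'M[F]_(k, n)) : rho U *m pim U = 0.
Proof. by rewrite mulmxBl mul1mx pimK subrr. Qed.

Lemma pimE k n (U : 'M[F]_(k, n)) : pim U = 1%:M - rho U.
Proof. by rewrite opprB addrC subrK. Qed.

Local Notation "A ^f" := (map_mx phi A) (format "A ^f").

Lemma map_rho k n (U : 'M[F]_(k, n)) : (rho U)^f = 1%:M - (pim U)^f.
Proof. by rewrite map_mxB map_mx1. Qed.

(** The hypotheses make [P] and [P'] idempotents with the same row space, which [G] preserves; the
    trace of the restriction does not depend on the chosen complement. *)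
Lemma mxtrace_proj n (P P' : 'M[F]_n) (G : 'M[K]_n) :
  P *m P' = P -> P' *m P = P' -> P^f *m G *m (1%:M - P^f) = 0 ->
  \tr (P^f *m G) = \tr (P'^f *m G).
Proof.
move=> PP' P'P /eqP; rewrite mulmxBr mulmx1 subr_eq0 => /eqP PG.
have PGP' : P^f *m G *m P'^f = P^f *m G.
  by rewrite {1}PG -mulmxA -map_mxM PP' -PG.
by rewrite -PGP' mxtrace_mulC mulmxA -map_mxM P'P.
Qed.

(** Additivity of the trace along the exact sequence 0 -> F^p/I -> F^q/J -> F^q/U -> 0 whose first
    map is induced by [f]: on its image, [G'] acts as [xi] times [G]. Exactness is stated over the
    field, the operators over [K]. *)
Lemma mxtrace_quotient p q (f : 'M[F]_(p, q)) (I : 'M_p) (J U : 'M_q)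
    (G : 'M[K]_p) (G' : 'M[K]_q) (xi : K) :
  (U :=: J + f)%MS -> (I *m f <= J)%MS ->
  (forall V : 'M_p, (V *m f <= J)%MS -> (V <= I)%MS) ->
  f^f *m G' = xi *: (G *m f^f) ->
  (pim J)^f *m G' *m (rho J)^f = 0 ->
  \tr ((rho U)^f *m G') = \tr ((rho J)^f *m G') - xi * \tr ((rho I)^f *m G).
Proof.
move=> eqU fI If fG JG.
have [Y eqY] : exists Y, Y = rho I *m f *m rho J by exists (rho I *m f *m rho J).
(* [Y] is the map induced by [f] between the chosen complements of [I] and [J], and [h] undoes it;
   injectivity modulo [I] is used here. *)
have [h Yh] : exists h, Y *m h = rho I.
  exists (pinvmx Y *m rho I).
  apply/eqP; rewrite -subr_eq0 mulmxA -{2}[rho I]mul1mx -mulmxBl.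
  set V := _ - _; have VY : V *m Y = 0 by rewrite mulmxBl mul1mx mulmxKpV ?subrr.
  have /If/pim_id <- : (V *m rho I *m f <= J)%MS.
    by apply: sub_rho0; rewrite -VY eqY !mulmxA.
  by rewrite -mulmxA rho_pim mulmx0.
have pif : pim I *m f *m rho J = 0.
  by apply: rho_sub0; rewrite (submx_trans (submxMr _ (pim_le I))).
have fY : f *m rho J = Y.
  by rewrite eqY {2}/rho mulmxBl mul1mx mulmxBl pif subr0.
(* A projection onto [U] adapted to the decomposition of [U]: off [J] it goes back along [h] and
   forth along [Y], so its trace splits into the two wanted ones. *)
have [P defP] : exists P, P = pim J + rho J *m h *m Y.
  by exists (pim J + rho J *m h *m Y).
have leJU : (J <= U)%MS by rewrite eqU addsmxSl.
have lefU : (f <= U)%MS by rewrite eqU addsmxSr.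
have leYU : (Y <= U)%MS.
  rewrite -fY mulmxBr mulmx1 addmx_sub // eqmx_opp (submx_trans (pim_sub _ _)) //.
have lePU : (P <= U)%MS.
  by rewrite defP addmx_sub ?(submx_trans (submxMl _ _)) ?(submx_trans (pim_le J)).
have JP : J *m P = J.
  by rewrite defP mulmxDr pim_id // !mulmxA rho_sub0 // !mul0mx addr0.
have fP : f *m P = f.
  have rY : rho I *m Y = Y by rewrite eqY !mulmxA rhoK.
  rewrite defP mulmxDr !mulmxA fY Yh rY -fY.
  by rewrite -mulmxDr addrC subrK mulmx1.
have UP V : (V <= U)%MS -> V *m P = V.
  rewrite eqU => /sub_addsmxP[[u1 u2] ->] /=.
  by rewrite mulmxDl -!mulmxA JP fP.
have leU : (pim U <= U)%MS by rewrite -[pim U]mul1mx pim_sub.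
have UG : (pim U)^f *m G' *m (1%:M - (pim U)^f) = 0.
  have fU : f^f *m G' *m (rho U)^f = 0.
    by rewrite fG -scalemxAl -mulmxA -map_mxM rho_sub0 // map_mx0 mulmx0 scaler0.
  have JU : J^f *m G' *m (rho U)^f = 0.
    have EJ : J^f = J^f *m (pim J)^f by rewrite -map_mxM pim_id.
    have JG2 : (pim J)^f *m G' = (pim J)^f *m G' *m (pim J)^f.
      apply/eqP; rewrite -subr_eq0 -[X in X - _]mulmx1 -mulmxBr -map_rho.
      exact/eqP.
    have pJU : pim J *m rho U = 0 by rewrite rho_sub0 // (submx_trans (pim_le J)).
    rewrite EJ -(mulmxA _ _ G') JG2 !mulmxA -(mulmxA _ (pim J)^f (rho U)^f).
    by rewrite -(map_mxM _ (pim J) (rho U)) pJU map_mx0 mulmx0.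
  have : (pim U <= J + f)%MS by rewrite -eqU.
  rewrite -map_rho => /sub_addsmxP[[u1 u2] /= ->].
  by rewrite map_mxD !map_mxM !mulmxDl -!mulmxA (mulmxA J^f) (mulmxA f^f) JU fU !mulmx0 addr0.
have trP : \tr ((pim U)^f *m G') = \tr (P^f *m G').
  apply: mxtrace_proj UG; first exact: UP.
  exact: pim_id.
rewrite !map_rho !mulmxBl !mul1mx !raddfB /= trP defP map_mxD mulmxDl mxtraceD.
rewrite opprD addrA; congr (_ - _).
rewrite -[X in _ * X]raddfB -[X in X - _]mul1mx -mulmxBl -map_rho.
move: JG; rewrite -[pim J]/(pim J) pimE map_mxB map_mx1 2!mulmxBl mul1mx => /eqP.
rewrite subr_eq0 => /eqP JG.
rewrite 2!map_mxM -!mulmxA mxtrace_mulC eqY !map_mxM -!mulmxA.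
rewrite (mulmxA (rho J)^f G') -JG (mulmxA f^f) fG.
rewrite -scalemxAl -!scalemxAr mxtraceZ; congr (_ * _).
rewrite -(mulmxA G) -map_mxM fY.
by rewrite !mulmxA mxtrace_mulC !mulmxA -map_mxM Yh -map_mxM rhoK.
Qed.

(** [Y *m P = P *m Y *m P] says that [Y] preserves the kernel of [P]. Both operators thus act on the
    quotient, where the trace is cyclic. *)
Lemma mxtrace_rho_comm n (P Y Z : 'M[K]_n) : P *m P = P ->
  Y *m P = P *m Y *m P -> Z *m P = P *m Z *m P ->
  \tr (P *m (Y *m Z)) = \tr (P *m (Z *m Y)).
Proof.
have H (Y' Z' : 'M[K]_n) : P *m P = P -> Y' *m P = P *m Y' *m P ->
    Z' *m P = P *m Z' *m P -> \tr (P *m (Y' *m Z')) =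
    \tr ((P *m Y' *m P) *m (P *m Z' *m P)).
  move=> PP YP ZP; rewrite -{1}PP -mulmxA mxtrace_mulC -!mulmxA ZP.
  rewrite !mulmxA -(mulmxA _ P P) PP.
  by rewrite -[in RHS](mulmxA (P *m Y') P P) PP.
by move=> PP YP ZP; rewrite !H // mxtrace_mulC.
Qed.

(** Carrying [B] once around the trace, past the weight [X], trades [u] for [v]. With substitutions
    for [A] and [B] this is the relation x_i S_ij = x_j S_ji of [casimir_rel]. *)
Lemma mxtrace_rho_swap p (R G A B X : 'M[K]_p) (u v : K) :
  R *m R = R -> G *m R = R *m G *m R -> A *m R = R *m A *m R ->
  B *m R = R *m B *m R -> X *m R = R *m X *m R ->
  B *m G = G *m B -> u *: (B *m X) = v *: (X *m B) ->
  u * \tr (R *m (G *m (A *m B) *m X)) = v * \tr (R *m (G *m (B *m A) *m X)).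
Proof.
move=> shuffle_mx pG pA pB pX BG uv.
have presM Y Z : Y *m R = R *m Y *m R -> Z *m R = R *m Z *m R ->
    (Y *m Z) *m R = R *m (Y *m Z) *m R.
  by move=> pY pZ; rewrite !mulmxA -[in RHS]mulmxA -[LHS]mulmxA pZ !mulmxA pY.
have -> : R *m (G *m (A *m B) *m X) = R *m G *m A *m (B *m X) by rewrite !mulmxA.
rewrite -mxtraceZ scalemxAr uv -scalemxAr mxtraceZ; congr (_ * _).
have -> : R *m G *m A *m (X *m B) = R *m ((G *m A *m X) *m B) by rewrite !mulmxA.
rewrite mxtrace_rho_comm //; last by do 2!apply: (presM) => //.
by rewrite !mulmxA -(mulmxA _ B G) BG !mulmxA.
Qed.

End Projector.

(** * Injectivity of insertions modulo smaller letters *)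

Section Insertions.
Variables (N : nat) (F : numFieldType).
Local Notation A := 'I_N.
Local Notation SH := (@ins_mx N F).
Local Notation DL := (@strip_mx N F).
Implicit Types (b c : A) (a : nat).

(* The span of the insertions of the letters smaller than [a]. *)
Definition Isub a n : 'M[F]_(dm N n) :=
  if n is m.+1 then (\sum_(b : A | (b < a)%N) <<SH b m>>)%MS else 0.

Lemma SH_Isub a b m : (b < a)%N -> (SH b m <= Isub a m.+1)%MS.
Proof. by move=> lt_ba; rewrite (sumsmx_sup b) ?genmxE. Qed.

Lemma Isub_mul a m k l (M : 'M[F]_(dm N m.+1, k)) (W : 'M_(l, k)) :
  (forall b, (b < a)%N -> (SH b m *m M <= W)%MS) -> (Isub a m.+1 *m M <= W)%MS.
Proof.
move=> SW; rewrite sumsmxMr_gen; apply/sumsmx_subP => b /SW.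
by apply: submx_trans; rewrite genmxE submxMr // genmxE.
Qed.

Lemma Isub_SH a c n : (Isub a n *m SH c n <= Isub a n.+1)%MS.
Proof.
case: n => [|n]; first by rewrite mul0mx sub0mx.
apply: Isub_mul => b lt_ba; rewrite mul_SHSH.
by rewrite (submx_trans (submxMl _ _)) ?SH_Isub.
Qed.

Lemma DLS_Isub a b c n : (b < a)%N -> (@stripins_mx N F b c n <= Isub a n)%MS.
Proof.
case: n => [|n] lt_ba; first by rewrite sub0mx.
by rewrite (submx_trans (submxMl _ _)) ?SH_Isub.
Qed.

Lemma Isub_DL c n : (Isub c n.+1 *m DL c n <= Isub c n)%MS.
Proof.
apply: Isub_mul => b lt_bc.
have /negPf ne_bc : b != c by rewrite -val_eqE /= neq_ltn lt_bc.
by rewrite mul_SHDL ne_bc raddf0 addr0 DLS_Isub.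
Qed.

(* As in the Weyl algebra, [DL c] is locally nilpotent and satisfies
   [SH c * DL c - DL c * SH c = 1], hence [SH c] is injective modulo [Isub c];
   the multiple [j.+1] grows along the induction on the degree. *)
Lemma DLS_regular c n k (V : 'M[F]_(k, dm N n)) j :
  ((j.+1%:R *: V + V *m @stripins_mx N F c c n)%R <= Isub c n)%MS -> (V <= Isub c n)%MS.
Proof.
have scale_le l p q (W : 'M[F]_(p, q)) (I : 'M_q) : (l.+1%:R *: W <= I)%MS -> (W <= I)%MS.
  by move=> le; rewrite -(scalerK (_ : l.+1%:R != 0) W) ?pnatr_eq0 // scalemx_sub.
elim: n j k V => [|n IHn] j k V.
  by rewrite /stripins_mx mulmx0 addr0 => /scale_le.
move=> le_V; apply: (scale_le j).
have le_V' : (V *m DL c n <= Isub c n)%MS.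
  apply: (IHn j.+1).
  have := submx_trans (submxMr (DL c n) le_V) (Isub_DL c n).
  rewrite mulmxDl -scalemxAl mulmxA -[X in ((_ + X)%R <= _)%MS]mulmxA mul_SHDL eqxx.
  by rewrite mulmxDr mulmx1 addrCA -[X in _ + (_ + X)]scale1r -scalerDl natr1 addrC.
rewrite -[X in (X <= _)%MS](addrK (V *m @stripins_mx N F c c n.+1)) addmx_sub //.
rewrite eqmx_opp /stripins_mx mulmxA (submx_trans (submxMr _ le_V')) //.
exact: Isub_SH.
Qed.

Lemma SH_regular c n k (V : 'M[F]_(k, dm N n)) :
  (V *m SH c n <= Isub c n.+1)%MS -> (V <= Isub c n)%MS.
Proof.
move=> le_V; apply: (@DLS_regular c n k V 0).
have := submx_trans (submxMr (DL c n) le_V) (Isub_DL c n).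
by rewrite -mulmxA mul_SHDL eqxx mulmxDr mulmx1 scale1r addrC.
Qed.

Lemma Isub_succ c n : (Isub c.+1 n.+1 :=: Isub c n.+1 + SH c n)%MS.
Proof.
apply/eqmxP/andP; split.
  apply/sumsmx_subP => b; rewrite ltnS leq_eqVlt => /predU1P[/val_inj-> | lt_bc].
    by rewrite genmxE addsmxSr.
  by rewrite genmxE (submx_trans (SH_Isub _ lt_bc)) ?addsmxSl.
rewrite addsmx_sub SH_Isub // andbT; apply/sumsmx_subP => b lt_bc.
by rewrite genmxE SH_Isub // ltnW.
Qed.

Lemma Isub0 n : Isub 0 n = 0.
Proof. by case: n => //= n; rewrite big_pred0. Qed.

Lemma RR_Isub n : (@shuffle_mx N F n <= Isub N n)%MS.
Proof.
case: n => [|n]; first by rewrite /shuffle_mx big1 ?sub0mx.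
rewrite summx_sub // => b _; rewrite (submx_trans (submxMl _ _)) //.
exact: SH_Isub.
Qed.

End Insertions.

Section GradedTrace.
Variables (N : nat) (F : numFieldType) (K : comNzRingType).
Variables (phi : {rmorphism F -> K}) (x : 'I_N -> K).
Local Notation A := 'I_N.
Local Notation SH := (@ins_mx N K).
Local Notation Xd := (@weight_mx N K x).
Implicit Types (b c : A) (a : nat).

Lemma map_mxw l n m : map_mx phi (mxw F l n m) = mxw K l n m :> 'M_(dm N n, dm N m).
Proof.
apply/matrixP=> i j; rewrite !mxE /wact rmorph_sum; apply: eq_bigr => u _.
exact: rmorph_nat.
Qed.

Lemma map_SH b n : map_mx phi (@ins_mx N F b n) = SH b n.
Proof. exact: map_mxw. Qed.

Definition rK a n := map_mx phi (rho (Isub N F a n)).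
Definition pK a n := map_mx phi (pim (Isub N F a n)).

Lemma rKE a n : rK a n = 1%:M - pK a n.
Proof. exact: map_rho. Qed.

Lemma rKK a n : rK a n *m rK a n = rK a n.
Proof. by rewrite -map_mxM rhoK. Qed.

Lemma rK0 n : rK 0 n = 1%:M.
Proof.
rewrite /rK Isub0 /rho.
have /eqP-> : pim (0 : 'M[F]_(dm N n)) == 0 by rewrite -submx0 pim_le.
by rewrite subr0 map_mx1.
Qed.

Lemma rK_deg0 a : rK a 0 = 1%:M.
Proof. by rewrite -(rK0 0) /rK Isub0. Qed.

Lemma SH_rK a b m : (b < a)%N -> SH b m *m rK a m.+1 = 0.
Proof. by move=> lt; rewrite -map_SH -map_mxM rho_sub0 ?map_mx0 ?SH_Isub. Qed.

Lemma RR_rK n : @shuffle_mx N K n *m rK N n = 0.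
Proof.
have -> : @shuffle_mx N K n = map_mx phi (@shuffle_mx N F n).
  rewrite /shuffle_mx raddf_sum; apply: eq_bigr => b _.
  case: n => [|n]; first exact/esym/map_mx0.
  by rewrite /delins_mx /= map_mxM !map_mxw.
by rewrite -map_mxM rho_sub0 ?map_mx0 ?RR_Isub.
Qed.

(** Stability of the span of the insertions of letters below [a], expressed through its projection
    because [Y] has entries in the ring [K]. *)
Definition ins_stable a n (Y : 'M[K]_(dm N n)) := Y *m rK a n = rK a n *m Y *m rK a n.
Local Notation pres := ins_stable.

Lemma presE a n (Y : 'M[K]_(dm N n)) : pres a Y <-> pK a n *m Y *m rK a n = 0.
Proof.
have -> : pK a n = 1%:M - rK a n by rewrite rKE opprB addrC subrK.
rewrite /pres 2!mulmxBl mul1mx.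
by split=> [->|/eqP]; rewrite ?subrr // subr_eq0 => /eqP.
Qed.

Lemma presP a n (Y : 'M[K]_(dm N n.+1)) :
  (forall b, (b < a)%N -> SH b n *m Y *m rK a n.+1 = 0) -> pres a Y.
Proof.
move=> Y0; apply/presE.
have /sub_sumsmxP[Z defZ] := pim_le (Isub N F a n.+1).
rewrite /pK defZ raddf_sum !mulmx_suml big1 // => b lt_ba.
have /submxP[B ->] : (<<@ins_mx N F b n>> <= @ins_mx N F b n)%MS by rewrite genmxE.
by rewrite /= mulmxA map_mxM map_SH -!mulmxA (mulmxA (@ins_mx _ _ _ _)) Y0 ?mulmx0.
Qed.

Lemma pres_deg0 a (Y : 'M[K]_(dm N 0)) : pres a Y.
Proof. by rewrite /pres rK_deg0 mul1mx. Qed.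

Lemma presM a n (Y Z : 'M[K]_(dm N n)) : pres a Y -> pres a Z -> pres a (Y *m Z).
Proof.
rewrite /pres => YP ZP; rewrite !mulmxA -[in RHS]mulmxA -[LHS]mulmxA ZP.
by rewrite !mulmxA YP.
Qed.

Lemma pres1 a n : @ins_stable a n 1%:M.
Proof. by rewrite /pres mulmx1 mul1mx rKK. Qed.

Lemma pres_Xd a n : pres a (Xd n).
Proof.
case: n => [|n]; [exact: pres_deg0 | apply: presP => b lt_ba].
by rewrite SH_Xd -scalemxAl -mulmxA SH_rK // mulmx0 scaler0.
Qed.

Lemma pres_comm a (G : forall n, 'M[K]_(dm N n)) n :
  (forall b n, SH b n *m G n.+1 = G n *m SH b n) -> pres a (G n).
Proof.
move=> GS; case: n => [|n]; [exact: pres_deg0 | apply: presP => b lt_ba].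
by rewrite GS -mulmxA SH_rK // mulmx0.
Qed.

(** Stated for the full span: a substitution may turn an insertion of one letter into an insertion
    of any other. *)
Lemma pres_E b c n : pres N (@subst_mx N K b c n).
Proof.
case: n => [|n]; [exact: pres_deg0 | apply: presP => d _].
by rewrite -mul_ESH mulmxDl -mulmxA -scalemxAl !SH_rK // mulmx0 scaler0 addr0.
Qed.

Lemma pres_SG s n : pres N (@letter_mx N K s n).
Proof.
case: n => [|n]; [exact: pres_deg0 | apply: presP => d _].
rewrite -[d](permKV s); rewrite -SG_SH.
by rewrite -mulmxA SH_rK // mulmx0.
Qed.

Definition graded_trace a n (G : 'M[K]_(dm N n)) : K := \tr (rK a n *m (G *m Xd n)).
Local Notation gtr := graded_trace.

Lemma gtr_succ c (G : forall n, 'M[K]_(dm N n)) n :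
  (forall b n, SH b n *m G n.+1 = G n *m SH b n) ->
  gtr c.+1 (G n.+1) = gtr c (G n.+1) - x c * gtr c (G n).
Proof.
move=> GS; apply: (@mxtrace_quotient _ _ _ _ _ (@ins_mx N F c n)).
- exact: Isub_succ.
- exact: Isub_SH.
- by move=> V; apply: SH_regular.
- by rewrite map_SH mulmxA GS -mulmxA SH_Xd -!scalemxAr mulmxA.
- by apply/presE/presM; [apply: pres_comm | apply: pres_Xd].
Qed.

Lemma gtr_comm a n (G Y : 'M[K]_(dm N n)) : pres a G -> pres a Y ->
  \tr (rK a n *m (G *m Y)) = \tr (rK a n *m (Y *m G)).
Proof. by apply: mxtrace_rho_comm; apply: rKK. Qed.

Lemma gtr_RR n (G : 'M[K]_(dm N n)) : pres N G -> gtr N (@shuffle_mx N K n *m G) = 0.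
Proof.
move=> GP; rewrite /gtr -mulmxA gtr_comm.
- by rewrite mxtrace_mulC -(mulmxA (G *m Xd n)) RR_rK mulmx0 raddf0.
- by rewrite /pres -mulmxA RR_rK mulmx0.
- exact: presM (pres_Xd _ _).
Qed.

End GradedTrace.

Section MatrixPowers.
Variables (K : comNzRingType) (n : nat).
Implicit Types M Y : 'M[K]_n.

Definition mpow M j : 'M[K]_n := iter j (mulmx M) 1%:M.

Lemma mpow0 M : mpow M 0 = 1%:M.
Proof. by []. Qed.

Lemma mpowS M j : mpow M j.+1 = M *m mpow M j.
Proof. by []. Qed.

Lemma mpow_comm M Y j :
  Y *m M = M *m Y -> Y *m mpow M j = mpow M j *m Y.
Proof.
move=> YM; elim: j => [|j IHj]; first by rewrite mulmx1 mul1mx.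
by rewrite mpowS mulmxA YM -!mulmxA IHj.
Qed.

End MatrixPowers.

Lemma map_mpow (F K : comNzRingType) (phi : {rmorphism F -> K}) n (M : 'M[F]_n) j :
  map_mx phi (mpow M j) = mpow (map_mx phi M) j.
Proof. by elim: j => [|j IHj]; rewrite ?map_mx1 // !mpowS map_mxM IHj. Qed.

(** * Traces of the shuffle against the Casimir operator *)

Section CasimirTraces.
Variables (N : nat) (F : numFieldType) (K : comNzRingType).
Variables (phi : {rmorphism F -> K}) (x : 'I_N -> K) (h : F).
Hypothesis h2 : h *+ 2 = 1.
Local Notation A := 'I_N.
Local Notation E := (@subst_mx N K).
Local Notation SH := (@ins_mx N K).
Local Notation SG := (@letter_mx N K).
Local Notation RR := (@shuffle_mx N K).
Local Notation Cas := (@casimir_mx N K).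
Local Notation Xd := (@weight_mx N K x).
Local Notation hK := (phi h).
Local Notation TT := (@transfer_mx N K hK).
Local Notation DD := (@defect_mx N K hK).
Local Notation gtr := (@graded_trace N F K phi x).
Local Notation pres := (@ins_stable N F K phi).

Lemma hK2 : hK *+ 2 = 1.
Proof. by rewrite -rmorphMn h2 rmorph1. Qed.

Lemma map_RR n : map_mx phi (@shuffle_mx N F n) = RR n.
Proof.
rewrite /shuffle_mx raddf_sum; apply: eq_bigr => b _.
case: n => [|n]; first exact: map_mx0.
by rewrite /delins_mx /= map_mxM !map_mxw.
Qed.

Lemma map_Cas n : map_mx phi (@casimir_mx N F n) = Cas n.
Proof.
rewrite /casimir_mx raddf_sum; apply: eq_bigr => a _.
by rewrite raddf_sum; apply: eq_bigr => b _; rewrite /= map_mxM !map_mxw.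
Qed.

Lemma map_TT n : map_mx phi (transfer_mx N h n) = TT n.
Proof.
by rewrite /transfer_mx map_mxD map_mxZ map_mxB !map_scalar_mx /= !rmorph_nat map_Cas.
Qed.

Lemma map_DD n : map_mx phi (defect_mx N h n) = DD n.
Proof. by rewrite /defect_mx map_mxB map_TT map_RR. Qed.

Lemma gtrB a n (G H : 'M[K]_(dm N n)) : gtr a (G - H) = gtr a G - gtr a H.
Proof. by rewrite /graded_trace mulmxBl mulmxBr raddfB. Qed.

Lemma gtr_TT a n (G : 'M[K]_(dm N n)) :
  gtr a (G *m TT n) =
  hK * gtr a (G *m Cas n) + ('C(n.+1, 2)%:R - hK * (N * n)%:R) * gtr a G.
Proof.
have gtrD H H' : gtr a (H + H') = gtr a H + gtr a H'.
  by rewrite /graded_trace mulmxDl mulmxDr raddfD.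
have gtrZ c H : gtr a (c *: H) = c * gtr a H.
  by rewrite /graded_trace -scalemxAl -scalemxAr mxtraceZ.
rewrite /transfer_mx mulmxDr -scalemxAr mulmxBr !mul_mx_scalar gtrD gtrZ gtrB !gtrZ.
ring.
Qed.

Lemma pres0 n (Y : 'M[K]_(dm N n)) : pres 0 Y.
Proof. by rewrite /ins_stable rK0 !mulmx1 mul1mx. Qed.

Lemma pres_mpow a n (M : 'M[K]_(dm N n)) j : pres a M -> pres a (mpow M j).
Proof.
by move=> pM; elim: j => [|j IHj]; [apply: pres1 | apply: presM].
Qed.

Lemma SH_mpowDD b n j :
  SH b n *m mpow (DD n.+1) j = mpow (DD n) j *m SH b n.
Proof.
elim: j => [|j IHj]; first by rewrite mulmx1 mul1mx.
by rewrite !mpowS mulmxA mul_SHDD ?hK2 // -!mulmxA IHj.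
Qed.

Lemma pres_DD a n : pres a (DD n).
Proof.
apply: (@pres_comm _ _ _ phi a (fun k => DD k)) => b k.
exact: (mul_SHDD hK2).
Qed.

Lemma gtr_DDS n j :
  gtr N (mpow (DD n) j.+1) = gtr N (mpow (DD n) j *m TT n).
Proof.
have pDj : pres N (mpow (DD n) j) by apply/pres_mpow/pres_DD.
rewrite mpowS {1}/defect_mx mulmxBl gtrB gtr_RR // subr0 TT_comm // => a b.
by apply: mpow_comm; apply: E_DD.
Qed.

(** Mixed powers are needed because the Casimir operator gives access to [T] only: replacing one
    factor [R] by [T - D] lowers [m] and raises [j], ending with powers of [D]. *)
Definition full n m j := mpow (RR n) m *m mpow (DD n) j.

Lemma E_full a b n m j : E a b n *m full n m j = full n m j *m E a b n.
Proof.
have ER : E a b n *m RR n = RR n *m E a b n by apply: E_RR.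
have ED : E a b n *m DD n = DD n *m E a b n by apply: E_DD.
by rewrite /full mulmxA (mpow_comm _ ER) -!mulmxA (mpow_comm _ ED).
Qed.

Lemma gtr_fullS n m j :
  gtr 0 (full n m.+1 j) = gtr 0 (full n m j *m TT n) - gtr 0 (full n m j.+1).
Proof.
have TR : TT n *m RR n = RR n *m TT n by apply: TT_comm => a b; apply: E_RR.
have DR : DD n *m RR n = RR n *m DD n by rewrite mulmxBl mulmxBr TR.
rewrite -gtrB; congr (gtr 0 _).
have RTD : RR n = TT n - DD n by rewrite opprB addrC subrK.
rewrite /full mpowS {1}RTD -!mulmxA mulmxBl; congr (_ - _).
  by rewrite -/(full n m j) TT_comm ?mulmxA // => a b; apply: E_full.
by rewrite mulmxA (mpow_comm _ DR) -mulmxA.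
Qed.

Lemma map_full n m j :
  map_mx phi (mpow (@shuffle_mx N F n) m *m mpow (defect_mx N h n) j) = full n m j.
Proof. by rewrite map_mxM !map_mpow map_RR map_DD. Qed.

Lemma SG_full s n m j : SG s n *m full n m j = full n m j *m SG s n.
Proof.
have SR : SG s n *m RR n = RR n *m SG s n by apply: SG_RR.
have SD : SG s n *m DD n = DD n *m SG s n by apply: SG_DD.
by rewrite /full mulmxA (mpow_comm _ SR) -!mulmxA (mpow_comm _ SD).
Qed.

(** Permuting the variables conjugates the weight matrix by a permutation of the letters, which
    commutes with [G] and is invisible to the trace. *)
Lemma rmorph_gtr a n (G : 'M[F]_(dm N n)) (s : 'S_N) (psi : {rmorphism K -> K}) :
  (forall c, psi (phi c) = phi c) -> (forall i, psi (x i) = x (s i)) ->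
  (forall t, pres a (SG t n)) -> pres a (map_mx phi G) ->
  (forall t, SG t n *m map_mx phi G = map_mx phi G *m SG t n) ->
  psi (gtr a (map_mx phi G)) = gtr a (map_mx phi G).
Proof.
move=> psiC psiX pS pG SGG; set GK := map_mx phi G.
have -> : psi (gtr a GK) =
    \tr (rK N phi a n *m (GK *m weight_mx (x \o s) n)).
  rewrite /graded_trace /mxtrace raddf_sum; apply: eq_bigr => i _.
  rewrite !mulmxA /= /rK -map_mxM !mul_mx_diag !mxE rmorphM psiC; congr (_ * _).
  rewrite /mon; elim: (wd i) => [|b w IHw]; first by rewrite !big_nil rmorph1.
  by rewrite !big_cons rmorphM IHw psiX.
have SK : SG s n *m SG s^-1 n = 1%:M by apply: SGK.
have SK' : SG s^-1 n *m SG s n = 1%:M by rewrite -{2}[s]invgK SGK.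
have -> : weight_mx (x \o s) n = SG s n *m Xd n *m SG s^-1 n.
  by rewrite SG_Xd -mulmxA SK mulmx1.
have -> : rK N phi a n *m (GK *m (SG s n *m Xd n *m SG s^-1 n)) =
  rK N phi a n *m ((GK *m SG s n *m Xd n) *m SG s^-1 n) by rewrite !mulmxA.
rewrite gtr_comm //; last first.
  by apply: presM; [exact: presM | exact: pres_Xd].
by rewrite /graded_trace -SGG !mulmxA -(mulmxA _ (SG s^-1 n)) SK' mulmx1.
Qed.

Lemma pres_mpowDD a n j : pres a (mpow (DD n) j).
Proof. exact/pres_mpow/pres_DD. Qed.

Section CasimirRelations.
Variable theta : A -> {additive K -> K}.
Hypothesis thetaE : forall b c w,
  theta b (phi c * mon x w) = (count_mem b w)%:R * (phi c * mon x w).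

(** The diagonal substitution multiplies a word by its number of letters [b], as [theta b] does with
    its monomial. *)
Lemma theta_trace b n (M : 'M[F]_(dm N n)) :
  theta b (\tr (map_mx phi M *m Xd n)) = \tr (map_mx phi M *m (E b b n *m Xd n)).
Proof.
rewrite /mxtrace raddf_sum; apply: eq_bigr => i _ /=.
rewrite mul_mx_diag mxE [in RHS]mxE (bigD1 i) //= big1 => [|j ne_ji].
  rewrite mul_mxw_Xd wact_e_diag /ind eqxx mulr1 !mxE thetaE addr0.
  exact: mulrCA.
rewrite mul_mxw_Xd wact_e_diag /ind (inj_eq (@wd_inj _ _)) (negPf ne_ji).
by rewrite !mulr0.
Qed.

(* What Freudenthal's identity needs of the trace [X] of an operator commuting
   with gl_N and of its trace [Y] against the Casimir operator: [S i j] is the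
   trace against [E_ij E_ji]. *)
Definition casimir_rel n (X Y : K) := exists S : A -> A -> K,
  [/\ Y = \sum_i \sum_j S i j,
      forall i j, i != j -> x i * S i j = x j * S j i,
      forall i j, S i j - theta j X = S j i - theta i X,
      forall i, S i i = theta i (theta i X)
    & \sum_i theta i X = n%:R * X].

Lemma gtr_theta a n (H : 'M[F]_(dm N n)) b :
  theta b (gtr a (map_mx phi H)) = gtr a (map_mx phi H *m E b b n).
Proof.
by rewrite /graded_trace !mulmxA -map_mxM theta_trace -!mulmxA.
Qed.

Lemma addr_swapB (V : zmodType) (p q r s : V) : p + q = r + s -> p - s = r - q.
Proof. by move=> pq; rewrite -[p](addrK q) pq addrAC addrK. Qed.

Lemma gtr_casimir_rel a n (G : 'M[F]_(dm N n)) (GK := map_mx phi G) :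
  (forall b c, pres a (E b c n)) -> pres a GK ->
  (forall b c, E b c n *m GK = GK *m E b c n) ->
  casimir_rel n (gtr a GK) (gtr a (GK *m Cas n)).
Proof.
move=> pE pG EG; exists (fun b c => gtr a (GK *m (E b c n *m E c b n))); split.
- rewrite /graded_trace /casimir_mx mulmx_sumr !mulmx_suml mulmx_sumr raddf_sum.
  apply: eq_bigr => b _ /=.
  by rewrite mulmx_sumr !mulmx_suml mulmx_sumr raddf_sum.
- move=> b c _; rewrite /graded_trace.
  apply: mxtrace_rho_swap; [exact: rKK | exact: pG | exact: pE | exact: pE | |
                            exact: EG | exact: E_Xd].
  exact: pres_Xd.
- move=> b c; rewrite !gtr_theta.
  have gtrD H H' : gtr a (GK *m H) + gtr a (GK *m H') = gtr a (GK *m (H + H')).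
    by rewrite /graded_trace mulmxDr mulmxDl mulmxDr raddfD.
  have e := mul_EE K b c c b n; rewrite !eqxx !scale1r in e.
  have e1 := gtrD (E b c n *m E c b n) (E b b n); rewrite e in e1.
  exact: addr_swapB (etrans e1 (esym (gtrD (E c b n *m E b c n) (E c c n)))).
- move=> b; rewrite !gtr_theta.
  have -> : GK *m E b b n = map_mx phi (G *m @subst_mx N F b b n).
    by rewrite map_mxM map_mxw.
  by rewrite gtr_theta map_mxM map_mxw mulmxA.
- under eq_bigr do rewrite gtr_theta.
  rewrite /graded_trace -raddf_sum -mulmx_sumr -mulmx_suml -mulmx_sumr sum_Ediag.
  by rewrite mul_mx_scalar -scalemxAl -scalemxAr; exact: mxtraceZ.
Qed.

(* The traces of [R^m D^j] on all words and of [D^j] on the quotient by the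
   insertions of the letters smaller than [a]. *)
Definition chiR n m j := gtr 0 (full n m j).
Definition chiQ a n j := gtr a (mpow (DD n) j).

Lemma chiRS n m j : exists2 Y, casimir_rel n (chiR n m j) Y &
  chiR n m.+1 j = hK * Y + ('C(n.+1, 2)%:R - hK * (N * n)%:R) * chiR n m j
                  - chiR n m j.+1.
Proof.
exists (gtr 0 (full n m j *m Cas n)); last by rewrite /chiR gtr_fullS gtr_TT.
rewrite /chiR -map_full; apply: gtr_casimir_rel; rewrite ?map_full.
- by move=> b c; apply: pres0.
- exact: pres0.
by move=> b c; apply: E_full.
Qed.

Lemma chiQS n j : exists2 Y, casimir_rel n (chiQ N n j) Y &
  chiQ N n j.+1 = hK * Y + ('C(n.+1, 2)%:R - hK * (N * n)%:R) * chiQ N n j.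
Proof.
exists (gtr N (mpow (DD n) j *m Cas n)); last by rewrite /chiQ gtr_DDS gtr_TT.
rewrite /chiQ -map_DD -map_mpow; apply: gtr_casimir_rel; rewrite ?map_mpow ?map_DD.
- by move=> b c; apply: pres_E.
- exact: pres_mpowDD.
by move=> b c; apply: mpow_comm; apply: E_DD.
Qed.

End CasimirRelations.

Lemma chiQ_full n j : chiQ 0 n j = chiR n 0 j.
Proof. by rewrite /chiQ /chiR /full mpow0 mul1mx. Qed.

Lemma chiQ_succ (c : A) n j :
  chiQ c.+1 n.+1 j = chiQ c n.+1 j - x c * chiQ c n j.
Proof.
apply: (@gtr_succ _ _ _ phi x c (fun k => mpow (DD k) j)) => b k.
exact: SH_mpowDD.
Qed.

Lemma chiQ_deg0 a j : chiQ a 0 j = chiQ 0 0 j.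
Proof. by rewrite /chiQ /graded_trace !rK_deg0. Qed.

Section Symmetry.
Variables (s : 'S_N) (psi : {rmorphism K -> K}).
Hypotheses (psiC : forall c, psi (phi c) = phi c).
Hypothesis (psiX : forall i, psi (x i) = x (s i)).

Lemma rmorph_chiR n m j : psi (chiR n m j) = chiR n m j.
Proof.
rewrite /chiR -map_full; apply: (rmorph_gtr psiC psiX).
- by move=> t; apply: pres0.
- exact: pres0.
by move=> t; rewrite map_full; apply: SG_full.
Qed.

Lemma rmorph_chiQ n j : psi (chiQ N n j) = chiQ N n j.
Proof.
rewrite /chiQ -map_DD -map_mpow; apply: (rmorph_gtr psiC psiX).
- by move=> t; apply: pres_SG.
- by rewrite map_mpow map_DD; apply: pres_mpowDD.
by move=> t; rewrite map_mpow map_DD; apply: mpow_comm; apply: SG_DD.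
Qed.

End Symmetry.

Lemma chiR_trace n m :
  chiR n m 0 = \sum_i phi (mpow (@shuffle_mx N F n) m i i) * mon x (wd i).
Proof.
rewrite /chiR /full mpow0 mulmx1 /graded_trace rK0 mul1mx -map_RR -map_mpow /mxtrace.
by apply: eq_bigr => i _; rewrite mul_mx_diag !mxE.
Qed.

Lemma chiR00 n : chiR n 0 0 = (\sum_a x a) ^+ n.
Proof.
rewrite chiR_trace; under eq_bigr do rewrite mpow0 mxE eqxx rmorph1 mul1r.
transitivity (\sum_(t : n.-tuple A) mon x t).
  rewrite [RHS](reindex_onto (@enum_val _ {: n.-tuple A}) enum_rank) => [|t _].
    by apply: eq_big => // i; rewrite enum_valK eqxx.
  exact: enum_rankK.
rewrite -[n in RHS]card_ord -prodr_const bigA_distr_bigA /=.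
rewrite (reindex (fun f : {ffun 'I_n -> A} => [tuple f i | i < n])) /=.
  apply: eq_bigr => f _; rewrite /mon /= big_map.
  by rewrite big_enum.
exists (fun t : n.-tuple A => [ffun i => tnth t i]) => [f _|t _].
  by apply/ffunP=> i; rewrite ffunE tnth_mktuple.
by apply: eq_from_tnth => i; rewrite tnth_mktuple ffunE.
Qed.

End CasimirTraces.

(** * Vandermonde products and graded traces *)

Section Theta.
Variables (N : nat) (F : fieldType).
Local Notation P := {mpoly F[N]}.
Implicit Types (p q : P) (i j : 'I_N) (m : 'X_{1..N}).

Definition theta i p : P := 'X_i * p^`M(i).

Lemma theta_is_linear i : linear (theta i).
Proof.
move=> c p q; rewrite /theta linearP mulrDr; congr (_ + _).
by rewrite scalerAr.
Qed.
HB.instance Definition _ i :=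
  GRing.isLinear.Build F P P _ (theta i) (theta_is_linear i).

Lemma thetaM i p q : theta i (p * q) = theta i p * q + p * theta i q.
Proof. rewrite /theta mderivM; ring. Qed.

Lemma thetaXm i m : theta i 'X_[m] = (m i)%:R *: 'X_[m].
Proof.
rewrite /theta mderivX -scalerAr -mpolyXD.
have [->|mi_gt0] := posnP (m i); first by rewrite !scale0r.
by rewrite addmC submK // lep1mP -lt0n.
Qed.

Lemma mcoeff_theta i p m : (theta i p)@_m = (m i)%:R * p@_m.
Proof.
rewrite {1}[p]mpolyE linear_sum /= raddf_sum /= [in RHS](mpolyE p) raddf_sum /=.
rewrite mulr_sumr; apply: eq_bigr => k _.
rewrite linearZ /= thetaXm !mcoeffZ mcoeffX.
by case: eqP => [->|_]; rewrite ?mulr0 // mulrCA.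
Qed.

Lemma thetaC i (c : F) : theta i c%:MP = 0.
Proof. by rewrite /theta mderivC mulr0. Qed.

Lemma thetaX i j : theta i 'X_j = (i == j)%:R * 'X_j.
Proof. by rewrite thetaXm mnm1E eq_sym scaler_nat mulr_natl. Qed.

Lemma theta_prod (I : eqType) (s : seq I) (f : I -> P) i : uniq s ->
  theta i (\prod_(k <- s) f k) =
  \sum_(k <- s) (\prod_(l <- s | l != k) f l) * theta i (f k).
Proof.
elim: s => [|k s IHs] /=; first by rewrite !big_nil -(thetaC i 1).
case/andP=> ks /IHs{}IHs; rewrite !big_cons eqxx /= thetaM IHs mulrC; congr (_ + _).
  rewrite mulrC [in RHS]mulrC; congr (_ * _); rewrite [RHS]big_mkcond.
  apply: eq_big_seq => l ls; case: eqP => // eq_lk.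
  by rewrite -eq_lk ls in ks.
rewrite mulr_sumr; apply: eq_big_seq => l ls.
rewrite big_cons; have -> : k != l by apply: contraNneq ks => ->.
by rewrite mulrA.
Qed.

Definition pairs (p : 'I_N * 'I_N) := (p.1 < p.2)%N.
Definition vandermonde : P := \prod_(p | pairs p) ('X_p.1 - 'X_p.2).
Local Notation vdm := vandermonde.
(** The quotient of the Vandermonde product by one factor, kept as a polynomial. *)
Definition vandermonde_but (p : 'I_N * 'I_N) : P :=
  \prod_(q | pairs q && (q != p)) ('X_q.1 - 'X_q.2).
Local Notation vdm_but := vandermonde_but.

Lemma vdmD1 e : pairs e -> vdm = vdm_but e * ('X_e.1 - 'X_e.2).
Proof. by move=> pe; rewrite /vdm (bigD1 e) //= mulrC. Qed.

Lemma theta_vdm i : theta i vdm =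
  \sum_(p | pairs p) vdm_but p * ((i == p.1)%:R * 'X_p.1 - (i == p.2)%:R * 'X_p.2).
Proof.
rewrite /vdm -big_filter theta_prod ?filter_uniq ?index_enum_uniq //.
rewrite big_filter; apply: eq_bigr => p _.
rewrite big_filter_cond linearB /= !thetaX; congr (_ * _).
Qed.

Lemma sum_theta_vdm (X : P) :
  \sum_i theta i vdm * theta i X =
  \sum_(p | pairs p) vdm_but p * ('X_p.1 * theta p.1 X - 'X_p.2 * theta p.2 X).
Proof.
under eq_bigr do rewrite theta_vdm mulr_suml.
rewrite exchange_big /=; apply: eq_bigr => p _.
under eq_bigr do rewrite -mulrA.
rewrite -mulr_sumr; congr (_ * _).
under eq_bigr do rewrite mulrBl -!mulrA.
have sum1 (j : 'I_N) (G : 'I_N -> P) : \sum_i (i == j)%:R * G i = G j.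
  rewrite (bigD1 j) //= big1 => [|i /negPf->]; last by rewrite mul0r.
  by rewrite eqxx mul1r addr0.
by rewrite sumrB !sum1.
Qed.

Lemma sum_pairs (V : zmodType) (G : 'I_N -> 'I_N -> V) :
  \sum_i \sum_(j | j != i) G i j =
  \sum_(p | pairs p) (G p.1 p.2 + G p.2 p.1).
Proof.
rewrite big_split /= pair_big_dep /=.
rewrite (bigID pairs) /=; congr (_ + _).
  apply: eq_bigl => -[i j] /=; rewrite andb_idl // => lt_ij.
  by rewrite -val_eqE neq_ltn (lt_ij : (i < j)%N) orbT.
have sw_inj : injective (fun p : 'I_N * 'I_N => (p.2, p.1)).
  by move=> [a b] [c d] [-> ->].
rewrite (reindex_inj sw_inj) /=; apply: eq_bigl => -[i j] /=.
by rewrite /pairs /= -val_eqE /=; case: ltngtP.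
Qed.

Definition sumsq m := (\sum_i m i ^ 2)%N.

Lemma mcoeff_theta2 (p : P) m :
  (\sum_i theta i (theta i p))@_m = (sumsq m)%:R * p@_m.
Proof.
rewrite raddf_sum natr_sum mulr_suml; apply: eq_bigr => i _.
by rewrite /= !mcoeff_theta mulrA natrX.
Qed.

Definition staircase : 'X_{1..N} := [multinom (rev_ord i : nat) | i < N].
Local Notation delta := staircase.

Definition vdm_mon (s : 'S_N) : 'X_{1..N} :=
  [multinom (s^-1%g (rev_ord i) : nat) | i < N].

Lemma vdmE : vdm = \sum_(s : 'S_N) (-1) ^+ s * 'X_[vdm_mon s].
Proof.
have -> : vdm = \det (Vandermonde N (\row_j ('X_(rev_ord j) : P))).
  rewrite det_Vandermonde /vdm -(pair_big_dep xpredT (fun i j : 'I_N => (i < j)%N)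
    (fun i j => 'X_i - 'X_j)) /=.
  rewrite (exchange_big_dep xpredT) //= (reindex_inj rev_ord_inj) /=.
  apply: eq_bigr => i _; rewrite (reindex_inj rev_ord_inj) /=.
  apply: eq_big => [j|j _]; last by rewrite !mxE.
  by case: i j => i i_lt [j j_lt] /=; lia.
rewrite /determinant; apply: eq_bigr => s _; congr (_ * _).
rewrite mpolyXE_id [RHS](reindex_inj rev_ord_inj) /= [RHS](reindex_inj (@perm_inj _ s)).
by apply: eq_bigr => i _; rewrite !mxE mnmE rev_ordK permK.
Qed.

Lemma sumsq_vdm_mon s : sumsq (vdm_mon s) = (\sum_(i < N) i ^ 2)%N.
Proof.
rewrite /sumsq (reindex_inj rev_ord_inj) (reindex_inj (@perm_inj _ s)) /=.
by apply: eq_bigr => i _; rewrite mnmE rev_ordK permK.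
Qed.

Lemma mcoeff_vdm_delta : vdm@_delta = 1.
Proof.
rewrite vdmE raddf_sum (bigD1 1%g) //= big1 => [|s ne_s1].
  rewrite odd_perm1 expr0 mul1r mcoeffX addr0.
  have -> : vdm_mon 1 = delta by apply/mnmP=> i; rewrite !mnmE invg1 perm1.
  by rewrite eqxx.
rewrite -signr_odd; case: (odd _); rewrite ?expr1 ?mulN1r ?mul1r ?mcoeffN mcoeffX;
  (case: eqP => [eq_s|_]; rewrite ?oppr0 //);
  case/eqP: ne_s1; apply/permP=> i; rewrite perm1; move/mnmP/(_ (rev_ord (s i))): eq_s;
  by rewrite !mnmE rev_ordK permK => /val_inj.
Qed.

(** All exponents of the Vandermonde product are permutations of the staircase and so have the same
    sum of squares. *)
Lemma theta2_vdm :
  \sum_i theta i (theta i vdm) = (\sum_(i < N) i ^ 2)%N%:R * vdm.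
Proof.
apply/mpolyP=> m; rewrite mcoeff_theta2 -mpolyC_nat mcoeffCM.
have [|/memN_msupp_eq0->] := boolP (m \in msupp vdm); last by rewrite !mulr0.
rewrite mcoeff_msupp vdmE raddf_sum /=; set S := \sum_s _ => S_neq0.
suff /existsP[s /eqP<-] : [exists s, vdm_mon s == m] by rewrite sumsq_vdm_mon.
apply: contraNT S_neq0 => /existsPn no_s.
rewrite /S big1 // => s _; have /negPf ne := no_s s.
by rewrite -signr_odd; case: (odd _); rewrite ?expr1 ?mulN1r ?mul1r ?mcoeffN mcoeffX ne ?oppr0.
Qed.

End Theta.

Section FreudenthalPoly.
Variables (N : nat) (F : fieldType).
Local Notation P := {mpoly F[N]}.
Local Notation vdm := (@vandermonde N F).
Local Notation vdm_but := (@vandermonde_but N F).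

(** The first two relations determine S_ij + S_ji after multiplication by x_i - x_j, a factor
    supplied by the Vandermonde product. Summed over pairs, this gives the mixed term in the sum of
    the [theta i (theta i (vdm * X))], an operator diagonal on monomials. The constants come from
    [thX] and from [theta2_vdm]. *)
Lemma freudenthal_poly (X : P) (n : nat) (S : 'I_N -> 'I_N -> P) :
  (forall i j, i != j -> 'X_i * S i j = 'X_j * S j i) ->
  (forall i j, S i j - theta j X = S j i - theta i X) ->
  (forall i, S i i = theta i (theta i X)) ->
  \sum_i theta i X = n%:R * X ->
  forall m, (vdm * \sum_i \sum_j S i j)@_m =
    ((sumsq m)%:R - (N.-1 * n)%:R - (\sum_(i < N) i ^ 2)%N%:R) * (vdm * X)@_m.
Proof.
move=> SX SS S2 thX m.
have pairS p : pairs p -> vdm * (S p.1 p.2 + S p.2 p.1) =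
    (vdm_but p * ('X_p.1 * theta p.1 X - 'X_p.2 * theta p.2 X)) *+ 2
    - vdm * (theta p.2 X + theta p.1 X).
  move=> pp; rewrite (vdmD1 F pp).
  have ne_p : p.1 != p.2 by rewrite -val_eqE neq_ltn (pp : (p.1 < p.2)%N).
  have e1 := SX _ _ ne_p; have := SS p.1 p.2; move/(canRL (subrK _)) => e2.
  have e3 : 'X_p.1 * S p.1 p.2 = 'X_p.2 * (S p.1 p.2 - theta p.2 X + theta p.1 X).
    by rewrite e1 e2; ring.
  have e4 : S p.2 p.1 = S p.1 p.2 - theta p.2 X + theta p.1 X by rewrite e2; ring.
  rewrite e4; move: (S p.1 p.2) (theta p.1 X) (theta p.2 X) (vdm_but p) e3.
  move=> s t u w e3; rewrite mulr2n.
  have -> : w * ('X_p.1 - 'X_p.2) * (s + (s - u + t)) =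
    w * (('X_p.1 * s) *+ 2 - 'X_p.2 * s *+ 2 + ('X_p.1 - 'X_p.2) * (t - u)).
    by rewrite !mulr2n; ring.
  by rewrite e3; ring.
have sumS : vdm * \sum_i \sum_j S i j = \sum_i theta i (theta i (vdm * X)) -
   ((N.-1 * n)%:R + (\sum_(i < N) i ^ 2)%N%:R) * (vdm * X).
  have -> : \sum_i \sum_j S i j =
      \sum_i theta i (theta i X) + \sum_i \sum_(j | j != i) S i j.
    rewrite -big_split; apply: eq_bigr => i _ /=.
    by rewrite (bigD1 i) //= S2.
  rewrite mulrDr sum_pairs [X in _ + X]mulr_sumr.
  under [X in _ + X]eq_bigr do rewrite pairS //.
  rewrite sumrB sumrMnl -sum_theta_vdm.
  rewrite -[X in _ - X]mulr_sumr.
  have -> : \sum_(p | pairs p) (theta p.2 X + theta p.1 X) = N.-1%:R * (n%:R * X).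
    transitivity (\sum_i \sum_(j | j != i) theta j X); first by rewrite sum_pairs.
    have thX1 i : \sum_(j | j != i) theta j X = n%:R * X - theta i X.
      by rewrite -thX [in RHS](bigD1 i) //= [RHS]addrC addKr.
    under eq_bigr do rewrite thX1.
    rewrite sumrB sumr_const card_ord thX.
    have [N0|N_gt0] := posnP N.
      have -> : n%:R * X = 0.
        by rewrite -thX big1 // => i _; exfalso; have := ltn_ord i; rewrite [X in (_ < X)%N]N0.
      by rewrite mul0rn mulr0 subr0.
    by rewrite -[X in _ *+ X](prednK N_gt0) mulrSr addrK -[LHS]mulr_natl.
  have -> : \sum_i theta i (theta i (vdm * X)) =
     (\sum_i theta i (theta i vdm)) * X + (\sum_i theta i vdm * theta i X) *+ 2
     + vdm * \sum_i theta i (theta i X).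
    rewrite mulr_sumr mulr_suml -sumrMnl -!big_split; apply: eq_bigr => i _ /=.
    by rewrite thetaM linearD /= !thetaM mulr2n; ring.
  rewrite theta2_vdm natrM; ring.
rewrite sumS mcoeffB mcoeff_theta2 -natrD -mpolyC_nat mcoeffCM natrD; ring.
Qed.

End FreudenthalPoly.

Section Eigen.
Variables (N : nat) (F : numFieldType).
Local Notation P := {mpoly F[N]}.
Local Notation phi := (mpolyC N (R := F)).
Local Notation vdm := (@vandermonde N F).
Local Notation half := (2%:R^-1 : F).

Definition x_ (i : 'I_N) : P := 'X_i.

Lemma half2 : half *+ 2 = 1.
Proof. by rewrite -[_ *+ 2]mulr_natr mulVf ?pnatr_eq0. Qed.

Definition full_trace n m j : P := locked (chiR phi x_ half n m j).
Local Notation ftr := full_trace.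
Definition quotient_trace a n j : P := locked (chiQ phi x_ half a n j).
Local Notation qtr := quotient_trace.

Lemma theta_mon b (c : F) (w : seq 'I_N) :
  theta b (phi c * mon x_ w) = (count_mem b w)%:R * (phi c * mon x_ w).
Proof.
have H : theta b (mon x_ w) = (count_mem b w)%:R * mon x_ w.
  elim: w => [|a w IHw].
    by rewrite /mon big_nil mul0r -[1](mpolyC1) thetaC.
  rewrite mon_cons thetaM IHw /x_ thetaX /= natrD eq_sym; ring.
by rewrite thetaM thetaC mul0r add0r H mulrCA.
Qed.

(* The scalar by which [transfer_mx] acts on the coefficient of exponent [m], see
   [freudenthal_poly]. *)
Definition ceig n (m : 'X_{1..N}) : F :=
  2%:R^-1 * ((sumsq m)%:R - (N.-1 * n)%:R - (\sum_(i < N) i ^ 2)%N%:R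
             - (N * n)%:R) + 'C(n.+1, 2)%:R.

Lemma mcoeff_casimir n (X Y : P) m :
  casimir_rel x_ (fun b => theta b) n X Y ->
  (vdm * (phi half * Y + ('C(n.+1, 2)%:R - phi half * (N * n)%:R) * X))@_m =
  ceig n m * (vdm * X)@_m.
Proof.
case=> S [-> SX SS S2 thX].
have -> : 'C(n.+1, 2)%:R - phi half * (N * n)%:R =
    phi ('C(n.+1, 2)%:R - half * (N * n)%:R).
  by rewrite mpolyCB mpolyCM !mpolyC_nat.
rewrite mulrDr [vdm * (phi half * _)]mulrCA [X in (_ + X)@__]mulrCA.
rewrite mcoeffD !mcoeffCM (freudenthal_poly SX SS S2 thX) /ceig.
ring.
Qed.

Definition qcoef a n j e : F := locked (vdm * qtr a n j)@_e.
Definition fcoef n m j e : F := locked (vdm * ftr n m j)@_e.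

Lemma qcoefE a n j e : qcoef a n j e = (vdm * qtr a n j)@_e.
Proof. by rewrite /qcoef -lock. Qed.

Lemma fcoefE n m j e : fcoef n m j e = (vdm * ftr n m j)@_e.
Proof. by rewrite /fcoef -lock. Qed.

Lemma qtrE a n j : qtr a n j = chiQ phi x_ half a n j.
Proof. by rewrite /qtr -lock. Qed.

Lemma ftrE n m j : ftr n m j = chiR phi x_ half n m j.
Proof. by rewrite /ftr -lock. Qed.

Lemma qcoefS n j e : qcoef N n j.+1 e = ceig n e * qcoef N n j e.
Proof.
have [Y relY eqY] := chiQS half2 theta_mon n j.
have {}eqY := etrans (qtrE N n j.+1) eqY.
apply: etrans (qcoefE _ _ _ _) _.
apply: etrans (congr1 (fun p => (vdm * p)@_e) eqY) _.
apply: etrans (mcoeff_casimir e relY) _; congr (_ * _).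
apply/esym/(etrans (qcoefE _ _ _ _)).
exact: (congr1 (fun p => (vdm * p)@_e) (qtrE N n j)).
Qed.

Lemma qcoef_eig n j e : qcoef N n j e = ceig n e ^+ j * qcoef N n 0 e.
Proof.
elim: j => [|j IHj]; first by rewrite mul1r.
by rewrite qcoefS IHj exprS mulrA.
Qed.

Lemma fcoefS n m j e :
  fcoef n m.+1 j e = ceig n e * fcoef n m j e - fcoef n m j.+1 e.
Proof.
have [Y relY eqY] := chiRS half theta_mon n m j.
have {}eqY := etrans (ftrE n m.+1 j) eqY.
apply: etrans (fcoefE _ _ _ _) _.
apply: etrans (congr1 (fun p => (vdm * p)@_e) eqY) _.
apply: etrans (congr1 (mcoeff e) (mulrBr _ _ _)) _.
apply: etrans (mcoeffB _ _ _) _.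
congr (_ - _); last first.
  apply/esym/(etrans (fcoefE _ _ _ _)).
  exact: (congr1 (fun p => (vdm * p)@_e) (ftrE n m j.+1)).
apply: etrans (mcoeff_casimir e relY) _; congr (_ * _).
apply/esym/(etrans (fcoefE _ _ _ _)).
exact: (congr1 (fun p => (vdm * p)@_e) (ftrE n m j)).
Qed.

(** At exponent [e] the operator [T] acts by the scalar [ceig n e]; hence [R = T - D] replaces each
    value [c i] of [D] by its difference from that scalar. *)
Lemma fcoef_eig n m j e (I : finType) (Q : pred I) (d c : I -> F) :
  (forall j, fcoef n 0 j e = \sum_(i | Q i) d i * c i ^+ j) ->
  fcoef n m j e = \sum_(i | Q i) d i * (ceig n e - c i) ^+ m * c i ^+ j.
Proof.
move=> base; elim: m j => [|m IHm] j.
  by rewrite base; apply: eq_bigr => i _; rewrite mulr1.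
rewrite fcoefS !IHm mulr_sumr -sumrB; apply: eq_bigr => i _.
rewrite !exprS; ring.
Qed.

Section Symmetry.
Variable s : 'S_N.

Lemma msym_phi c : msym s (phi c) = phi c.
Proof. by rewrite -alg_mpolyC msymZ msym1. Qed.

Lemma msym_x i : msym s (x_ i) = x_ (s i).
Proof.
rewrite /x_ msymX; congr ('X_[_]); apply/mnmP=> j; rewrite !mnmE.
by rewrite -(inj_eq (@perm_inj _ s)) permKV.
Qed.

Lemma msym_ftr n m j : msym s (ftr n m j) = ftr n m j.
Proof. by rewrite ftrE; exact: (rmorph_chiR (psi := msym s : {rmorphism P -> P}) half msym_phi msym_x). Qed.

Lemma msym_qtr n j : msym s (qtr N n j) = qtr N n j.
Proof. by rewrite qtrE; exact: (rmorph_chiQ half2 (psi := msym s : {rmorphism P -> P}) msym_phi msym_x). Qed.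
End Symmetry.

Lemma qtr_full n j : qtr 0 n j = ftr n 0 j.
Proof. rewrite qtrE ftrE; exact: chiQ_full. Qed.

Lemma qtr_succ (c : 'I_N) n j :
  qtr c.+1 n.+1 j = qtr c n.+1 j - 'X_c * qtr c n j.
Proof.
apply: etrans (qtrE _ _ _) _; apply: etrans (@chiQ_succ N F P phi x_ half half2 c n j) _.
by rewrite !qtrE.
Qed.

Lemma qtr_deg0 a j : qtr a 0 j = qtr 0 0 j.
Proof. by rewrite !qtrE; exact: chiQ_deg0. Qed.

Lemma ftr00 n : ftr n 0 0 = (\sum_a 'X_a) ^+ n.
Proof. by rewrite ftrE; exact: chiR00. Qed.

End Eigen.

(** * Pieri rules for alternating coefficients *)

Section Alternating.
Variables (N : nat) (F : numFieldType).
Local Notation P := {mpoly F[N]}.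
Local Notation "m # s" := [multinom m (s i) | i < N]
  (at level 40, left associativity, format "m # s").
Implicit Types (m e l : 'X_{1..N}) (i j p q : 'I_N) (k : nat).

Definition vdmk k : P :=
  \prod_(p : 'I_N * 'I_N | pairs p && (p.2 < k)%N) ('X_p.1 - 'X_p.2).

Lemma vdmk_full : vdmk N = vandermonde N F.
Proof. by apply: eq_bigl => p; rewrite ltn_ord andbT. Qed.

Lemma msym_X (s : 'S_N) i : msym s ('X_i : P) = 'X_(s i).
Proof.
rewrite msymX; congr ('X_[_]); apply/mnmP=> j; rewrite !mnmE.
by rewrite -(inj_eq (@perm_inj _ s)) permKV.
Qed.

Lemma tperm_adj_lt p q i j : q = p.+1 :> nat -> (i, j) != (p, q) ->
  (i < j)%N -> (tperm p q i < tperm p q j)%N.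
Proof.
move=> qp; rewrite xpair_eqE -!val_eqE /=.
by case: tpermP => [->|->|/eqP + /eqP]; case: tpermP => [->|->|/eqP + /eqP];
  rewrite -?val_eqE /=; lia.
Qed.

Lemma msym_vdmk k p q : q = p.+1 :> nat -> (q < k)%N ->
  msym (tperm p q) (vdmk k) = - vdmk k.
Proof.
move=> qp qk; set s := tperm p q.
have pq : pairs (p, q) && ((p, q).2 < k)%N by rewrite /pairs /= qp ltnSn -qp.
rewrite /vdmk rmorph_prod (bigD1 (p, q)) //= [in RHS](bigD1 (p, q)) //= -mulNr.
rewrite rmorphB /= !msym_X tpermL tpermR opprB; congr (_ * _).
pose f (r : 'I_N * 'I_N) := (s r.1, s r.2).
have fK : involutive f by case=> a b; rewrite /f /= !tpermK.
pose Q r := pairs r && (r.2 < k)%N && (r != (p, q)).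
have Qf r : Q r -> Q (f r).
  case: r => a b /andP[/andP[lt_ab lt_bk] ne_ab]; rewrite /f /Q /pairs /=.
  rewrite (tperm_adj_lt qp) //=; apply/andP; split.
    by rewrite /s; case: tpermP => // _; rewrite -?qp // ltnW // -qp.
  apply: contraTneq lt_ab => -[sa sb].
  have -> : a = q by rewrite -(tpermK p q a) -/s sa /s tpermL.
  have -> : b = p by rewrite -(tpermK p q b) -/s sb /s tpermR.
  by rewrite /pairs /= qp ltnNge leqnSn.
rewrite [RHS](reindex_inj (inv_inj fK)) /=; apply: eq_big => [r|r _].
  by apply/idP/idP=> [/Qf //|/Qf]; rewrite fK.
by rewrite rmorphB /= !msym_X.
Qed.

(** Adjacent transpositions suffice as a definition, since the cancellations exchange neighbouring
    exponents; [k] bounds the variables in which the sign change holds. *)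
Definition alternating k (A : 'X_{1..N} -> F) := forall p q,
  q = p.+1 :> nat -> (q < k)%N -> forall m, A (m#(tperm p q)) = - A m.

Lemma alternating_coef k (X : P) : (forall s, msym s X = X) ->
  alternating k (fun e => (vdmk k * X)@_e).
Proof.
move=> sX p q qp qk m; rewrite -mcoeff_sym msymM msym_vdmk // sX.
by rewrite mulNr mcoeffN.
Qed.

Lemma alternating_eq0 k A p q m : alternating k A ->
  q = p.+1 :> nat -> (q < k)%N -> m p = m q -> A m = 0.
Proof.
move=> altA qp qk eq_m; have := altA p q qp qk m.
have -> : m#(tperm p q) = m.
  by apply/mnmP=> i; rewrite mnmE; case: tpermP => [->|->|].
move/eqP; rewrite -addr_eq0 -mulr2n mulrn_eq0 /= => /eqP //.
Qed.

Lemma sum_alternating0 k A p q M (Q : pred 'X_{1..N}) : alternating k A ->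
  q = p.+1 :> nat -> (q < k)%N -> (forall m, Q (m#(tperm p q)) = Q m) ->
  \sum_(g : 'X_{1..N < M} | Q g) A g = 0.
Proof.
move=> altA qp qk QS.
have deg_sw (g : 'X_{1..N < M}) : (mdeg ((g : 'X_{1..N})#(tperm p q)) < M)%N.
  by rewrite mdeg_mperm bmdeg.
pose sw g : 'X_{1..N < M} := BMultinom (deg_sw g).
have swK : involutive sw.
  move=> g; apply/val_inj/mnmP=> i /=; by rewrite !mnmE tpermK.
set S := \sum_(g | _) _; have : S = - S.
  rewrite {1}/S (reindex_inj (inv_inj swK)) /= -sumrN.
  by apply: eq_big => [g|g _]; [apply: QS | apply: altA].
by move/eqP; rewrite -addr_eq0 -mulr2n mulrn_eq0 => /eqP.
Qed.

(* Summing an alternating function over a box, the terms whose exponents fail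
   to interlace with the corner [l] cancel in pairs. *)
Lemma pieri_down A l M : alternating N A ->
  (forall p q, q = p.+1 :> nat -> (l q <= l p)%N) ->
  \sum_(g : 'X_{1..N < M} | (g <= l)%MM) A g =
  \sum_(g : 'X_{1..N < M} | (g <= l)%MM &&
     [forall p : 'I_N, forall q : 'I_N,
        (q == p.+1 :> nat) ==> (l q < (g : 'X_{1..N}) p)%N]) A g.
Proof.
move=> altA dec_l.
pose Q t (g : 'X_{1..N}) := (g <= l)%MM &&
  [forall p : 'I_N, forall q : 'I_N, (p < t)%N && (q == p.+1 :> nat) ==> (l q < g p)%N].
have Qt t : \sum_(g : 'X_{1..N < M} | (g <= l)%MM) A g =
    \sum_(g : 'X_{1..N < M} | Q t g) A g.
  elim: t => [|t ->].
    apply: eq_bigl => g; rewrite /Q [X in _ && X](_ : _ = true) ?andbT //.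
    by apply/forallP=> p; apply/forallP=> q.
  have [lt_tN|le_Nt] := ltnP t.+1 N; last first.
    apply: eq_bigl => g; rewrite /Q; congr (_ && _).
    apply: eq_forallb => p; apply: eq_forallb => q; congr (_ ==> _).
    by apply/idP/idP; have := ltn_ord q; have := ltn_ord p; lia.
  pose p := Ordinal (ltnW lt_tN); pose q := Ordinal lt_tN.
  rewrite (bigID (fun g : 'X_{1..N < M} => (l q < (g : 'X_{1..N}) p)%N)) /=.
  rewrite [X in _ + X](@sum_alternating0 N _ p q _
     (fun g => Q t g && ~~ (l q < g p)%N)) ?addr0 //.
    apply: eq_bigl => g; rewrite /Q -andbA; congr (_ && _).
    apply/andP/forallP=> [[/forallP Hg lq] p'|Hg].
      apply/forallP=> q'; apply/implyP=> /andP[+ /eqP q'p].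
      rewrite ltnS leq_eqVlt => /predU1P[p't|lt_p't].
        have -> : p' = p by apply: val_inj.
        by have -> : q' = q by apply: val_inj; rewrite /= q'p p't.
      have /forallP/(_ q')/implyP := Hg p'; apply.
      by rewrite lt_p't q'p eqxx.
    split.
      apply/forallP=> p'; apply/forallP=> q'; apply/implyP=> /andP[lt_p't q'p].
      have /forallP/(_ q')/implyP := Hg p'; apply.
      by rewrite ltnS ltnW.
    have /forallP/(_ q)/implyP := Hg p; apply.
    by rewrite /= ltnSn eqxx.
  have dec_pq : (l q <= l p)%N by apply: dec_l.
  (* When [m p <= l q], the exchange stays in the box because [m q <= l q <= l p], and the condition
     survives since [m q <= l q]. *)
  have QS m : Q t m && ~~ (l q < m p)%N -> Q t (m#(tperm p q)) && ~~ (l q < (m#(tperm p q)) p)%N.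
    case/andP=> /andP[/mnm_lepP le_m /forallP Hm]; rewrite -leqNgt => le_pq.
    apply/andP; split; last by rewrite mnmE tpermL -leqNgt le_m.
    apply/andP; split.
      apply/mnm_lepP=> i; rewrite mnmE; case: tpermP => [->|->|_ _] //.
      exact: leq_trans (le_m q) dec_pq.
    apply/forallP=> p'; apply/forallP=> q'; apply/implyP=> lt_p't.
    have /forallP/(_ q')/implyP/(_ lt_p't) := Hm p'; rewrite mnmE tpermD //.
      by case/andP: lt_p't => + _; apply: contraTneq => <-; rewrite ltnn.
    by case/andP: lt_p't => + _; apply: contraTneq => <-; rewrite /= ltnNge ltnW.
  move=> m; apply/idP/idP=> [/QS|/QS //].
  by rewrite -mpermM tperm2 mperm1.
rewrite (Qt N); apply: eq_bigl => g; rewrite /Q; congr (_ && _).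
by apply: eq_forallb => p; apply: eq_forallb => q; rewrite ltn_ord.
Qed.

End Alternating.

(** [h] maps the [ok] part of [B] bijectively onto the complement of [B0] in [B], so all terms
    outside [B0] cancel. *)
Lemma sum_telescope (T : finType) (V : zmodType) (B B0 ok : pred T)
    (h h' : T -> T) (Z Z' : T -> V) :
  (forall g, B0 g -> B g) ->
  (forall g, B g -> Z' g = Z g - (if ok g then Z (h g) else 0)) ->
  (forall g, B g -> ok g -> [/\ B (h g), ~~ B0 (h g) & h' (h g) = g]) ->
  (forall g, B g -> ~~ B0 g -> [/\ B (h' g), ok (h' g) & h (h' g) = g]) ->
  \sum_(g | B g) Z' g = \sum_(g | B0 g) Z g.
Proof.
move=> sB0B eqZ hP h'P; rewrite (eq_bigr _ eqZ) sumrB -big_mkcondr /=.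
rewrite (bigID B0) /= [X in X + _ - _](eq_bigl B0) => [|g]; last first.
  by rewrite andbC andb_idr // => /sB0B.
rewrite -addrA [X in _ + X](_ : _ = 0) ?addr0 //; apply/eqP; rewrite subr_eq0.
apply/eqP; rewrite (reindex_onto h h') /= => [|g /andP[Bg /(h'P _ Bg)[]]] //.
apply: eq_bigl => g; apply/idP/idP.
  case/andP=> /andP[Bhg nB0hg] /eqP h'hg.
  by have [] := h'P _ Bhg nB0hg; rewrite h'hg => -> ->.
by case/andP=> Bg okg; have [-> -> ->] := hP _ Bg okg; rewrite eqxx.
Qed.

Section Boxes.
Variables (N : nat) (F : numFieldType).
Local Notation P := {mpoly F[N]}.
Implicit Types (m e l : 'X_{1..N}) (i j p q : 'I_N) (k : nat).

Lemma mcoeff_mulX (X : P) i e :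
  ('X_i * X)@_e = if e i == 0%N then 0 else X@_(e - U_(i)).
Proof.
have [ei0|ei] := eqVneq; last first.
  by rewrite mulrC -{1}(submK (_ : U_(i) <= e)%MM) ?lep1mP // addmC mcoeffMX.
rewrite [X]mpolyE mulr_sumr raddf_sum big1 // => m _ /=.
rewrite -scalerAr -mpolyXD mcoeffZ mcoeffX; case: eqP => [e_m|_]; last exact: mulr0.
by move: ei0; rewrite -e_m mnmDE mnm1E eqxx.
Qed.

Lemma bmnm_insub M (g : 'X_{1..N < M}) e : (mdeg e < M)%N ->
  val (insubd g e : 'X_{1..N < M}) = e.
Proof. by move=> lt_e; rewrite val_insubd lt_e. Qed.

(** The recursion is multiplication by 1 - x_a. Inverting it by a geometric series lets the exponent
    of x_a run from 0 to [l a]. *)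
Lemma box_sum (Z : nat -> 'X_{1..N} -> F) :
  (forall (a : 'I_N) e,
     Z a.+1 e = Z a e - (if e a != 0%N then Z a (e - U_(a))%MM else 0)) ->
  forall l M, (mdeg l < M)%N ->
  Z 0 l = \sum_(g : 'X_{1..N < M} | (g <= l)%MM) Z N g.
Proof.
move=> ZS l M lt_lM.
pose B a (g : 'X_{1..N < M}) := (g <= l)%MM &&
  [forall i : 'I_N, (a <= i)%N ==> ((g : 'X_{1..N}) i == l i)].
have step a : (a <= N)%N -> Z 0 l = \sum_(g | B a g) Z a g.
  elim: a => [_|a IHa lt_aN].
    rewrite (big_pred1 (BMultinom lt_lM)) // => g; rewrite /B /= -val_eqE /=.
    apply/andP/eqP=> [[_ /forallP gl]|->].
      by apply/mnmP=> i; apply/eqP; have := gl i.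
    by rewrite lepm_refl; split=> //; apply/forallP=> i.
  rewrite (IHa (ltnW lt_aN)); pose i := Ordinal lt_aN; apply/esym.
  apply: (@sum_telescope _ _ (B a.+1) (B a) (fun g => (g : 'X_{1..N}) i != 0%N)
    (fun g => insubd g (g - U_(i))%MM) (fun g => insubd g (g + U_(i))%MM)).
  - move=> g /andP[le_g /forallP Hg]; rewrite /B le_g.
    apply/forallP=> j; apply/implyP=> lt_aj.
    by have /implyP := Hg j; apply; exact: ltnW.
  - move=> g Bg; rewrite (ZS i g); case: ifP => // _.
    by rewrite bmnm_insub // (leq_ltn_trans (mdegB _ _)) ?bmdeg.
  - move=> g /andP[/mnm_lepP le_g /forallP Hg] gi.
    have lt1 : (mdeg (g - U_(i))%MM < M)%N.
      by rewrite (leq_ltn_trans (mdegB _ _)) ?bmdeg.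
    split.
    + rewrite /B bmnm_insub //; apply/andP; split.
        apply/mnm_lepP=> j; rewrite mnmBE; exact: leq_trans (leq_subr _ _) _.
      apply/forallP=> j; apply/implyP=> lt_aj.
      rewrite mnmBE mnm1E -val_eqE /= (ltn_eqF lt_aj) subn0.
      by have /implyP-> := Hg j.
    + rewrite /B bmnm_insub // negb_and orbC.
      apply/orP; left; apply/forallPn; exists i.
      rewrite leqnn /= mnmBE mnm1E eqxx; have := le_g i; move: gi; lia.
    apply/val_inj; rewrite /= !bmnm_insub //; last by rewrite submK ?bmdeg // lep1mP.
    by rewrite submK // lep1mP.
  move=> g /andP[/mnm_lepP le_g /forallP Hg]; rewrite /B negb_and.
  have -> /= : (g <= l)%MM by apply/mnm_lepP.
  case/forallPn=> j; rewrite negb_imply => /andP[le_aj ne_j].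
  have eq_ji : j = i.
    apply/val_inj/eqP; rewrite /= eqn_leq le_aj andbT leqNgt.
    by apply: contra ne_j => /(implyP (Hg j)).
  rewrite eq_ji in ne_j.
  have lt_gi : (g i < l i)%N by rewrite ltn_neqAle ne_j le_g.
  have le_gl : (g + U_(i) <= l)%MM.
    apply/mnm_lepP=> j'; rewrite mnmDE mnm1E; have [<-|_] := eqVneq i j'.
      by rewrite addn1.
    by rewrite addn0.
  have lt1 : (mdeg (g + U_(i))%MM < M)%N.
    apply: leq_ltn_trans lt_lM; rewrite !mdegE; apply: leq_sum => j' _.
    by move/mnm_lepP: le_gl; apply.
  split.
  - rewrite bmnm_insub // le_gl; apply/forallP=> j'; apply/implyP=> lt_aj.
    rewrite mnmDE mnm1E -val_eqE /= (ltn_eqF lt_aj) addn0.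
    by have /implyP-> := Hg j'.
  - by rewrite bmnm_insub // mnmDE mnm1E eqxx addn1.
  by apply/val_inj; rewrite /= !bmnm_insub ?addmK ?bmdeg.
rewrite (step N) //; apply: eq_bigl => g; rewrite /B; case: (_ <= _)%MM => //=.
by apply/forallP=> i; rewrite leqNgt ltn_ord.
Qed.

End Boxes.

Section Peel.
Variables (N : nat) (F : numFieldType).
Local Notation P := {mpoly F[N]}.
Local Notation "m # s" := [multinom m (s i) | i < N]
  (at level 40, left associativity, format "m # s").
Implicit Types (m e l : 'X_{1..N}) (i j p q : 'I_N).
Variable k : 'I_N.

(* A box growing from [l] in the variables of index smaller than [t], at the
   expense of the variable [k]. *)
Definition upbox t l e := (mdeg e == mdeg l) && [forall i : 'I_N,
  if (i < t)%N then (l i <= e i)%N else (i == k) || (e i == l i)].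

(** The recursion is multiplication by 1 - x_k / x_t; its inverse moves units of exponent from [k]
    to [t], at constant degree. *)
Lemma upbox_sum (Z : nat -> 'X_{1..N} -> F) :
  (forall t : 'I_N, (t < k)%N -> forall e,
     Z t.+1 e = Z t e - (if e k != 0%N then Z t (e + U_(t) - U_(k))%MM else 0)) ->
  forall l M, (mdeg l < M)%N ->
  Z 0 l = \sum_(g : 'X_{1..N < M} | upbox k l g) Z k g.
Proof.
move=> ZS l M lt_lM.
pose B t (g : 'X_{1..N < M}) := upbox t l g.
suff step t : (t <= k)%N -> Z 0 l = \sum_(g | B t g) Z t g by exact: step.
elim: t => [_|t IHt lt_tk].
  rewrite (big_pred1 (BMultinom lt_lM)) // => g; rewrite /B /upbox /= -val_eqE /=.
  apply/andP/eqP=> [[/eqP dg /forallP gl]|->].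
    have eq_i i : i != k -> (g : 'X_{1..N}) i = l i.
      by move=> ne_ik; have := gl i; rewrite /= (negPf ne_ik) => /eqP.
    apply/mnmP=> i; have [->|/eq_i//] := eqVneq i k.
    move: dg; rewrite !mdegE (bigD1 k) //= [X in _ = X](bigD1 k) //=.
    by rewrite (eq_bigr l) => [/addIn|j /eq_i].
  by rewrite eqxx; split=> //; apply/forallP=> i; rewrite eqxx orbT.
have t_lt : (t < N)%N by rewrite (ltn_trans lt_tk).
rewrite (IHt (ltnW lt_tk)); pose i := Ordinal t_lt; apply/esym.
have ne_ik : i != k by rewrite -val_eqE /= ltn_eqF.
have ne_ki : k != i by rewrite eq_sym.
pose up (g : 'X_{1..N}) := (g + U_(i) - U_(k))%MM; pose dn (g : 'X_{1..N}) := (g - U_(i) + U_(k))%MM.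
have upE (g : 'X_{1..N}) j : up g j = (g j + (i == j) - (k == j))%N by rewrite mnmBE mnmDE !mnm1E.
have dnE (g : 'X_{1..N}) j : dn g j = (g j - (i == j) + (k == j))%N by rewrite mnmDE mnmBE !mnm1E.
have deg_up (g : 'X_{1..N}) : g k != 0%N -> mdeg (up g) = mdeg g.
  move=> gk; have le_kg : (U_(k) <= g + U_(i))%MM.
    by rewrite lep1mP mnmDE -lt0n ltn_addr ?lt0n.
  by have := congr1 (@mdeg N) (submK le_kg); rewrite !mdegD !mdeg1 => /addIn.
have deg_dn (g : 'X_{1..N}) : g i != 0%N -> mdeg (dn g) = mdeg g.
  move=> gi; have le_ig : (U_(i) <= g)%MM by rewrite lep1mP.
  by rewrite mdegD mdeg1 -(mdeg1 i) -mdegD submK.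
have dnK (g : 'X_{1..N}) : g i != 0%N -> up (dn g) = g.
  move=> gi; apply/mnmP=> j; rewrite upE dnE.
  have [<-|_] := eqVneq i j; rewrite /= ?(negPf ne_ki); move: gi; lia.
have upK (g : 'X_{1..N}) : g k != 0%N -> dn (up g) = g.
  move=> gk; apply/mnmP=> j; rewrite dnE upE.
  have [<-|_] := eqVneq k j; rewrite /= ?(negPf ne_ik); move: gk; lia.
apply: (@sum_telescope _ _ (B t.+1) (B t) (fun g => (g : 'X_{1..N}) k != 0%N)
    (fun g => insubd g (up g)) (fun g => insubd g (dn g))).
- move=> g /andP[dg /forallP Hg]; rewrite /B /upbox dg /=; apply/forallP=> j.
  have := Hg j; rewrite ltnS; case: ltngtP => // jt /orP[/eqP jk|/eqP->//].
  by move: lt_tk; rewrite -jk; move: jt; lia.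
- move=> g _; rewrite (ZS i lt_tk g); case: ifP => // gk.
  by rewrite bmnm_insub // -/(up _) deg_up ?bmdeg.
- move=> g /andP[dg /forallP Hg] gk.
  have lt1 : (mdeg (up g) < M)%N by rewrite deg_up ?bmdeg.
  have le_gi := Hg i; rewrite /= ltnSn in le_gi.
  split.
  + rewrite /B /upbox bmnm_insub // deg_up // dg; apply/forallP=> j.
    have := Hg j; rewrite upE; case: ltnP => [lt_jt|le_tj].
      have -> : (k == j) = false by rewrite -val_eqE /=; lia.
      by rewrite subn0 => /leq_trans-> //; rewrite leq_addr.
    have -> : (i == j) = false by rewrite -val_eqE /=; lia.
    case/orP=> [->//|/eqP->]; rewrite addn0 eq_sym.
    by case: eqP => [//|_] /=; rewrite subn0 eqxx.
  + rewrite /B /upbox bmnm_insub // negb_and; apply/orP; right.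
    apply/forallPn; exists i; rewrite ltnn (negPf ne_ik) /= upE eqxx (negPf ne_ki).
    move: le_gi; lia.
  by apply/val_inj; rewrite /= !bmnm_insub ?upK ?bmdeg.
move=> g /andP[dg /forallP Hg] nBg.
have lt_lg : (l i < (g : 'X_{1..N}) i)%N.
  move: nBg; rewrite /B /upbox dg /= => /forallPn[j]; have := Hg j.
  rewrite ltnS; case: (ltngtP j t) => [lt_jt -> //|lt_tj -> //|eq_jt le_lg].
  have -> : j = i by apply: val_inj.
  rewrite negb_or => /andP[_ ne_g]; rewrite ltn_neqAle eq_sym ne_g.
  by have := Hg i; rewrite ltnSn.
have gi : (g : 'X_{1..N}) i != 0%N by rewrite -lt0n (leq_ltn_trans _ lt_lg).
have lt1 : (mdeg (dn g) < M)%N by rewrite deg_dn ?bmdeg.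
split.
- rewrite /B /upbox bmnm_insub // deg_dn // dg; apply/forallP=> j.
  have := Hg j; rewrite dnE; case: ltnP => [lt_jt|le_tj].
    have -> : (k == j) = false by rewrite -val_eqE /=; lia.
    rewrite addn0; have [<-|_] := eqVneq i j; last by rewrite subn0.
    by move=> _; move: lt_lg; lia.
  have -> : (i == j) = false by rewrite -val_eqE /=; lia.
  case/orP=> [->//|/eqP->]; rewrite subn0 eq_sym.
  by case: eqP => [//|_] /=; rewrite addn0 eqxx.
- by rewrite bmnm_insub // dnE eqxx addn1.
by apply/val_inj; rewrite /= !bmnm_insub ?dnK ?bmdeg.
Qed.

(* The upward analogue of [pieri_down]; the cancellation now starts from the
   last exponent. *)
Lemma pieri_up (A : 'X_{1..N} -> F) l M : alternating k.+1 A ->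
  (forall p q, q = p.+1 :> nat -> (q < k)%N -> (l q <= l p)%N) ->
  \sum_(g : 'X_{1..N < M} | upbox k l g) A g =
  \sum_(g : 'X_{1..N < M} | upbox k l g &&
     [forall p : 'I_N, forall q : 'I_N, (p < k)%N && (q == p.+1 :> nat) ==>
        ((g : 'X_{1..N}) q < l p)%N]) A g.
Proof.
move=> altA dec_l.
pose Q t (g : 'X_{1..N}) := upbox k l g &&
  [forall p : 'I_N, forall q : 'I_N,
     (k - t <= p < k)%N && (q == p.+1 :> nat) ==> (g q < l p)%N].
have Qt t : (t <= k)%N -> \sum_(g : 'X_{1..N < M} | upbox k l g) A g =
    \sum_(g : 'X_{1..N < M} | Q t g) A g.
  elim: t => [_|t IHt lt_tk].
    apply: eq_bigl => g; rewrite /Q [X in _ && X](_ : _ = true) ?andbT //.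
    apply/forallP=> p; apply/forallP=> q; apply/implyP=> /andP[/andP[]]; lia.
  rewrite (IHt (ltnW lt_tk)).
  have p_lt : (k - t.+1 < N)%N by have := ltn_ord k; lia.
  have q_lt : (k - t < N)%N by have := ltn_ord k; lia.
  pose p := Ordinal p_lt; pose q := Ordinal q_lt.
  have qp : q = p.+1 :> nat by rewrite /=; lia.
  rewrite (bigID (fun g : 'X_{1..N < M} => ((g : 'X_{1..N}) q < l p)%N)) /=.
  rewrite [X in _ + X](@sum_alternating0 _ _ k.+1 _ p q _
     (fun g => Q t g && ~~ (g q < l p)%N)) ?addr0 //; last 1 first.
  (* When [m' q >= l p], both exponents meet both lower bounds and can be exchanged; if [q] is [k]
     itself, its exponent carries no bound. *)
  - move=> m; have QS m' : Q t m' && ~~ (m' q < l p)%N ->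
        Q t (m'#(tperm p q)) && ~~ ((m'#(tperm p q)) q < l p)%N.
      case/andP=> /andP[/andP[dm /forallP Hbox] /forallP Hm]; rewrite -leqNgt => le_pq.
      have lt_pk : (p < k)%N by rewrite /=; lia.
      have le_lp : (l p <= m' p)%N by have := Hbox p; rewrite lt_pk.
      apply/andP; split; last by rewrite mnmE tpermR -leqNgt.
      apply/andP; split.
        rewrite /upbox mdeg_mperm dm; apply/forallP=> i; rewrite mnmE.
        case: tpermP => [->|->|_ _]; last exact: Hbox.
          by rewrite lt_pk.
        case: ifP => [lt_qk|ge_qk]; first exact: leq_trans (dec_l p q qp lt_qk) le_lp.
        by apply/orP; left; rewrite -val_eqE /=; move: ge_qk => /=; lia.
      apply/forallP=> p'; apply/forallP=> q'; apply/implyP=> lt_p'k.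
      have /forallP/(_ q')/implyP/(_ lt_p'k) := Hm p'; rewrite mnmE tpermD //;
        rewrite -val_eqE /=; move: lt_p'k => /andP[/andP[]] + + /eqP; lia.
    by apply/idP/idP=> [/QS|/QS //]; rewrite -mpermM tperm2 mperm1.
  apply: eq_bigl => g; rewrite /Q -andbA; congr (_ && _).
  apply/andP/forallP=> [[/forallP Hg lq] p'|Hg].
    apply/forallP=> q'; apply/implyP=> /andP[/andP[le_p' lt_p'] /eqP q'p].
    have [p't|ne_p't] := eqVneq (p' : nat) p.
      have -> : p' = p by apply: val_inj.
      by have -> : q' = q by apply: val_inj; apply: etrans q'p _; rewrite p't -qp.
    have /forallP/(_ q')/implyP := Hg p'; apply.
    by rewrite lt_p' q'p eqxx !andbT; move: ne_p't le_p' => /=; lia.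
  split.
    apply/forallP=> p'; apply/forallP=> q'; apply/implyP=> /andP[/andP[le_p' lt_p'] q'p].
    have /forallP/(_ q')/implyP := Hg p'; apply.
    by rewrite q'p lt_p' !andbT; move: le_p'; lia.
  have /forallP/(_ q)/implyP := Hg p; apply.
  by rewrite qp eqxx andbT /=; lia.
  by rewrite /=; lia.
rewrite (Qt k) //; apply: eq_bigl => g; rewrite /Q; congr (_ && _).
by apply: eq_forallb => p; apply: eq_forallb => q; rewrite subnn.
Qed.

(* These polynomials interpolate between [vdmk k] (times a monomial) and
   [vdmk k.+1]. *)
Definition wpeel (t : nat) (X : P) : P :=
  vdmk N F k * (\prod_(j : 'I_N | (j < k)%N) if (j < t)%N then 'X_j - 'X_k else 'X_j) * X.

Lemma wpeel0 X m : (wpeel 0 X)@_(m + \sum_(j : 'I_N | (j < k)%N) U_(j)) = (vdmk N F k * X)@_m.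
Proof.
by rewrite /wpeel /= mprodXE mulrAC addmC mcoeffMX.
Qed.

Lemma wpeelk X : wpeel k X = vdmk N F k.+1 * X.
Proof.
rewrite /wpeel; congr (_ * _).
rewrite /vdmk [RHS](bigID (fun p : 'I_N * 'I_N => p.2 == k)) /= mulrC; congr (_ * _).
  rewrite (eq_bigr (fun j : 'I_N => 'X_j - 'X_k)) => [|j ->] //.
  rewrite [RHS](reindex_onto (fun j : 'I_N => (j, k) : 'I_N * 'I_N) (fun p : 'I_N * 'I_N => p.1)) /= => [|[a b] /andP[_ /eqP /= ->] //].
  by apply: eq_bigl => j; rewrite /pairs /= !eqxx ltnSn !andbT.
apply: eq_bigl => -[a b] /=; rewrite -andbA; congr (_ && _).
by rewrite -val_eqE /=; lia.
Qed.

Lemma wpeel_step (t : 'I_N) X e : (t < k)%N ->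
  (wpeel t.+1 X)@_e =
  (wpeel t X)@_e - (if e k != 0%N then (wpeel t X)@_(e + U_(t) - U_(k)) else 0).
Proof.
(* Multiplication by the variable [t] clears the quotient x_k / x_t hidden in the recursion. *)
move=> lt_tk; suff e1 : 'X_t * (wpeel t X - wpeel t.+1 X) = 'X_k * wpeel t X.
  apply/eqP; rewrite eq_sym subr_eq addrC -subr_eq -mcoeffB.
  rewrite -(mcoeffMX _ U_(t)) mulrC e1 mcoeff_mulX addmC mnmDE mnm1E.
  have -> : (t == k) = false by rewrite -val_eqE /=; lia.
  rewrite addn0. by case: (e k == 0%N).
pose R : P := \prod_(j : 'I_N | (j < k)%N && (j != t))
  (if (j < t)%N then 'X_j - 'X_k else 'X_j).
have e0 : \prod_(j : 'I_N | (j < k)%N) (if (j < t)%N then 'X_j - 'X_k else 'X_j)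
    = 'X_t * R by rewrite (bigD1 t) //= ltnn.
have e1 : \prod_(j : 'I_N | (j < k)%N) (if (j < t.+1)%N then 'X_j - 'X_k else 'X_j)
    = ('X_t - 'X_k) * R.
  rewrite (bigD1 t) //= ltnSn; congr (_ * _); apply: eq_bigr => j /andP[_ ne_jt].
  by rewrite ltnS leq_eqVlt (inj_eq val_inj) (negPf ne_jt).
by rewrite /wpeel e0 e1; ring.
Qed.

End Peel.

(** Reindexing along a relation: exponents and partitions are matched by an encoding whose inverse
    is available only as an existence statement. *)
Lemma sum_rel (V : nmodType) (I J : finType) (P : pred I) (Q : pred J)
    (r : I -> J -> bool) (F : I -> V) (G : J -> V) :
  (forall i, P i -> exists2 j, Q j && r i j & forall j', Q j' -> r i j' -> j' = j) ->
  (forall j, Q j -> exists2 i, P i && r i j & forall i', P i' -> r i' j -> i' = i) ->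
  (forall i j, P i -> Q j -> r i j -> F i = G j) ->
  \sum_(i | P i) F i = \sum_(j | Q j) G j.
Proof.
move=> exJ exI eqFG.
transitivity (\sum_(i | P i) \sum_(j | Q j && r i j) G j).
  apply: eq_bigr => i Pi; have [j /andP[Qj rij] uj] := exJ i Pi.
  rewrite (big_pred1 j) => [|j']; first exact: eqFG.
  apply/andP/eqP=> [[]|->//]; exact: uj.
rewrite (exchange_big_dep Q) /= => [|i j _ /andP[]//].
apply: eq_bigr => j Qj; have [i /andP[Pi rij] ui] := exI j Qj.
rewrite (big_pred1 i) // => i'; rewrite Qj /=.
apply/andP/eqP=> [[]|->//]; exact: ui.
Qed.

Section PartExponents.
Variables (N : nat).
Local Notation delta := (@staircase N).
Implicit Types (la mu : seq nat) (g e l : 'X_{1..N}).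
Local Open Scope nat_scope.

Definition part_exp la : 'X_{1..N} := [multinom nth 0 la i + rev_ord i | i < N].
Local Notation pexp := part_exp.

Definition strict_exp g :=
  [forall p : 'I_N, forall q : 'I_N, (q == p.+1 :> nat) ==> (g q < g p)].

Lemma strict_expP g :
  reflect (forall p q : 'I_N, q = p.+1 :> nat -> g q < g p) (strict_exp g).
Proof.
apply: (iffP forallP) => [H p q /eqP qp|H p].
  by have /forallP/(_ q)/implyP := H p; apply.
by apply/forallP=> q; apply/implyP=> /eqP; apply: H.
Qed.

Lemma pexp_strict la : is_part la -> strict_exp (pexp la).
Proof.
move=> pla; apply/strict_expP=> p q qp; rewrite !mnmE.
by have := part_nth_anti pla (leqnSn p); rewrite /= -qp; have := ltn_ord q; lia.
Qed.

Lemma sumn_nth_le la : size la <= N -> sumn la = \sum_(i < N) nth 0 la i.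
Proof.
move=> le_N; rewrite sumn_nth -(big_mkord xpredT) -(big_mkord xpredT (fun i => nth 0 la i)).
rewrite [RHS](big_cat_nat _ le_N) //= [X in _ = _ + X]big_nat_cond [X in _ = _ + X]big1 ?addn0 //.
by move=> i /andP[/andP[le_i _] _]; rewrite nth_default.
Qed.

Lemma mdeg_pexp la : size la <= N -> mdeg (pexp la) = sumn la + mdeg delta.
Proof.
move=> le_N; rewrite !mdegE (sumn_nth_le le_N) -big_split.
by apply: eq_bigr => i _; rewrite !mnmE.
Qed.

Lemma pexp_inj la mu : is_part la -> is_part mu -> size la <= N -> size mu <= N ->
  pexp la = pexp mu -> la = mu.
Proof.
move=> pla pmu sla smu eq_e; apply: part_eq => // i.
have [lt_iN|le_Ni] := ltnP i N; last by rewrite !nth_default ?(leq_trans _ le_Ni).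
by have /mnmP/(_ (Ordinal lt_iN)) := eq_e; rewrite !mnmE /= => /addIn.
Qed.

(** A strictly decreasing exponent is entrywise at least the staircase, and subtracting the
    staircase leaves weakly decreasing parts. *)
Lemma strict_pexp g : strict_exp g ->
  exists la, [/\ is_part la, size la <= N & pexp la = g].
Proof.
move/strict_expP=> dec_g.
pose r i := if insub i is Some j then g (j : 'I_N) - rev_ord j else 0.
have rE (i : 'I_N) : r i = g i - rev_ord i by rewrite /r valK.
have r0 i : N <= i -> r i = 0 by move=> le_Ni; rewrite /r insubN -?leqNgt.
have ge_g (i : 'I_N) : rev_ord i <= g i.
  have [n] := ubnP (rev_ord i : nat); elim: n i => // n IHn i; rewrite ltnS => le_n.
  have [lt_iN|le_Ni] := ltnP i.+1 N; last by move: le_Ni => /=; lia.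
  have := dec_g i (Ordinal lt_iN) erefl; have /= := IHn (Ordinal lt_iN).
  by move: le_n lt_iN => /=; lia.
have dec_r i : r i.+1 <= r i.
  have [lt_iN|le_Ni] := ltnP i.+1 N; last by rewrite r0.
  have := rE (Ordinal lt_iN); have := rE (Ordinal (ltnW lt_iN)) => /= -> ->.
  have := dec_g (Ordinal (ltnW lt_iN)) (Ordinal lt_iN) erefl => /=.
  by move: lt_iN; lia.
exists (part_of_fun N r); split.
- exact: part_of_fun_part.
- by rewrite size_filter (leq_trans (count_size _ _)) // size_mkseq.
by apply/mnmP=> i; rewrite mnmE nth_part_of_fun // rE subnK.
Qed.

Lemma strict_delta g : strict_exp g -> mdeg g = mdeg delta -> g = delta.
Proof.
case/strict_pexp=> la [pla sla <-]; rewrite mdeg_pexp // -[RHS]add0n => /addIn la0.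
have -> : la = [::].
  by apply/eqP; rewrite -size_eq0 -leqn0 -[X in _ <= X]la0 leq_size_sumn //; case/andP: pla.
by apply/mnmP=> i; rewrite !mnmE nth_nil.
Qed.

End PartExponents.

Lemma size_sub_part la mu : is_part mu -> (forall i, nth 0 mu i <= nth 0 la i)%N ->
  (size mu <= size la)%N.
Proof.
by move=> pmu sub; rewrite -part_nth_eq0 // -leqn0 (leq_trans (sub _)) // nth_default.
Qed.

Section Diag.
Local Open Scope ring_scope.

Lemma diag_sum la N : (size la <= N)%N ->
  diag la = \sum_(i < N) \sum_(j < nth 0%N la i) (j%:Z - i%:Z).
Proof.
move=> le_N; rewrite /diag /diag_skew /Defs.skew filter_predT big_allpairs_dep /=.
have -> : \sum_(i < N) \sum_(j < nth 0%N la i) (j%:Z - i%:Z) =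
   \sum_(0 <= i < N) \sum_(0 <= j < nth 0%N la i) (j%:Z - i%:Z).
  by rewrite big_mkord; apply: eq_bigr => i _; rewrite big_mkord.
rewrite [RHS](big_cat_nat _ le_N) //= [X in _ = _ + X]big_nat_cond [X in _ = _ + X]big1 ?addr0.
  by rewrite /index_iota subn0; apply: eq_bigr => i _; rewrite subn0.
by move=> i /andP[/andP[le_i _] _]; rewrite nth_default // big_geq.
Qed.

Lemma diag_cat la mu : all (mem (cells la)) (cells mu) ->
  diag la = diag mu + diag_skew la mu.
Proof.
move=> /allP sub; rewrite /diag /diag_skew /Defs.skew !filter_predT big_filter.
rewrite (bigID (mem (cells mu))) /=; congr (_ + _).
rewrite -big_filter; apply: perm_big; apply: uniq_perm.
- by rewrite filter_uniq ?uniq_cells.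
- exact: uniq_cells.
move=> c; rewrite mem_filter /=; apply/andP/idP=> [[]//|c_mu]; split=> //; exact: sub.
Qed.

Lemma eig_strip n k (la : intpart n) (mu : intpart k) : horizontal_strip la mu ->
  eig la mu = ('C(n.+1, 2))%:Z - ('C(k.+1, 2))%:Z + diag_skew la mu.
Proof.
case/andP=> sub _; rewrite /eig !intpart_sum (diag_cat sub); ring.
Qed.

End Diag.

(** * Desarrangement numbers as coefficients of the quotient trace *)

Section Desarrangements.
Variables (N : nat) (F : numFieldType).
Local Notation P := {mpoly F[N]}.
Local Notation vdm := (@vandermonde N F).
Local Notation delta := (@staircase N).
Local Notation qtr := (@quotient_trace N F).
Local Notation pexp := (@part_exp N).
Local Notation p1 := (\sum_a 'X_a : P).

(* [(-1)^n] times the elementary symmetric polynomial of degree [n] in the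
   variables of index smaller than [a]. *)
Definition ycol a n : P := if n is n'.+1 then qtr a n 0 - p1 * qtr a n' 0 else 1.

Lemma qtr00 a : qtr a 0 0 = 1.
Proof. by rewrite qtr_deg0 qtr_full ftr00 expr0. Qed.

Lemma ycol0 n : ycol 0 n = (n == 0)%:R.
Proof.
by case: n => //= n; rewrite !qtr_full !ftr00 exprS subrr.
Qed.

(** All words have the series 1/(1 - p1 t), so multiplying the series of the [qtr a n 0] by 1 - p1 t
    leaves the product of the 1 - x_c t over c < a. *)
Lemma ycolS (c : 'I_N) n : ycol c.+1 n.+1 = ycol c n.+1 - 'X_c * ycol c n.
Proof.
case: n => [|n] /=; last by rewrite !qtr_succ; ring.
by rewrite qtr_succ !qtr00; ring.
Qed.

Lemma mcoeff_ycol a n m : (a <= N)%N -> (ycol a n)@_m =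
  if [forall i : 'I_N, (m i <= (i < a))%N] && (mdeg m == n) then (-1) ^+ n else 0.
Proof.
elim: a n m => [|a IHa] n m le_aN.
  rewrite ycol0 (_ : _ && _ = (m == 0%MM) && (n == 0)%N); last first.
    apply/andP/andP=> [[/forallP m0 /eqP dm]|[/eqP-> /eqP->]].
      have m00 : m = 0%MM.
        by apply/mnmP=> i; have := m0 i; rewrite mnm0E ltn0 leqn0 => /eqP.
      by move: dm; rewrite m00 mdeg0 => <-.
    by rewrite mdeg0; split=> //; apply/forallP=> i; rewrite mnm0E.
  case: n => [|n]; last by rewrite andbF mcoeff0.
  by rewrite andbT mcoeff1; case: eqP.
case: n => [|n].
  rewrite /= mcoeff1 mdeg_eq0; case: eqP => [->|_]; rewrite ?andbF // andbT.
  by case: forallP => // -[] i; rewrite mnm0E.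
have lt_aN : (a < N)%N by []. 
rewrite (ycolS (Ordinal lt_aN)) mcoeffB mcoeff_mulX !IHa 1?ltnW //=.
set c := Ordinal lt_aN.
have memE : [forall i : 'I_N, (m i <= (i < a.+1))%N] =
   [forall i : 'I_N, (i == c) || (m i <= (i < a))%N] && (m c <= 1)%N.
  apply/forallP/andP=> [H|[/forallP H mc] i].
    split; last by have := H c; rewrite ltnSn.
    apply/forallP=> i; have := H i; rewrite ltnS [(i <= a)%N]leq_eqVlt -val_eqE /=.
    by case: eqP.
  rewrite ltnS [(i <= a)%N]leq_eqVlt; have := H i; rewrite -val_eqE /=; case: eqP => //= ia _.
  by have -> : i = c by apply: val_inj.
have memE0 : [forall i : 'I_N, (m i <= (i < a))%N] =
   [forall i : 'I_N, (i == c) || (m i <= (i < a))%N] && (m c == 0)%N.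
  apply/forallP/andP=> [H|[/forallP H mc] i].
    split; last by have := H c; rewrite ltnn leqn0.
    by apply/forallP=> i; rewrite H orbT.
  by have := H i; case: eqP => [->|//]; rewrite (eqP mc).
rewrite memE memE0; case: (boolP (m c == 0)%N) => [/eqP->|mc0].
  by rewrite subr0 !andbT.
rewrite andbF /= sub0r.
have le_c : (U_(c) <= m)%MM by rewrite lep1mP.
have -> : (mdeg (m - U_(c))%MM == n) = (mdeg m == n.+1).
  by rewrite -[in RHS](submK le_c) mdegD mdeg1 addn1 eqSS.
have -> : [forall i : 'I_N, ((m - U_(c))%MM i <= (i < a))%N] =
   [forall i : 'I_N, (i == c) || (m i <= (i < a))%N] && (m c <= 1)%N.
  apply/forallP/andP=> [H|[/forallP H mc] i].
    split; last by have := H c; rewrite mnmBE mnm1E eqxx ltnn; move: mc0; lia.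
    apply/forallP=> i; have := H i; rewrite mnmBE mnm1E eq_sym.
    by case: eqP => //; rewrite subn0.
  rewrite mnmBE mnm1E eq_sym; have := H i; case: eqP => [->|] /=; last by rewrite subn0.
  by rewrite ltnn; move: mc; lia.
by case: ifP; rewrite ?oppr0 // exprS mulN1r.
Qed.

Lemma strict_alt (A : 'X_{1..N} -> F) (g : 'X_{1..N}) : alternating N A ->
  (forall p q : 'I_N, q = p.+1 :> nat -> g q <= g p)%N -> A g != 0 -> strict_exp g.
Proof.
move=> altA dec_g Ag; apply/strict_expP=> p q qp.
rewrite ltn_neqAle dec_g // andbT; apply: contraNneq Ag => eq_g.
by apply/eqP; apply: (alternating_eq0 altA qp (ltn_ord q)).
Qed.

Lemma alternating_vdm : alternating N (fun e => vdm@_e).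
Proof.
have alt1 : alternating N (fun e => (vdmk N F N * 1)@_e).
  by apply: alternating_coef => s; rewrite msym1.
by move=> p q qp qN m; have := alt1 p q qp qN m; rewrite !mulr1 vdmk_full.
Qed.

Lemma mcoeff_vdm_ycol n (mu : intpart n) : (size mu <= N)%N ->
  (vdm * ycol N n)@_(pexp mu) = (parts mu == nseq n 1%N)%:R * (-1) ^+ n.
Proof.
move=> smu; have pmu := intpart_part mu; have sum_mu := intpart_sum mu.
set m0 : 'X_{1..N} := [multinom nth 0%N mu i | i < N].
have em : pexp mu = (delta + m0)%MM.
  by apply/mnmP=> i; rewrite !mnmE addnC.
(* Subtracting a 0/1 vector from a strictly decreasing exponent leaves a weakly decreasing one;
   alternation makes it strict, and its degree then forces the staircase. *)
have term (k1 k2 : 'X_{1..N}) : pexp mu = (k1 + k2)%MM ->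
    vdm@_k1 * (ycol N n)@_k2 != 0 -> k1 = delta /\ k2 = m0.
  move=> ek; rewrite mulf_eq0 negb_or mcoeff_ycol // => /andP[k1_n0].
  case: ifP => [/andP[/forallP k2_le /eqP dk2] _|]; last by rewrite eqxx.
  have st1 : strict_exp k1.
    apply: (strict_alt alternating_vdm) k1_n0 => p q qp.
    have /strict_expP/(_ p q qp) := pexp_strict N pmu.
    by rewrite ek !mnmDE; have := k2_le p; rewrite ltn_ord; lia.
  have d1 : mdeg k1 = mdeg delta.
    have := congr1 (@mdeg N) ek; rewrite mdeg_pexp // mdegD dk2 sum_mu addnC.
    by move/addIn.
  have k1E := strict_delta st1 d1; split=> //.
  by move: ek; rewrite em k1E => /(congr1 (fun z => z - delta)%MM); rewrite ![(delta + _)%MM]addmC !addmK.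
have lt_b (k1 k2 : 'X_{1..N}) : (delta + m0)%MM = (k1 + k2)%MM ->
    (mdeg k1 < (mdeg (pexp mu)).+1)%N && (mdeg k2 < (mdeg (pexp mu)).+1)%N.
  by rewrite em => ->; rewrite mdegD !ltnS leq_addr leq_addl.
have /andP[b1 b2] := lt_b _ _ erefl.
rewrite mcoeffM (bigD1 (BMultinom b1, BMultinom b2)) /=; last by rewrite em.
rewrite [X in _ + X]big1 ?addr0.
  rewrite mcoeff_vdm_delta mul1r mcoeff_ycol //.
  have -> : [forall i : 'I_N, m0 i <= (i < N)]%N && (mdeg m0 == n) = (parts mu == nseq n 1%N).
    have dm0 : mdeg m0 = n.
      rewrite mdegE (eq_bigr (fun i : 'I_N => nth 0%N mu i)) => [|i _]; last by rewrite mnmE.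
      by rewrite -sumn_nth_le // sum_mu.
    rewrite dm0 eqxx andbT; apply/forallP/eqP=> [le1|eq1 i]; last first.
      by rewrite mnmE eq1 nth_nseq ltn_ord; case: ifP.
    have nth1 i : (nth 0 mu i <= 1)%N.
      have [lt_iN|le_Ni] := ltnP i N; last by rewrite nth_default ?(leq_trans smu).
      by have := le1 (Ordinal lt_iN); rewrite mnmE ltn_ord.
    have all1 i : (i < size mu)%N -> nth 0%N mu i = 1%N.
      move=> lt_i; apply/eqP; rewrite eqn_leq nth1 lt0n part_nth_eq0 //.
      by rewrite -ltnNge.
    have e : size mu = n.
      by rewrite -[RHS]sum_mu sumn_nth (eq_bigr (fun=> 1%N)) => [|i _]; rewrite ?sum1_card ?card_ord ?all1.
    apply: (@eq_from_nth _ 0%N); first by rewrite size_nseq.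
    by move=> i lt_i; rewrite all1 // nth_nseq -e lt_i.
  by case: ifP; rewrite ?mul1r ?mul0r.
case=> k1 k2 /= /andP[/eqP ek ne_k]; apply/eqP/negPn/negP=> /(term k1 k2 ek)[].
move=> k1E k2E; case/eqP: ne_k; congr (_, _); exact: val_inj.
Qed.

Lemma qcoef_rec n (mu : intpart n.+1) : (size mu <= N)%N ->
  qcoef F N n.+1 0 (pexp mu) =
  \sum_(la : intpart n | all (mem (cells mu)) (cells la)) qcoef F N n 0 (pexp la)
  + (parts mu == nseq n.+1 1%N)%:R * (-1) ^+ n.+1.
Proof.
move=> smu; have pmu := intpart_part mu.
rewrite qcoefE (_ : qtr N n.+1 0 = p1 * qtr N n 0 + ycol N n.+1); last by rewrite /= addrC subrK.
rewrite mulrDr mcoeffD mcoeff_vdm_ycol //; congr (_ + _).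
rewrite mulrCA mulr_suml raddf_sum /=.
under eq_bigr do rewrite mcoeff_mulX.
(* The rows whose last cell is a corner; in the other rows, lowering the exponent creates equal
   neighbours and alternation kills the term. *)
pose ok (i : 'I_N) := (pexp mu i != 0)%N && strict_exp (pexp mu - U_(i))%MM.
have altq : alternating N (fun e => (vdm * qtr N n 0)@_e).
  by rewrite -vdmk_full; apply: alternating_coef => s; apply: msym_qtr.
rewrite (bigID ok) /= [X in _ + X]big1 ?addr0 => [|i]; last first.
  rewrite /ok; case: (eqVneq (pexp mu i) 0%N) => //= mi nst.
  apply/eqP/negPn/negP=> nz; case/negP: nst.
  apply: (strict_alt altq _ nz) => p q qp; rewrite !mnmBE !mnm1E.
  have /strict_expP/(_ p q qp) := pexp_strict N pmu; lia.
apply: (@sum_rel _ _ _ _ _ (fun i (la : intpart n) => (pexp mu - U_(i))%MM == pexp la)).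
- move=> i /andP[mi /strict_pexp[la [pla sla ela]]].
  have sum_la : sumn la = n.
    have := congr1 (@mdeg N) (submK (_ : U_(i) <= pexp mu)%MM); rewrite lep1mP => /(_ mi).
    rewrite mdegD mdeg1 -ela !mdeg_pexp // intpart_sum; lia.
  have pla' : is_part_of n la by rewrite is_part_ofE pla sum_la /=.
  exists (IntPart pla') => /= [|la' sub /eqP].
    rewrite ela eqxx andbT; apply/cells_subP=> j /=.
    have [lt_jN|le_Nj] := ltnP j N; last by rewrite nth_default // (leq_trans sla).
    by have /mnmP/(_ (Ordinal lt_jN)) := ela; rewrite !mnmE /=; lia.
  rewrite -ela => /pexp_inj eq_la; apply/val_inj/esym/eq_la => //.
    exact: intpart_part.
  apply: leq_trans smu; apply: size_sub_part; first exact: intpart_part.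
  exact/cells_subP.
- move=> la /cells_subP sub; have pla := intpart_part la.
  have sla : (size la <= N)%N by apply: leq_trans smu; apply: size_sub_part.
  have sum1 : (\sum_(i < N) (nth 0 mu i - nth 0 la i) == 1)%N.
    rewrite sumnB => [|i _]; last exact: sub.
    by rewrite -!sumn_nth_le // !intpart_sum subSnn.
  case/sum_nat_eq1: sum1 => i [_ mui muj].
  have ela : pexp la = (pexp mu - U_(i))%MM.
    apply/mnmP=> j; rewrite mnmBE mnm1E !mnmE; have := sub j.
    have [<-|ne_ij] := eqVneq i j; first by move: mui; lia.
    by have := muj j; rewrite eq_sym => /(_ ne_ij isT); lia.
  have mui0 : pexp mu i != 0%N by rewrite mnmE; move: mui; lia.
  exists i; first by rewrite /ok mui0 -ela eqxx pexp_strict.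
  move=> i' /andP[mui' _]; rewrite ela => /eqP/mnmP/(_ i').
  rewrite !mnmBE !mnm1E eqxx; have [->//|_] := eqVneq i i'; move: mui'; lia.
move=> i la /andP[mi _] _ /eqP <-.
by rewrite (negPf mi) qcoefE.
Qed.

Lemma qcoef_desarr n (mu : intpart n) : (size mu <= N)%N ->
  qcoef F N n 0 (pexp mu) = (desarr_num mu)%:R.
Proof.
elim: n mu => [|n IHn] mu smu.
  rewrite desarr_num0 qcoefE qtr00 mulr1.
  have -> : pexp mu = delta; last exact: mcoeff_vdm_delta.
  by apply: strict_delta; [apply/pexp_strict/intpart_part|rewrite mdeg_pexp // intpart_sum].
rewrite qcoef_rec //.
have IH (la : intpart n) : all (mem (cells mu)) (cells la) ->
    qcoef F N n 0 (pexp la) = (desarr_num la)%:R.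
  move=> /cells_subP sub; apply: IHn; apply: leq_trans smu.
  by apply: size_sub_part => //; apply: intpart_part.
rewrite (eq_bigr _ IH) -natr_sum; have [mu1|mu1] := eqVneq (parts mu) (nseq n.+1 1%N).
  rewrite (big_pred1 (IntPart (column_part n))) => [|la]; last exact: sub_column.
  (* The correction reads 1 - 1 = 0 for even [n] and 0 + 1 = 1 for odd [n]. *)
  rewrite mu1 !desarr_num_column mul1r -signr_odd /=.
  by case: (odd n); rewrite ?expr0 ?expr1 ?mulr1n ?mulr0n ?add0r ?subrr.
by rewrite mul0r addr0 desarr_num_rec.
Qed.

End Desarrangements.

(** * Coefficients of the trace on all words *)

Section FullTrace.
Variables (N : nat) (F : numFieldType).
Local Notation delta := (@staircase N).
Local Notation qtr := (@quotient_trace N F).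
Local Notation pexp := (@part_exp N).

Lemma gauss_sum a : (\sum_(j < a) j%:R : F) = 2%:R^-1 * (a%:R ^+ 2 - a%:R).
Proof.
have n2 : 2%:R != 0 :> F by rewrite pnatr_eq0.
elim: a => [|a IHa]; first by rewrite big_ord0 expr0n /= subr0 mulr0.
rewrite big_ord_recr /= IHa; apply: (mulfI n2).
by rewrite mulrDr !mulVKf // -addn1 natrD; ring.
Qed.

Lemma ceig_pexp n (mu : intpart n) : (size mu <= N)%N ->
  ceig F n (pexp mu) = ('C(n.+1, 2))%:R + (diag mu)%:~R.
Proof.
move=> smu; rewrite /ceig addrC; congr (_ + _).
rewrite (diag_sum smu) [RHS]rmorph_sum /=.
under [RHS]eq_bigr => i _ do rewrite rmorph_sum /=.
have row i : \sum_(j < nth 0%N mu i) (j%:Z - i%:Z)%:~R =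
   2%:R^-1 * ((nth 0%N mu i)%:R ^+ 2 - (nth 0%N mu i)%:R) - i%:R * (nth 0%N mu i)%:R :> F.
  under eq_bigr do rewrite rmorphB /=.
  by rewrite sumrB gauss_sum sumr_const card_ord mulr_natr.
under [RHS]eq_bigr do rewrite row.
have n2 : 2%:R != 0 :> F by rewrite pnatr_eq0.
apply: (mulfI n2); rewrite mulVKf // mulr_sumr.
have en : n%:R = \sum_(i < N) (nth 0%N mu i)%:R :> F.
  by rewrite -natr_sum -sumn_nth_le // intpart_sum.
(* After this reversal the identity holds row by row, [N - i.+1] being the staircase entry of row
   [i]. *)
have eS : (\sum_(i < N) i ^ 2 = \sum_(i < N) (N - i.+1) ^ 2)%N by rewrite (reindex_inj rev_ord_inj).
rewrite /sumsq eS.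
rewrite !natrM en !natr_sum !mulr_sumr -!sumrB; apply: eq_bigr => i _.
rewrite mnmE /=.
have eN : N%:R = (N - i.+1)%N%:R + i%:R + 1 :> F.
  rewrite -natrD natr1; apply: (congr1 (fun k => k%:R)); have := ltn_ord i; lia.
have eN1 : N.-1%:R = (N - i.+1)%N%:R + i%:R :> F.
  rewrite -natrD; apply: (congr1 (fun k => k%:R)); have := ltn_ord i; lia.
rewrite eN eN1 !natrX natrD mulrBr mulVKf //; ring.
Qed.

Lemma qcoef_succ (c : 'I_N) n j e : qcoef F c.+1 n.+1 j e =
  qcoef F c n.+1 j e - (if e c == 0%N then 0 else qcoef F c n j (e - U_(c))%MM).
Proof.
by rewrite qcoefE qtr_succ mulrBr mulrCA mcoeffB mcoeff_mulX !qcoefE.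
Qed.

Lemma qcoef_deg0 c j (e : 'X_{1..N}) : qcoef F c.+1 0 j e = qcoef F c 0 j e.
Proof. by rewrite !qcoefE qtr_deg0 [in RHS]qtr_deg0. Qed.

Lemma alternating_qcoef n j : alternating N (@qcoef N F N n j).
Proof.
have altq : alternating N (fun e => (vdmk N F N * qtr N n j)@_e).
  by apply: alternating_coef => s; apply: msym_qtr.
move=> p q qp qN m; rewrite !qcoefE; have := altq p q qp qN m.
by rewrite vdmk_full.
Qed.

Lemma qcoef_full n j (e : 'X_{1..N}) : qcoef F 0 n j e = fcoef F n 0 j e.
Proof. by rewrite qcoefE qtr_full -fcoefE. Qed.

Local Opaque qcoef fcoef.

(* The degree of the trace is read off the exponent, so that [box_sum] applies. *)
Definition boxZ j a (e : 'X_{1..N}) : F :=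
  if (mdeg delta <= mdeg e)%N then qcoef F a (mdeg e - mdeg delta) j e else 0.

Lemma boxZS j (a : 'I_N) e : boxZ j a.+1 e =
  boxZ j a e - (if e a != 0%N then boxZ j a (e - U_(a))%MM else 0).
Proof.
rewrite /boxZ; have [ea|ea] /= := eqVneq (e a) 0%N.
  rewrite subr0; have [_|//] := leqP (mdeg delta) (mdeg e).
  case: (mdeg e - mdeg delta)%N => [|d]; first exact: qcoef_deg0.
  by rewrite qcoef_succ ea subr0.
have de : mdeg e = (mdeg (e - U_(a))%MM).+1.
  by rewrite -{1}(submK (_ : U_(a) <= e)%MM) ?lep1mP // mdegD mdeg1 addn1.
(* If [e] has exactly the degree of the staircase, the subtracted term falls below the range and is
   0, in agreement with [qcoef_deg0]. *)
rewrite de; have [le_d'|gt_d'] := leqP (mdeg delta) (mdeg (e - U_(a))%MM); last first.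
  rewrite subr0; have [le_d|//] := leqP (mdeg delta) (mdeg (e - U_(a))%MM).+1.
  have -> : ((mdeg (e - U_(a))%MM).+1 - mdeg delta = 0)%N by move: le_d gt_d'; lia.
  exact: qcoef_deg0.
rewrite leqW //.
by rewrite subSn // qcoef_succ (negPf ea).
Qed.

Lemma alternating_boxZ j : alternating N (boxZ j N).
Proof.
move=> p q qp qN m; rewrite /boxZ mdeg_mperm; have [_|_] := leqP (mdeg delta) (mdeg m).
  exact: alternating_qcoef.
by rewrite oppr0.
Qed.

Lemma fcoef_base n j (la : intpart n) : (size la <= N)%N ->
  fcoef F n 0 j (pexp la) =
  \sum_(p : {k : 'I_n.+1 & intpart k} | horizontal_strip la (tagged p))
    (desarr_num (tagged p))%:R *
      (('C((tag p).+1, 2))%:R + (diag (tagged p))%:~R) ^+ j.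
Proof.
move=> sla; have pla := intpart_part la.
have st_la := pexp_strict N pla.
have -> : fcoef F n 0 j (pexp la) = boxZ j 0 (pexp la).
  by rewrite /boxZ mdeg_pexp // leq_addl addnK intpart_sum qcoef_full.
rewrite (box_sum (boxZS j) (ltnSn _)) pieri_down //; first last.
- by move=> p q qp; apply/ltnW/(strict_expP _ st_la).
- exact: alternating_boxZ.
pose I := {k : 'I_n.+1 & intpart k}.
pose B (g : 'X_{1..N}) := (g <= pexp la)%MM && [forall p : 'I_N, forall q : 'I_N,
  (q == p.+1 :> nat) ==> (pexp la q < g p)%N].
have BP (g : 'X_{1..N}) : reflect ((forall i, g i <= pexp la i)%N /\
    forall p q : 'I_N, q = p.+1 :> nat -> (pexp la q < g p)%N) (B g).
  apply: (iffP andP) => [[/mnm_lepP le_g /forallP H]|[le_g H]].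
    split=> // p q /eqP qp; have /forallP/(_ q)/implyP := H p; exact.
  split; first exact/mnm_lepP.
  by apply/forallP=> p; apply/forallP=> q; apply/implyP=> /eqP; apply: H.
(* Neighbouring staircase entries differ by 1, so removing the staircase turns the strict inequality
   of [B] into weak interlacing. *)
have BE k (mu : intpart k) : (size mu <= N)%N -> B (pexp mu) = horizontal_strip la mu.
  move=> smu; have pmu := intpart_part mu.
  apply/BP/(hstripP pla pmu) => [[le_mu lt_la] i|H].
    split.
      have [lt_iN|le_Ni] := ltnP i N; last by rewrite nth_default // (leq_trans smu).
      by have := le_mu (Ordinal lt_iN); rewrite !mnmE leq_add2r.
    have [lt_iN|le_Ni] := ltnP i.+1 N; last by rewrite nth_default // (leq_trans sla).
    have := lt_la (Ordinal (ltnW lt_iN)) (Ordinal lt_iN) erefl.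
    by rewrite !mnmE /=; lia.
  split=> [i|p q qp]; rewrite !mnmE; first by have [+ _] := H i; rewrite leq_add2r.
  by have [_] := H p; rewrite -qp /=; have := ltn_ord q; lia.
have st_B (g : 'X_{1..N}) : B g -> strict_exp g.
  case/BP=> le_g lt_la; apply/strict_expP=> p q qp.
  exact: leq_ltn_trans (le_g q) (lt_la p q qp).
apply: (@sum_rel _ _ _ (fun g : 'X_{1..N < (mdeg (pexp la)).+1} => B g) _
   (fun g (p : I) => (g : 'X_{1..N}) == pexp (tagged p))).
- move=> g Bg; have [mu [pmu smu emu]] := strict_pexp (st_B _ Bg).
  have le_n : (sumn mu < n.+1)%N.
    rewrite ltnS -(leq_add2r (mdeg delta)) -[X in (_ <= X + _)%N](intpart_sum la).
    rewrite -!mdeg_pexp // emu mdegE [leqRHS]mdegE; apply: leq_sum => i _.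
    by have [+ _] := elimT (BP g) Bg; apply.
  have pmu' : is_part_of (Ordinal le_n) mu by rewrite is_part_ofE pmu /=.
  exists (Tagged (fun k : 'I_n.+1 => intpart k) (IntPart pmu' : intpart (Ordinal le_n))) => /=.
    by rewrite -emu eqxx -(BE _ (IntPart pmu')) //= emu Bg.
  case=> k mu' /= hs; rewrite -emu => /eqP/pexp_inj eq_mu.
  have pmu2 := intpart_part mu'.
  have smu2 : (size mu' <= N)%N.
    apply: leq_trans sla; apply: size_sub_part => //; apply/cells_subP.
    by case/andP: hs.
  have {}eq_mu := eq_mu pmu pmu2 smu smu2.
  have ek : k = Ordinal le_n by apply: val_inj; rewrite /= eq_mu intpart_sum.
  by subst k; congr existT; apply: val_inj.
- case=> k mu /= hs; have pmu := intpart_part mu.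
  have smu : (size mu <= N)%N.
    apply: leq_trans sla; apply: size_sub_part => //; apply/cells_subP.
    by case/andP: hs.
  have lt_M : (mdeg (pexp mu) < (mdeg (pexp la)).+1)%N.
    rewrite ltnS !mdegE; apply: leq_sum => i _.
    by have /BP[+ _] : B (pexp mu); [rewrite BE | apply].
  exists (BMultinom lt_M); first by rewrite BE // hs eqxx.
  by move=> g' _ /eqP eg; apply: val_inj.
move=> g [k mu] /= Bg hs /eqP eg.
have smu : (size mu <= N)%N.
  apply: leq_trans sla; apply: size_sub_part; first exact: intpart_part.
  by apply/cells_subP; case/andP: hs.
rewrite eg /boxZ mdeg_pexp // leq_addl addnK intpart_sum qcoef_eig.
by rewrite qcoef_desarr // ceig_pexp // mulrC.
Qed.

Lemma fcoef_trace n m (la : intpart n) : (size la <= N)%N ->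
  fcoef F n m 0 (pexp la) =
  \sum_(k < n.+1) \sum_(mu : intpart k | horizontal_strip la mu)
    (desarr_num mu)%:R * (eig la mu)%:~R ^+ m.
Proof.
move=> sla; rewrite (fcoef_eig m 0 (fun j => fcoef_base j sla)) ceig_pexp //.
rewrite (sig_big_dep xpredT (fun (k : 'I_n.+1) (mu : intpart k) => horizontal_strip la mu)
  (fun k mu => (desarr_num mu)%:R * (eig la mu)%:~R ^+ m)) /=.
apply: eq_bigr => -[k mu] /= hs; rewrite mulr1; congr (_ * _ ^+ _).
by rewrite /eig !intpart_sum rmorphB !rmorphD.
Qed.

End FullTrace.

(** * Coefficients of symmetric polynomials and Kostka numbers *)

Section KostkaNumbers.
Local Open Scope nat_scope.

Lemma kost0 (la : intpart 0) c : kost la 0 c = 1.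
Proof.
have nocell (p : cell la) : False.
  have : 0 < #|{: cell la}| by apply/card_gt0P; exists p.
  by rewrite card_cells intpart_sum.
pose T0 : filling la 0 := [ffun p => match nocell p with end].
rewrite /kost (_ : [set _ | _] = [set T0]) ?cards1 //; apply/setP=> T; rewrite !inE.
have -> : T = T0 by apply/ffunP=> p; case: (nocell p).
rewrite eqxx; apply/andP; split; last by apply/forallP=> -[].
by apply/semistandardP; split=> p; case: (nocell p).
Qed.

Lemma kost_recS n (la : intpart n) m (c : nat -> nat) : n = \sum_(i < m.+1) c i ->
  kost la m.+1 c =
  \sum_(mu : intpart (\sum_(i < m) c i) | horizontal_strip la mu) kost mu m c.
Proof. by move=> n_sum; apply: (@kost_rec n la _ (c m)) => //; rewrite n_sum big_ord_recr. Qed.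

(** The shape of the smaller entries satisfies the inequalities by induction and lies inside [la];
    for [j = m.+1] both sides are the total. *)
Lemma kost_neq0 n (la : intpart n) m (c : nat -> nat) : n = \sum_(i < m) c i -> kost la m c != 0 ->
  size la <= m /\
  forall j, j <= m -> \sum_(i < j) c i <= \sum_(i < j) nth 0 la i.
Proof.
elim: m n la => [|m IHm] n la n_sum.
  have la0 : sumn la = 0 by rewrite intpart_sum n_sum big_ord0.
  have sz0 : size la <= 0 by rewrite -[X in _ <= X]la0 leq_size_sumn //; case/andP: (intpart_part la).
  by move=> _; split=> // j; rewrite leqn0 => /eqP->; rewrite !big_ord0.
rewrite kost_recS // sum_nat_eq0 negb_forall => /existsP[mu].
rewrite negb_imply => /andP[/(hstripP (intpart_part la) (intpart_part mu)) hs kmu].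
have [szmu dommu] := IHm _ mu erefl kmu.
have sz : size la <= m.+1.
  rewrite -part_nth_eq0 ?intpart_part // -leqn0; have [_ le] := hs m.
  by apply: leq_trans le _; rewrite leqn0 part_nth_eq0 ?intpart_part.
split=> // j; rewrite leq_eqVlt => /predU1P[->|lt_j].
  by rewrite -n_sum -sumn_nth_le // intpart_sum.
apply: leq_trans (dommu j lt_j) _; apply: leq_sum => i _; by have [] := hs i.
Qed.

Lemma kost_pad n (la : intpart n) m (c : nat -> nat) : n = \sum_(i < m) c i -> c m = 0 ->
  kost la m.+1 c = kost la m c.
Proof.
move=> n_sum cm0; rewrite (@kost_rec n la n 0) ?addn0 //.
rewrite (big_pred1 la) // => mu; apply/(hstripP (intpart_part la) (intpart_part mu))/eqP.
  move=> hs; apply/val_inj/part_eq; try exact: intpart_part.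
  have sz : size mu <= size la by apply: size_sub_part (intpart_part mu) _ => i; case: (hs i).
  move=> i /=; apply/eqP; rewrite eqn_leq; have [-> _] := hs i; rewrite /=.
  have [lt_i|le_i] := ltnP i (size la); last by rewrite (nth_default _ le_i).
  have /eqP : \sum_(j < size la) (nth 0 la j - nth 0 mu j) = 0.
    rewrite sumnB => [|j _]; last by have [] := hs j.
    by rewrite -!sumn_nth_le // !intpart_sum subnn.
  by rewrite sum_nat_eq0 => /forallP/(_ (Ordinal lt_i)).
by move=> -> i; split=> //; apply: part_nth_anti (intpart_part la) _.
Qed.

Lemma kost_kostka n (la nu : intpart n) N : size nu <= N -> kost la N (nth 0 nu) = kostka la nu.
Proof.
rewrite kostkaE => /subnKC <-; elim: (N - size nu) => [|d IHd]; first by rewrite addn0.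
rewrite addnS kost_pad ?IHd // ?nth_default ?leq_addr //.
by rewrite -sumn_nth_le ?leq_addr // intpart_sum.
Qed.

Lemma kostka_neq0 n (la nu : intpart n) : kostka la nu != 0 ->
  size la <= size nu /\ dominates la nu.
Proof.
rewrite kostkaE => /kost_neq0; rewrite -sumn_nth intpart_sum => /(_ erefl)[sz dom].
split=> //; apply/dominatesP=> j.
have takeE (s : seq nat) : sumn (take j s) = \sum_(i < j) nth 0 s i.
  rewrite (@sumn_nth_le j) ?size_take; last by case: ltnP.
  by apply: eq_bigr => i _; rewrite nth_take.
rewrite !takeE; have [/dom//|/ltnW lt_j] := leqP j (size nu).
by rewrite -!sumn_nth_le ?(leq_trans sz) // !intpart_sum.
Qed.

End KostkaNumbers.

Lemma vdmk0 N (F : numFieldType) : vdmk N F 0 = 1.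
Proof. by apply: big1 => p /andP[]. Qed.

Section WeightPeel.
Variables (N : nat) (F : numFieldType) (X : {mpoly F[N]}) (c : nat -> nat).
Hypothesis symX : forall s, msym s X = X.

Definition vcoef k e : F := locked (vdmk N F k * X)@_e.

Lemma vcoefE k e : vcoef k e = (vdmk N F k * X)@_e.
Proof. by rewrite /vcoef -lock. Qed.

Lemma vcoef_alternating k : alternating k (vcoef k).
Proof.
move=> p q qp qk m; rewrite !vcoefE; exact: (alternating_coef symX qp qk m).
Qed.

(* The first [k] exponents encode the shape of the entries smaller than [k] of a
   tableau of content [c], the others the remaining content. *)
Definition peelexp k la : 'X_{1..N} :=
  [multinom if (i < k)%N then (nth 0 la i + (k - i.+1))%N else c i | i < N].

(** The added units are the monomial in [wpeel 0]; they turn the staircase entries for [k] rows into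
    those for [k.+1] rows. *)
Definition peelbox (k : 'I_N) la : 'X_{1..N} := (peelexp k la + \sum_(j : 'I_N | (j < k)%N) U_(j))%MM.

Lemma peelboxE (k : 'I_N) la (i : 'I_N) : peelbox k la i =
  if (i < k)%N then (nth 0 la i + (k - i))%N else c i.
Proof.
rewrite mnmDE mnm_sumE mnmE; under eq_bigr do rewrite mnm1E.
have [lt_ik|le_ki] := ltnP i k.
  by rewrite (bigD1 i) //= eqxx big1 => [|j /andP[_ /negPf->] //]; lia.
by rewrite big1 ?addn0 // => j lt_jk; case: eqP => // eq_ji; move: lt_jk; rewrite eq_ji; lia.
Qed.

Lemma mdeg_peelbox (k : 'I_N) la kappa : (size la <= k.+1)%N -> (size kappa <= k)%N ->
  (mdeg (peelexp k.+1 la) + (sumn kappa + c k) = mdeg (peelbox k kappa) + sumn la)%N.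
Proof.
move=> sla ska; have kN := ltn_ord k.
rewrite (@sumn_nth_le N la) ?(leq_trans sla) // (@sumn_nth_le N kappa) ?(leq_trans ska) 1?ltnW //.
have -> : (c k = \sum_(i < N) if i == k then c i else 0)%N by rewrite -big_mkcond big_pred1_eq.
rewrite !mdegE -!big_split; apply: eq_bigr => i _.
rewrite peelboxE mnmE ltnS -val_eqE /=.
case: (ltngtP i k) => [lt_ik|lt_ki|->]; first lia.
  by rewrite !nth_default ?(leq_trans ska) 1?(leq_trans sla) // ltnW.
by rewrite [nth 0%N kappa k]nth_default //; lia.
Qed.

(** Inverting the factors x_j - x_k distributes the exponent [c k] over the rows above, the
    remainder becoming row [k]. By [pieri_up] the added cells form a horizontal strip. *)
Lemma peel_step (k : 'I_N) n n' (kappa : intpart n) : n' = (n + c k)%N -> (size kappa <= k)%N ->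
  vcoef k (peelexp k kappa) =
  \sum_(la : intpart n' | (size la <= k.+1)%N && horizontal_strip la kappa)
    vcoef k.+1 (peelexp k.+1 la).
Proof.
move=> n'E ska; have pka := intpart_part kappa; have kN := ltn_ord k.
pose l := peelbox k kappa.
transitivity ((wpeel k 0 X)@_l); first by rewrite wpeel0 vcoefE.
rewrite (upbox_sum (k := k) (Z := fun t e => (wpeel k t X)@_e) _ (ltnSn (mdeg l))); last first.
  by move=> t lt_tk e; apply: wpeel_step.
under eq_bigr do rewrite wpeelk -vcoefE.
rewrite pieri_up; first last.
- move=> p q qp lt_qk; rewrite !peelboxE lt_qk qp.
  have lt_pk : (p < k)%N by rewrite (leq_trans _ lt_qk) // qp leqnSn.
  have := part_nth_anti pka (leqnSn p); rewrite lt_pk -qp; lia.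
- exact: vcoef_alternating.
pose B (g : 'X_{1..N}) := upbox k k l g && [forall p : 'I_N, forall q : 'I_N,
   (p < k)%N && (q == p.+1 :> nat) ==> (g q < l p)%N].
have BP (g : 'X_{1..N}) : reflect [/\ mdeg g = mdeg l,
   forall i : 'I_N, (i < k)%N -> (nth 0 kappa i + (k - i) <= g i)%N,
   forall i : 'I_N, (k < i)%N -> g i = c i
   & forall p q : 'I_N, (p < k)%N -> q = p.+1 :> nat -> (g q < nth 0 kappa p + (k - p))%N] (B g).
  apply: (iffP andP) => [[/andP[/eqP dg /forallP H1] /forallP H2]|[dg H1 H2 H3]].
    split=> // [i lt_ik|i lt_ki|p q lt_pk /eqP qp].
    - by have := H1 i; rewrite lt_ik peelboxE lt_ik.
    - have := H1 i; rewrite ltnNge ltnW //= -val_eqE /= gtn_eqF //=.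
      by rewrite peelboxE ltnNge ltnW //= => /eqP.
    have /forallP/(_ q)/implyP := H2 p; rewrite lt_pk qp peelboxE lt_pk.
    by apply.
  split.
    rewrite /upbox dg eqxx; apply/forallP=> i; rewrite peelboxE.
    have [lt_ik|] := ltnP i k; first exact: H1.
    rewrite leq_eqVlt => /predU1P[e|lt_ki]; first by rewrite -val_eqE /= -e eqxx.
    by rewrite H2 // eqxx orbT.
  apply/forallP=> p; apply/forallP=> q; apply/implyP=> /andP[lt_pk /eqP qp].
  by rewrite peelboxE lt_pk H3.
have BE (la : intpart n') : (size la <= k.+1)%N ->
    B (peelexp k.+1 la) = horizontal_strip la kappa.
  move=> sla; have pla := intpart_part la.
  apply/BP/(hstripP pla pka) => [[_ H1 _ H3] i|H].
    split.
      have [lt_ik|le_ki] := ltnP i k; last by rewrite nth_default // (leq_trans ska).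
      have := H1 (Ordinal (ltn_trans lt_ik kN)) lt_ik; rewrite mnmE /= ltnS (ltnW lt_ik).
      by move: lt_ik; lia.
    have [lt_ik|le_ki] := ltnP i k; last by rewrite nth_default // (leq_trans sla).
    have lt_i1 : (i.+1 < N)%N by apply: leq_ltn_trans kN.
    have := H3 (Ordinal (ltn_trans lt_ik kN)) (Ordinal lt_i1) lt_ik erefl.
    by rewrite mnmE /= ltnS lt_ik; move: lt_ik; lia.
  split=> [|i lt_ik|i lt_ki|p q lt_pk qp].
  - have := mdeg_peelbox sla ska; rewrite !intpart_sum -n'E => /eqP.
    by rewrite eqn_add2r => /eqP.
  - by rewrite mnmE ltnS (ltnW lt_ik); have [+ _] := H i; move: lt_ik; lia.
  - by rewrite mnmE ltnS leqNgt lt_ki.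
  by rewrite mnmE qp ltnS lt_pk; have [_] := H p; move: lt_pk; lia.
apply: (@sum_rel _ _ _ (fun g : 'X_{1..N < (mdeg l).+1} => B g) _
   (fun g (la : intpart n') => (g : 'X_{1..N}) == peelexp k.+1 la)).
- move=> g Bg; have [dg H1 H2 H3] := elimT (BP g) Bg.
  pose r (i : nat) := if (insub i : option 'I_N) is Some j then
    if (j <= k)%N then ((g : 'X_{1..N}) (j : 'I_N) - (k - j))%N else 0%N else 0%N.
  have rE (i : 'I_N) : (i <= k)%N -> r i = ((g : 'X_{1..N}) i - (k - i))%N by rewrite /r valK => ->.
  have r0 i : (k < i)%N -> r i = 0%N.
    by move=> lt_ki; rewrite /r; case: insubP => // j _ ->; rewrite leqNgt lt_ki.
  have dec_r i : (r i.+1 <= r i)%N.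
    have [lt_ik|le_ki] := ltnP i k; last by rewrite r0.
    have iN : (i < N)%N by apply: ltn_trans kN.
    have i1N : (i.+1 < N)%N by apply: leq_ltn_trans kN.
    have /= -> := rE (Ordinal iN) (ltnW lt_ik); have /= -> := rE (Ordinal i1N) lt_ik.
    have := H1 (Ordinal iN) lt_ik; have := H3 (Ordinal iN) (Ordinal i1N) lt_ik erefl.
    by move=> /=; lia.
  have r_out i : (N <= i)%N -> r i = 0%N by move=> le_Ni; apply: r0; apply: leq_trans le_Ni.
  set la := part_of_fun N r.
  have pla : is_part la by apply: part_of_fun_part.
  have laE i : nth 0%N la i = r i by apply: nth_part_of_fun.
  have sla : (size la <= k.+1)%N by rewrite -part_nth_eq0 // laE r0.
  have ela : peelexp k.+1 la = g.
    apply/mnmP=> i; rewrite mnmE ltnS; case: leqP => [le_ik|lt_ki]; last by rewrite H2.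
    rewrite laE rE // subSS subnK //; move: le_ik; rewrite leq_eqVlt.
    by case/predU1P=> [->|/H1]; [rewrite subnn|lia].
  have sum_la : sumn la = n'.
    have := mdeg_peelbox sla ska; rewrite ela dg intpart_sum -n'E.
    by move/addnI.
  have pla' : is_part_of n' la by rewrite is_part_ofE pla sum_la /=.
  exists (IntPart pla') => [|la' /andP[sla' hs]].
    by rewrite /= sla -(BE (IntPart pla')) //= ela Bg eqxx.
  rewrite -ela => /eqP/mnmP eq_la; apply/val_inj/part_eq => //; first exact: intpart_part.
  move=> i; have [lt_i|le_i] := leqP i k; last by rewrite !nth_default // ?(leq_trans sla) ?(leq_trans sla').
  have := eq_la (Ordinal (leq_ltn_trans lt_i kN)); rewrite !mnmE /= ltnS lt_i.
  by move/addIn.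
- move=> la /andP[sla hs]; have Bla : B (peelexp k.+1 la) by rewrite BE.
  have lt_M : (mdeg (peelexp k.+1 la) < (mdeg l).+1)%N by have [-> _ _ _] := elimT (BP _) Bla.
  exists (BMultinom lt_M); first by rewrite Bla eqxx.
  by move=> g' _ /eqP eg; apply: val_inj.
by move=> g la _ _ /eqP ->.
Qed.

Lemma peel_sum k : (k <= N)%N -> X@_[multinom c i | i < N] =
  \sum_(la : intpart (\sum_(i < k) c i)%N | (size la <= k)%N)
    (kost la k c)%:R * vcoef k (peelexp k la).
Proof.
elim: k => [_|k IHk lt_kN].
  have part0 : is_part_of (\sum_(i < 0) c i)%N [::] by rewrite big_ord0.
  rewrite (big_pred1 (IntPart part0)) => [|la]; last first.
    apply/idP/eqP=> [|-> //]; rewrite leqn0 size_eq0 => /eqP e; exact: val_inj.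
  have -> : kost (IntPart part0) 0 c = 1%N.
    by rewrite -(kost0 (IntPart (isT : is_part_of 0 [::])) c).
  rewrite mul1r vcoefE vdmk0 mul1r.
  by congr (_@__); apply/mnmP=> i; rewrite !mnmE.
rewrite (IHk (ltnW lt_kN)).
pose kk := Ordinal lt_kN.
have sumS : (\sum_(i < k.+1) c i = \sum_(i < k) c i + c kk)%N by rewrite big_ord_recr.
transitivity (\sum_(kappa : intpart (\sum_(i < k) c i)%N | (size kappa <= k)%N)
  \sum_(la : intpart (\sum_(i < k.+1) c i)%N | (size la <= k.+1)%N && horizontal_strip la kappa)
    (kost kappa k c)%:R * vcoef k.+1 (peelexp k.+1 la)).
  apply: eq_bigr => kappa ska.
  by rewrite (@peel_step kk _ _ kappa sumS ska) mulr_sumr.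
rewrite (exchange_big_dep (fun la : intpart _ => (size la <= k.+1)%N)) /=; last by move=> kappa la _ /andP[].
apply: eq_bigr => la sla; rewrite -mulr_suml; congr (_ * _).
rewrite kost_recS // natr_sum; apply/esym; rewrite (bigID (fun mu : intpart _ => (size mu <= k)%N)) /=.
(* A shape with more than [k] rows has no semistandard filling with [k] letters. *)
rewrite [X in _ + X]big1 ?addr0 => [|mu /andP[_ smu]].
  by apply: eq_bigl => mu; rewrite sla andbC.
have [->//|kmu] := eqVneq (kost mu k c) 0%N.
by have [szmu _] := kost_neq0 erefl kmu; rewrite szmu in smu.
Qed.

End WeightPeel.

Lemma weight_coef N (F : numFieldType) (X : {mpoly F[N]}) n (nu : intpart n) :
  (forall s, msym s X = X) -> (size nu <= N)%N ->
  X@_[multinom nth 0%N nu i | i < N] =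
  \sum_(la : intpart n | (size la <= N)%N)
    (kostka la nu)%:R * (vandermonde N F * X)@_(part_exp N la).
Proof.
move=> symX snu; rewrite (peel_sum (nth 0%N nu) symX (leqnn N)).
have sum_nu : (\sum_(i < N) nth 0 nu i)%N = n by rewrite -sumn_nth_le // intpart_sum.
have eq_exp la : peelexp N (nth 0%N nu) N la = part_exp N la.
  by apply/mnmP=> i; rewrite !mnmE ltn_ord.
case: _ / (esym sum_nu).
apply: eq_bigr => la sla; rewrite vcoefE vdmk_full eq_exp.
by rewrite (kost_kostka la snu).
Qed.

(** * Eigenvalues of the shuffle *)

Section TriangularPowers.
Variables (K : comNzRingType) (n : nat) (T : 'M[K]_n).
Hypothesis trigT : is_trig_mx T.

Lemma trig_mpow m : is_trig_mx (mpow T m) /\ forall i, mpow T m i i = T i i ^+ m.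
Proof.
elim: m => [|m [/is_trig_mxP tr dg]].
  by split=> [|i]; rewrite mpow0 ?scalar_mx_is_trig // mxE eqxx.
have /is_trig_mxP trT := trigT; split=> [|i].
  apply/is_trig_mxP=> i j lt_ij; rewrite mpowS mxE big1 // => k _.
  by have [/trT->|le_ki] := ltnP i k; [rewrite mul0r | rewrite tr ?mulr0 // (leq_ltn_trans le_ki)].
rewrite mpowS mxE (bigD1 i) //= dg -exprS big1 ?addr0 // => k ne_ki.
have [/trT->|le_ki] := ltnP i k; first by rewrite mul0r.
by rewrite tr ?mulr0 // ltn_neqAle le_ki andbT.
Qed.

End TriangularPowers.

(** The diagonal of a Schur triangular form gives the roots with multiplicity and all power traces
    at once. *)
Lemma trigonal_traces (C : numClosedFieldType) n (M : 'M[C]_n) :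
  exists r : 'I_n -> C, char_poly M = \prod_i ('X - (r i)%:P) /\
    forall m, \tr (mpow M m) = \sum_i r i ^+ m.
Proof.
have [n0|n_gt0] := posnP n.
  subst n.
  exists (fun=> 0); split=> [|m]; last by rewrite /mxtrace !big_ord0.
  by rewrite char_poly_trig ?big_ord0 //; apply/is_trig_mxP=> -[].
have [P /unitarymx_unit uP] := Schur M n_gt0.
rewrite /similar_to conjumx // => trT.
set T := P *m M *m invmx P in trT.
have PM : P *m M = T *m P by rewrite /T mulmxKV.
exists (fun i => T i i); split.
  rewrite -char_poly_trig //; set pP := map_mx polyC P.
  have dP : \det pP != 0 by rewrite det_map_mx polyC_eq0 -unitfE.
  apply: (mulfI dP); rewrite -det_mulmx [RHS]mulrC -det_mulmx; congr (\det _).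
  rewrite /char_poly_mx mulmxBr mulmxBl -!map_mxM PM.
  by rewrite mul_mx_scalar mul_scalar_mx.
move=> m; have PMm : P *m mpow M m = mpow T m *m P.
  elim: m => [|m IHm]; first by rewrite !mpow0 mulmx1 mul1mx.
  by rewrite !mpowS mulmxA PM -mulmxA IHm mulmxA.
have -> : mpow M m = invmx P *m (mpow T m *m P) by rewrite -PMm mulKmx.
rewrite mxtrace_mulC mulmxK //; apply: eq_bigr => i _.
by have [_ ->] := trig_mpow trT m.
Qed.

(** Equal power sums give equal sums of every polynomial over the roots and over the weighted family
    [c]. A polynomial that vanishes at all values but [a] isolates the two multiplicities, which
    characteristic 0 compares as naturals. *)
Lemma mup_char_poly_traces (C : numClosedFieldType) n (M : 'M[C]_n)
    (I : finType) (Q : pred I) (d : I -> nat) (c : I -> C) :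
  (forall m, \tr (mpow M m) = \sum_(i | Q i) (d i)%:R * c i ^+ m) ->
  forall a, mup a (char_poly M) = (\sum_(i | Q i && (c i == a)) d i)%N.
Proof.
have [r [-> trM]] := trigonal_traces M; move=> trc a.
(* Repetitions in [s] are harmless: only the vanishing of [p] at these values and its nonvanishing
   at [a] matter. *)
pose s := [seq b <- codom r ++ codom c | b != a].
pose p := \prod_(b <- s) ('X - b%:P).
have p_a : p.[a] != 0.
  by rewrite -rootE root_prod_XsubC mem_filter eqxx.
have p_b b : b \in codom r ++ codom c -> b != a -> p.[b] = 0.
  by move=> b_s ne_ba; apply/eqP; rewrite -rootE root_prod_XsubC mem_filter ne_ba.
have sum_p : \sum_i p.[r i] = \sum_(i | Q i) (d i)%:R * p.[c i].
  under eq_bigr do rewrite horner_coef.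
  rewrite exchange_big /=; under [RHS]eq_bigr do rewrite horner_coef mulr_sumr.
  rewrite [RHS]exchange_big /=; apply: eq_bigr => k _.
  rewrite -mulr_sumr -trM trc mulr_sumr; apply: eq_bigr => i _.
  exact: mulrCA.
rewrite (bigID (fun i => r i == a)) /= [X in _ + X]big1 ?addr0 in sum_p; last first.
  by move=> i ne; apply: p_b ne; rewrite mem_cat codom_f.
rewrite [RHS](bigID (fun i => c i == a)) /= [X in _ + X]big1 ?addr0 in sum_p; last first.
  by move=> i /andP[_ ne]; rewrite p_b ?mulr0 // mem_cat codom_f orbT.
have -> : \prod_i ('X - (r i)%:P) = \prod_(y <- codom r) ('X - y%:P).
  by rewrite big_image.
rewrite mu_prod_XsubC; apply/eqP; rewrite -(eqr_nat C) natr_sum.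
rewrite -(inj_eq (mulIf p_a)) mulr_suml; apply/eqP.
transitivity (\sum_(i | r i == a) p.[r i]).
  rewrite (eq_bigr (fun=> p.[a])) => [|i /eqP-> //].
  rewrite sumr_const -[RHS]mulr_natl; congr (_%:R * _).
  by rewrite -sum1_count big_image_cond /= sum1_card.
by rewrite sum_p; apply: eq_bigr => i /andP[_ /eqP->].
Qed.

(** * From insertions and deletions to moves of the chain *)

Section Moves.
Variables (N : nat) (K : comNzRingType).
Implicit Types (w u : seq 'I_N).

Lemma wact_shw c (f : seq 'I_N -> K) w :
  wact (shw c) f w = \sum_(j < (size w).+1) f (take j w ++ c :: drop j w).
Proof.
elim: w f => [|x w IHw] f.
  by rewrite /wact /= big_seq1 big_ord_recl big_ord0 addr0.
by rewrite /wact /= big_cons big_map big_ord_recl /= -/(wact _ (fun u => f (x :: u)) w) IHw.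
Qed.

Lemma sum_wact_delw x0 (g : 'I_N -> seq 'I_N -> K) w :
  \sum_c wact (delw c) (g c) w =
  \sum_(i < size w) g (nth x0 w i) (take i w ++ drop i.+1 w).
Proof.
elim: w g => [|x w IHw] g.
  by rewrite big_ord0 big1 // => c _; rewrite /wact big_nil.
rewrite big_ord_recl /= drop0.
rewrite -(IHw (fun c u => g c (x :: u))).
under eq_bigr do rewrite /wact /= big_cat big_map sum_nseqb /=.
rewrite big_split /=; congr (_ + _).
rewrite (bigD1 x) //= eqxx mul1r big1 ?addr0 // => c ne_cx.
by rewrite eq_sym (negPf ne_cx) mul0r.
Qed.

Lemma sum_r2r_move n (w : n.-tuple 'I_N) (f : seq 'I_N -> K) :
  \sum_c wact (delw c) (wact (shw c) f) w = \sum_(i < n) \sum_(j < n) f (r2r_move w i j).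
Proof.
case: n w => [|n] w.
  by rewrite big_ord0 tuple0 big1 // => c _; rewrite /wact big_nil.
rewrite (sum_wact_delw (tnth w ord0)) size_tuple; apply: eq_bigr => i _.
rewrite wact_shw (_ : size _ = n) => [|]; last first.
  rewrite size_cat size_take size_drop size_tuple ltn_ord.
  by have := ltn_ord i; lia.
by apply: eq_bigr => j _; rewrite /r2r_move (tnth_nth (tnth w ord0) w i).
Qed.

End Moves.

Lemma r2r_move_perm (A : eqType) n (w : n.-tuple A) (i j : 'I_n) :
  perm_eq (r2r_move w i j) w.
Proof.
have move1 (u1 u2 : seq A) x : perm_eq (u1 ++ x :: u2) (x :: u1 ++ u2).
  by rewrite -cat1s perm_catCA.
apply: perm_trans (move1 _ _ _) _; rewrite cat_take_drop perm_sym.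
apply: perm_trans (move1 _ _ _); rewrite (tnth_nth (tnth w i)).
by rewrite -drop_nth ?size_tuple // cat_take_drop.
Qed.

Lemma sum_codom (V : nmodType) (I J : finType) (e : I -> J) (F : J -> V) :
  injective e -> \sum_(j | j \in codom e) F j = \sum_i F (e i).
Proof.
by move=> inj_e; rewrite -big_uniq ?big_image // map_inj_uniq ?enum_uniq.
Qed.

(** No transition leaves the image of [e], so restriction to it is compatible with products. *)
Lemma mpow_mxsub (K : comNzRingType) n p (M : 'M[K]_n) (e : 'I_p -> 'I_n) m :
  injective e -> (forall s j, j \notin codom e -> M (e s) j = 0) ->
  mpow (mxsub e e M) m = mxsub e e (mpow M m).
Proof.
move=> inj_e M0; elim: m => [|m IHm].
  by apply/matrixP=> s t; rewrite !mxE (inj_eq inj_e).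
rewrite mpowS IHm; apply/matrixP=> s t; rewrite mxE [RHS]mxE mpowS [RHS]mxE.
rewrite [RHS](bigID (mem (codom e))) /= [X in _ = _ + X]big1 ?addr0 => [|k nk]; last first.
  by rewrite M0 ?mul0r.
by rewrite sum_codom //=; apply: eq_bigr => k _; rewrite !mxE.
Qed.

Section Shuffle.
Variables (C : numClosedFieldType) (n N : nat) (nu : intpart n).
Hypothesis (le_nuN : (size nu <= N)%N).
Local Notation R := (@shuffle_mx N C n).

Definition word_index (s : 'I_#|{: word n N nu}|) : 'I_(dm N n) :=
  enum_rank (val (enum_val s)).

Lemma word_index_inj : injective word_index.
Proof. by move=> s t /enum_rank_inj/val_inj/enum_val_inj. Qed.

Lemma codom_word_index j : (j \in codom word_index) = has_eval nu (enum_val j).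
Proof.
apply/codomP/idP=> [[s ->]|ev_j]; first by rewrite enum_rankK; apply: (valP (enum_val s)).
exists (enum_rank (exist _ (enum_val j) ev_j : word n N nu)).
by rewrite /word_index enum_rankK /= enum_valK.
Qed.

Lemma RR_move i j : R i j = \sum_(a < n) \sum_(b < n)
  (r2r_move (enum_val i) a b == enum_val j :> seq _)%:R.
Proof.
rewrite /shuffle_mx summxE; under eq_bigr do rewrite DSE.
exact: (sum_r2r_move (enum_val i) (ind C j)).
Qed.

Lemma r2r_mxE : r2r_mx C n N nu = (n%:R ^+ 2)^-1 *: mxsub word_index word_index R.
Proof.
apply/matrixP=> s t; rewrite !mxE RR_move /r2r_prob !enum_rankK mulr_sumr.
apply: eq_bigr => a _; rewrite -mulr_sumr mulrA -invfM -expr2.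
by [].
Qed.

Lemma RR_eval s j : j \notin codom word_index -> R (word_index s) j = 0.
Proof.
rewrite codom_word_index => nev; rewrite RR_move big1 // => a _; rewrite big1 // => b _.
case: eqP => // eq_j; case/negP: nev; apply/forallP=> c.
rewrite -eq_j; have /seq.permP-> := r2r_move_perm (enum_val (word_index s)) a b.
by rewrite enum_rankK; have /forallP := valP (enum_val s); apply.
Qed.

Lemma mpowZ p (M : 'M[C]_p) (c : C) m : mpow (c *: M) m = c ^+ m *: mpow M m.
Proof.
elim: m => [|m IHm]; first by rewrite !mpow0 scale1r.
by rewrite !mpowS IHm -scalemxAr -scalemxAl scalerA exprSr.
Qed.

Lemma mon_X (w : seq 'I_N) :
  mon (@x_ N C) w = 'X_[[multinom count_mem i w | i < N]].
Proof.
rewrite mpolyXE_id; elim: w => [|a w IHw].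
  by rewrite /mon big_nil big1 // => i _; rewrite mnmE.
rewrite mon_cons IHw /x_ [in RHS](bigD1 a) //= [in LHS](bigD1 a) //= mulrA.
rewrite !mnmE /= eqxx add1n exprS; congr (_ * _).
by apply: eq_bigr => i ne_ia; rewrite !mnmE /= eq_sym (negPf ne_ia).
Qed.

(** The exponent of the monomial of a word is its evaluation, so a coefficient of the graded trace
    is the trace over one evaluation class. *)
Lemma mcoeff_ftr m : (full_trace N C n m 0)@_[multinom nth 0%N nu i | i < N] =
  \sum_s mpow R m (word_index s) (word_index s).
Proof.
rewrite ftrE chiR_trace raddf_sum /=.
under eq_bigr do rewrite mon_X mcoeffCM mcoeffX.
have evE i : ([multinom count_mem a (wd i) | a < N] == [multinom nth 0%N nu i | i < N]) =
    (i \in codom word_index).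
  rewrite codom_word_index; apply/eqP/forallP=> [/mnmP ev a|ev].
    by have := ev a; rewrite !mnmE => /eqP.
  by apply/mnmP=> a; rewrite !mnmE; apply/eqP/ev.
under eq_bigr do rewrite evE mulr_natr mulrb.
by rewrite -big_mkcond sum_codom //; apply: word_index_inj.
Qed.

Lemma trace_r2r m : \tr (mpow (r2r_mx C n N nu) m) =
  (n%:R ^+ 2)^-1 ^+ m * (full_trace N C n m 0)@_[multinom nth 0%N nu i | i < N].
Proof.
rewrite r2r_mxE mpowZ mxtraceZ mcoeff_ftr; congr (_ * _).
rewrite (mpow_mxsub _ word_index_inj RR_eval).
by apply: eq_bigr => s _; rewrite mxE.
Qed.

Lemma trace_r2r_sum m : \tr (mpow (r2r_mx C n N nu) m) =
  \sum_(la : intpart n | (size la <= N)%N) \sum_(k < n.+1)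
    \sum_(mu : intpart k | horizontal_strip la mu)
      (kostka la nu * desarr_num mu)%:R *
        ((n%:R ^+ 2)^-1 * (eig la mu)%:~R) ^+ m.
Proof.
rewrite trace_r2r (weight_coef (fun s => msym_ftr C s n m 0) le_nuN) mulr_sumr.
apply: eq_bigr => la sla; rewrite -fcoefE fcoef_trace // !mulr_sumr.
apply: eq_bigr => k _; rewrite !mulr_sumr; apply: eq_bigr => mu _.
by rewrite natrM exprMn; ring.
Qed.

End Shuffle.

Lemma mup_r2r (C : numClosedFieldType) (n N : nat) (nu : intpart n) (eps : C) :
  (0 < n)%N -> (size nu <= N)%N ->
  mup ((n%:R ^+ 2)^-1 * eps) (char_poly (r2r_mx C n N nu))
  = (\sum_(la : intpart n | dominates la nu) \sum_(k < n.+1)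
       \sum_(mu : intpart k | horizontal_strip la mu && ((eig la mu)%:~R == eps))
         kostka la nu * desarr_num mu)%N.
Proof.
move=> n_gt0 le_nuN; have n2_neq0 : (n%:R ^+ 2)^-1 != 0 :> C.
  by rewrite invr_eq0 expf_eq0 pnatr_eq0 -lt0n n_gt0.
(* The triple sum is flattened into one finite index type, as the comparison of traces requires. *)
pose J (la : intpart n) : finType := {k : 'I_n.+1 & intpart k}.
pose I := {la : intpart n & J la}.
pose Q (p : I) := (size (tag p) <= N)%N && horizontal_strip (tag p) (tagged (tagged p)).
pose d (p : I) := (kostka (tag p) nu * desarr_num (tagged (tagged p)))%N.
pose e (p : I) : C := (eig (tag p) (tagged (tagged p)))%:~R.
rewrite (@mup_char_poly_traces C _ _ I Q d (fun p => (n%:R ^+ 2)^-1 * e p)); last first.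
  move=> m; rewrite (trace_r2r_sum C le_nuN).
  rewrite -(sig_big_dep (fun la : intpart n => size la <= N)%N
    (fun la (p : J la) => horizontal_strip la (tagged p))
    (fun la p => (kostka la nu * desarr_num (tagged p))%:R *
                 ((n%:R ^+ 2)^-1 * (eig la (tagged p))%:~R) ^+ m)) /=.
  apply: eq_bigr => la _.
  by rewrite (sig_big_dep xpredT (fun (k : 'I_n.+1) (mu : intpart k) => horizontal_strip la mu)).
transitivity (\sum_(la : intpart n | (size la <= N)%N) \sum_(k < n.+1)
       \sum_(mu : intpart k | horizontal_strip la mu && ((eig la mu)%:~R == eps))
         kostka la nu * desarr_num mu)%N.
  under [RHS]eq_bigr => la _ do rewrite (sig_big_dep xpredT (fun (k : 'I_n.+1) (mu : intpart k) =>
    horizontal_strip la mu && ((eig la mu)%:~R == eps))) /=.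
  rewrite (sig_big_dep (fun la : intpart n => size la <= N)%N
    (fun la (p : J la) => horizontal_strip la (tagged p) && ((eig la (tagged p))%:~R == eps))
    (fun la p => (kostka la nu * desarr_num (tagged p))%N)) /=.
  by apply: eq_bigl => p; rewrite -andbA (inj_eq (mulfI n2_neq0)).
(* The bound on rows and dominance select the same nonzero terms: a nonzero Kostka number implies
   both. *)
rewrite big_mkcond [RHS]big_mkcond; apply: eq_bigr => la _; set G := bigop _ _ _.
have [k0|/kostka_neq0[sla ->]] := eqVneq (kostka la nu) 0%N; last by rewrite (leq_trans sla).
have -> : G = 0%N by rewrite /G big1 // => k _; rewrite big1 // => mu _; rewrite k0.
by rewrite !if_same.
Qed.

Theorem theorem5 (C : numClosedFieldType) (n N : nat) (nu : intpart n)
    (n_gt0 : (0 < n)%N) (le_nuN : (size nu <= N)%N) :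
  [/\ (forall (la : intpart n) (k : nat) (mu : intpart k),
         horizontal_strip la mu ->
         eig la mu = ('C(n.+1, 2))%:Z - ('C(k.+1, 2))%:Z + diag_skew la mu),
      (forall a : C, eigenvalue (r2r_mx C n N nu) a ->
         exists (la : intpart n) (k : nat) (mu : intpart k),
           [/\ horizontal_strip la mu,
               dominates la nu,
               parts mu <> [:: n],
               (forall r : nat, odd r -> parts mu <> nseq r 1%N)
             & a = (n%:R ^+ 2)^-1 * (eig la mu)%:~R])
    & (forall eps : C,
         mup ((n%:R ^+ 2)^-1 * eps) (char_poly (r2r_mx C n N nu))
         = (\sum_(la : intpart n | dominates la nu)
              \sum_(k < n.+1)
                \sum_(mu : intpart k |
                        horizontal_strip la mu && ((eig la mu)%:~R == eps))
                  kostka la nu * desarr_num mu)%N)].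
Proof.
split=> [la k mu|a|eps]; [exact: eig_strip | | exact: mup_r2r].
have n2_neq0 : n%:R ^+ 2 != 0 :> C by rewrite expf_eq0 pnatr_eq0 -lt0n n_gt0.
have monic_p := char_poly_monic (r2r_mx C n N nu).
(* Writing [a] as n^-2 times n^2 a makes the multiplicity formula applicable; a positive
   multiplicity has a nonzero summand. *)
rewrite eigenvalue_root_char -dvdp_XsubCl XsubC_dvd ?monic_neq0 // -(mulKf n2_neq0 a).
rewrite mup_r2r // lt0n sum_nat_eq0 => /forallPn[la]; rewrite negb_imply => /andP[dom].
rewrite sum_nat_eq0 => /forallPn[k]; rewrite negb_imply sum_nat_eq0 => /forallPn[mu].
rewrite negb_imply => /andP[/andP[hs /eqP eig_a]].
(* The nonzero summand has d^mu != 0, which excludes the row and the columns of odd length. *)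
rewrite muln_eq0 negb_or => /andP[_ dmu]; exists la, k, mu; split=> //.
- by move=> mu_n; move: dmu; rewrite mu_n desarr_num_row.
- by move=> r odd_r mu_r; move: dmu; rewrite mu_r desarr_num_column odd_r.
by rewrite eig_a.
Qed.
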